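(* Let $\gamma\in(0,1)$, $S=[-\frac\pi2,\frac\pi2]$, $\theta_0\in(0,\frac\pi2)$, $S_0=[-\theta_0,\theta_0]$, let $\mathcal K$ be a Markov kernel on $S$, and let $\zeta=(\zeta_n)_{n\ge0}$, $\zeta_n=(Z_n,\chi_n,\alpha_n)$, be the stochastic billiards collisions process in $\mathcal D_\gamma$ with reflection kernel $\mathcal K$, as constructed in the context. Suppose: (B1) $\mathcal K(\alpha,S_0)=1$ for all $\alpha\in S$. (B2) There is a bounded measurable $\kappa:S^2\to[0,\infty)$ with $\mathcal K(\alpha,B)=\int_B\kappa(\alpha,\beta)\,d\beta$ for all $\alpha \in S$ and Borel $B\subseteq S$, and $\kappa$ is uniformly equicontinuous in each argument: for any $\varepsilon>0$ there is $\delta>0$ such that $\sup_{\alpha\in S}|\kappa(\alpha,\beta)-\kappa(\alpha,\beta')|\le\varepsilon$ whenever $\beta,\beta'\in S$, $|\beta-\beta'|\le\delta$, and $\sup_{\beta\in S}|\kappa(\alpha,\beta)-\kappa(\alpha',\beta)|\le\varepsilon$ whenever $\alpha,\alpha'\in S$, $|\alpha-\alpha'|\le\delta$. (B3) There is $\varepsilon>0$ with $\mathcal K(\alpha,[\varepsilon,\frac\pi2])\ge\varepsilon$ for all $\alpha\in S$. (B4) $\mathcal K$ has a unique invariant probability measure, whose density is denoted $\varpi$. Suppose also that $\rho_1(\alpha):=\int_S\kappa(\alpha,\beta)\tan\beta\,d\beta=0$ for all $\alpha\in S$. Define $$\gamma_{\mathrm c,0}:=\frac{\int_S\varpi(\alpha)\tan^2\alpha\,d\alpha}{1+2\int_S\varpi(\alpha)\tan^2\alpha\,d\alpha}.$$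 Then $\zeta$ is transient if $\gamma_{\mathrm c,0}<\gamma<1$ and recurrent if $0<\gamma<\gamma_{\mathrm c,0}$.
   Context: Domain and geometry. $\mathcal D_\gamma=\{(x,y)\in[0,\infty)\times\mathbb R:|y|\le x^\gamma\}$, with boundary $\partial\mathcal D_\gamma=\{(z,jz^\gamma):z\ge0,\ j\in\{-1,+1\}\}$. Set $\theta(0)=\frac\pi2$ and $\theta(z)=\arctan(\gamma z^{\gamma-1})$ for $z>0$ (magnitude of the angle between the inward normal at $(z,jz^\gamma)$ and the vertical). For $z\ge0$, $j\in\{-1,+1\}$, $\beta\in S$, $t>0$ let $\ell_t(z,j,\beta)=(z,jz^\gamma)+t\,(\sin(\theta(z)+\beta),\,-j\cos(\theta(z)+\beta))$ (the ray leaving $(z,jz^\gamma)$ at angle $\beta$ to the inward normal). Let $\lambda(z,j,\beta)=\inf\{t>0:\ell_t(z,j,\beta)\in\partial\mathcal D_\gamma\}$ and $\Lambda(z,j,\beta)=(\Lambda_1,\Lambda_2)(z,j,\beta)=\ell_{\lambda}(z,j,\beta)$ if $\lambda=\lambda(z,j,\beta)<\infty$, $\Lambda=(0,0)$ otherwise. With $\mathrm{sgn}(x)=1$ if $x\ge0$ and $-1$ if $x<0$, define for $z>0$: $\Theta(z,j,\beta)=\beta+\theta(z)+\theta(\Lambda_1(z,j,\beta))$ if $j\Lambda_2(z,j,\beta)<0$, and $\Theta(z,j,\beta)=\mathrm{sgn}(\beta)\pi-\beta-\theta(z)+\theta(\Lambda_1(z,j,\beta))$ otherwise; and $\Theta(0,j,\beta)=\frac\pi2-|\beta|+\theta(\Lambda_1(0,j,\beta))$.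 Collisions process. $\zeta_n=(Z_n,\chi_n,\alpha_n)\in[0,\infty)\times\{-1,+1\}\times S$ is the Markov chain with arbitrary initial state (with $\chi_0=1$ if $Z_0=0$) and the following dynamics. Given $\zeta_n$: if $Z_n>0$, draw an outgoing angle $\beta_n$ from $\mathcal K(\alpha_n,\cdot)$ (using an independent uniform random input $U_n$ at each step); if $Z_n=0$, take $\beta_n$ uniform on $S_0$. Then set $Z_{n+1}=\Lambda_1(Z_n,\chi_n,\beta_n)$, $\chi_{n+1}=\mathrm{sgn}(\Lambda_2(Z_n,\chi_n,\beta_n))$, $\alpha_{n+1}=\Theta(Z_n,\chi_n,\beta_n)$. (Here $Z_n$ is the horizontal coordinate of the collision point, $\chi_n$ the sign of the vertical coordinate, $\alpha_n$ the incoming angle.) Definitions. $\zeta$ is transient if $\lim_{n\to\infty}Z_n=\infty$ a.s., and recurrent if $\liminf_{n\to\infty}Z_n<\infty$ a.s. A measure $\mu$ is invariant for $\mathcal K$ if $\mu(B)=\int_S\mu(d\alpha)\mathcal K(\alpha,B)$ for all Borel $B\subseteq S$; under (B2) every invariant measure has a density. *)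

(* Defs.v *)
From HB Require Import structures.
From mathcomp Require Import all_boot all_order all_algebra.
From mathcomp Require Import all_classical all_reals all_analysis.
Set Implicit Arguments.
Unset Strict Implicit.
Unset Printing Implicit Defensive.
Import Order.TTheory GRing.Theory Num.Theory.
Import numFieldNormedType.Exports.
Local Open Scope classical_set_scope.
Local Open Scope ring_scope.

(** * Geometry of the domain |y| <= x ^ gamma *)

Definition angles {R : realType} : set R := `[- (pi / 2), pi / 2].

(* The sign is 1 at 0, unlike [Num.sg]. *)
Definition sgn {R : realType} (x : R) : R := if 0 <= x then 1 else -1.

Definition boundary {R : realType} (gamma : R) : set (R * R) :=
  [set p | exists z j : R,
     [/\ 0 <= z, j = 1 \/ j = -1 & p = (z, j * z `^ gamma)]].

Definition theta {R : realType} (gamma z : R) : R :=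
  if z == 0 then pi / 2 else atan (gamma * z `^ (gamma - 1)).

Definition ray {R : realType} (gamma z j beta t : R) : R * R :=
  (z + t * sin (theta gamma z + beta),
   j * z `^ gamma - t * (j * cos (theta gamma z + beta))).

(* Extended-real valued, so that a ray which never meets the boundary again
   has hitting time +oo. *)
Definition hit_time {R : realType} (gamma z j beta : R) : \bar R :=
  ereal_inf [set t%:E | t in
    [set t : R | 0 < t /\ boundary gamma (ray gamma z j beta t)]].

Definition hit_point {R : realType} (gamma z j beta : R) : R * R :=
  if hit_time gamma z j beta is t%:E then ray gamma z j beta t else (0, 0).

Definition incoming_angle {R : realType} (gamma z j beta : R) : R :=
  let p := hit_point gamma z j beta in
  if z == 0 then pi / 2 - `|beta| + theta gamma p.1
  else if j * p.2 < 0 then beta + theta gamma z + theta gamma p.1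
  else sgn beta * pi - beta - theta gamma z + theta gamma p.1.

(** * The collisions process *)

(* A state is a triple (z, j, alpha): horizontal coordinate of the collision
   point, sign of its vertical coordinate, incoming angle. *)
Definition next_state {R : realType} (gamma : R) (s : R * R * R) (beta : R) :
    R * R * R :=
  let: (z, j, _) := s in
  let p := hit_point gamma z j beta in
  (p.1, sgn p.2, incoming_angle gamma z j beta).

Definition initial_state {R : realType} (s : R * R * R) : Prop :=
  let: (z, j, alpha) := s in
  [/\ 0 <= z, j = 1 \/ j = -1, alpha \in angles & z = 0 -> j = 1].

(* The law of the outgoing angle given the current state. *)
Definition outgoing_law {R : realType} (theta0 : R) (htheta0 : 0 < theta0)
    (K : R.-pker R ~> R) (s : R * R * R) (B : set R) : \bar R :=
  let: (z, _, alpha) := s in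
  if 0 < z then K alpha B else uniform_prob (gtrN htheta0) B.

(* The sigma-algebra generated by zeta_0, ..., zeta_n. *)
Definition history {R : realType} (d : measure_display)
    (Omega : measurableType d) (P : probability Omega R)
    (zeta : nat -> {RV P >-> (R * R * R)%type}) (n : nat) : set (set Omega) :=
  <<s [set A | exists k (B : set (R * R * R)),
        [/\ (k <= n)%N, measurable B & A = zeta k @^-1` B]] >>.

(* [collisions_law] says that, conditionally on zeta_0, ..., zeta_n, the
   outgoing angle beta_n has law [outgoing_law (zeta n)].  States at later times
   belong to [0, oo) x {-1, 1} x angles almost surely, so the values of K
   outside [angles] play no role. *)
Record collisions_process {R : realType} (gamma theta0 : R)
    (htheta0 : 0 < theta0) (K : R.-pker R ~> R) (d : measure_display)
    (Omega : measurableType d) (P : probability Omega R)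
    (zeta : nat -> {RV P >-> (R * R * R)%type})
    (beta : nat -> {RV P >-> R}) : Prop := {
  collisions_init : forall w, initial_state (zeta 0%N w) ;
  collisions_step : forall n w,
    zeta n.+1 w = next_state gamma (zeta n w) (beta n w) ;
  collisions_law : forall n (A : set Omega) (B : set R),
    history zeta n A -> measurable B ->
    P (A `&` beta n @^-1` B) =
      (\int[P]_(w in A) outgoing_law htheta0 K (zeta n w) B)%E }.

Definition transient {R : realType} (d : measure_display)
    (Omega : measurableType d) (P : probability Omega R)
    (zeta : nat -> {RV P >-> (R * R * R)%type}) : Prop :=
  {ae P, forall w, (zeta n w).1.1 @[n --> \oo] --> +oo}.

Definition recurrent {R : realType} (d : measure_display)
    (Omega : measurableType d) (P : probability Omega R)
    (zeta : nat -> {RV P >-> (R * R * R)%type}) : Prop :=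
  {ae P, forall w, (limn_einf (fun n => ((zeta n w).1.1)%:E) < +oo)%E}.

(** * The reflection kernel *)

(* A Markov kernel on [angles] is represented by a probability kernel on R
   (extended arbitrarily to arguments outside [angles]), and likewise a
   probability measure on [angles] by one on R giving mass 1 to [angles]. *)
Definition markov_on_angles {R : realType} (K : R.-pker R ~> R) : Prop :=
  forall alpha, alpha \in angles -> K alpha angles = 1%E.

Definition concentrated {R : realType} (theta0 : R) (K : R.-pker R ~> R) :
    Prop :=
  forall alpha, alpha \in angles -> K alpha `[- theta0, theta0]%classic = 1%E.

Definition regular_density {R : realType} (K : R.-pker R ~> R)
    (kappa : R -> R -> R) : Prop :=
  [/\ measurable_fun (angles `*` angles)
        (fun p : R * R => kappa p.1 p.2),
      {in angles &, forall alpha beta, 0 <= kappa alpha beta},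
      exists M : R, {in angles &, forall alpha beta, kappa alpha beta <= M},
      forall alpha (B : set R), alpha \in angles ->
        measurable B -> B `<=` angles ->
        K alpha B = (\int[lebesgue_measure]_(beta in B) (kappa alpha beta)%:E)%E
    & forall eps : R, 0 < eps -> exists2 delta : R, 0 < delta &
        (forall beta beta', beta \in angles -> beta' \in angles ->
           `|beta - beta'| <= delta ->
           {in angles, forall alpha,
             `|kappa alpha beta - kappa alpha beta'| <= eps}) /\
        (forall alpha alpha', alpha \in angles -> alpha' \in angles ->
           `|alpha - alpha'| <= delta ->
           {in angles, forall beta,
             `|kappa alpha beta - kappa alpha' beta| <= eps}) ].

Definition uniformly_positive {R : realType} (K : R.-pker R ~> R) : Prop :=
  exists2 eps : R, 0 < eps &
    forall alpha, alpha \in angles -> (eps%:E <= K alpha `[eps, (pi / 2)%R]%classic)%E.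

Definition invariant_probability {R : realType} (K : R.-pker R ~> R)
    (mu : probability R R) : Prop :=
  mu angles = 1%E /\
  forall B : set R, measurable B -> B `<=` angles ->
    mu B = (\int[mu]_(alpha in angles) K alpha B)%E.

Definition unique_invariant_probability {R : realType} (K : R.-pker R ~> R)
    (mu : probability R R) : Prop :=
  invariant_probability K mu /\
  forall nu : probability R R, invariant_probability K nu ->
    forall B : set R, measurable B -> nu B = mu B.

Definition density_on_angles {R : realType} (mu : probability R R)
    (varpi : R -> R) : Prop :=
  [/\ measurable_fun angles varpi,
      {in angles, forall alpha, 0 <= varpi alpha}
    & forall B : set R, measurable B -> B `<=` angles ->
        mu B = (\int[lebesgue_measure]_(alpha in B) (varpi alpha)%:E)%E].

Definition rho1 {R : realType} (kappa : R -> R -> R) (alpha : R) : R :=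
  \int[lebesgue_measure]_(beta in angles) (kappa alpha beta * tan beta).

Definition gamma_c0 {R : realType} (varpi : R -> R) : R :=
  let I := \int[lebesgue_measure]_(alpha in angles)
             (varpi alpha * tan alpha ^+ 2) in
  I / (1 + 2 * I).

(* Main.v *)
Require Import Defs.
From HB Require Import structures.
From mathcomp Require Import all_boot all_order all_algebra.
From mathcomp Require Import all_classical all_reals all_analysis.
From mathcomp Require Import measurable_realfun lra ring.
Import Order.TTheory GRing.Theory Num.Theory.
Import numFieldNormedType.Exports.
Set Implicit Arguments.
Unset Strict Implicit.
Unset Printing Implicit Defensive.
Local Open Scope classical_set_scope.
Local Open Scope ring_scope.

(** Put y = z^(gamma-1).  A collision at a large abscissa z with outgoing angle b
    and T = tan b leads to an abscissa z' with
      z' / z = 1 + 2 y T + 2 gamma y^2 (1 + 2 T^2) + O(y^3),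
    and to an incoming angle b + O(y).  Since rho1 = 0, the term of order y
    averages out, and z^p changes in mean by the factor
      1 + y^2 (2 p gamma + (4 p gamma + 2 p (p - 1)) rho2(alpha)),
    where rho2(alpha) is the mean of tan^2 under K(alpha, .).  By (B2) and the
    uniqueness in (B4) the Cesaro averages of the powers of K converge uniformly,
    which gives an approximate solution psi of the Poisson equation for rho2; with
    V = z^p (1 + y^2 psi(alpha)) the function rho2 is replaced by its mean rho,
    and the drift of V is, up to small errors,
      z^p y^2 p (2 (gamma (1 + 2 rho) - rho) + 2 p rho).
    It is negative for small p of sign opposite to gamma - gamma_c0.  If p > 0, V
    is large far out and Fatou's lemma excludes Z_n -> oo.  If p < 0, V is small
    far out, and a return from above z2 to below z0 has probability
    O((z2 / z0)^p); by (B3) a bounded number of jumps to the right, which happens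
    with probability bounded below, crosses any given level, so Z_n -> oo. *)

(** * Real powers and the arctangent *)

(** The correction [psi] is read at the incoming angle, which differs from the outgoing one by O(y),
    so it must be uniformly continuous; but tan^2 cut off at [theta0] is discontinuous, and a
    Poisson solution built from it is only bounded and measurable. Hence the Poisson equation is
    solved after one extra application of K, whose density is equicontinuous. Cesaro averages
    replace powers of K because (B4) does not exclude periodicity. The law of the initial state is
    arbitrary, so z^p need not be integrable. Every supermartingale inequality is therefore stated
    between integrals over an event of the history on which z >= 2 x, so that one jump cannot fall
    below x, the level at which V is frozen. Stopping times are replaced by shrinking sequences of
    such events. One direction is singular: for theta z + b = pi / 2 the ray is horizontal, misses
    the boundary, and the chain is sent to the tip by convention. Far out this cannot occur with |b|
    <= theta0; elsewhere it is a single angle for each z, of probability 0 under either outgoing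
    law. *)

Lemma powR_lt_tangent1 (R : realType) (g u : R) : 0 < g < 1 -> 0 <= u ->
  u != 1 -> u `^ g < 1 + g * (u - 1).
Proof.
move=> /andP[g0 g1]; rewrite le_eqVlt => /predU1P[<- _|u0 u1].
  by rewrite powR0 ?gt_eqF//; lra.
set m := 1 + g * (u - 1).
have m0 : 0 < m by rewrite /m; have := mulr_gt0 g0 u0; lra.
have um : ln u - ln m != 0.
  rewrite subr_eq0; apply/eqP => /ln_inj; rewrite !posrE => /(_ u0 m0) umE.
  move: u1; rewrite -subr_eq0 => /negP; apply.
  have : (1 - g) * (u - 1) = 0 by move: umE; rewrite /m; lra.
  by move/eqP; rewrite mulf_eq0 => /orP[/eqP ?|//]; exfalso; lra.
(* Weighted arithmetic-geometric inequality: 1 + x <= exp x is used at ln u - ln m and at -ln m with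
   weights g and 1 - g. The right-hand sides average to 1 because m is the weighted mean of u and 1,
   and u != m makes the first inequality strict. *)
have h1 : 1 + (ln u - ln m) < u / m.
  by rewrite (lt_le_trans (expR_gt1Dx um))// expRB !lnK ?posrE.
have h2 : 1 + - ln m <= m^-1.
  by rewrite (le_trans (expR_ge1Dx _))// expRN lnK ?posrE.
have h3 : g * (1 + (ln u - ln m)) < g * (u / m) by rewrite ltr_pM2l.
have h4 : (1 - g) * (1 + - ln m) <= (1 - g) * m^-1.
  by rewrite ler_pM2l//; lra.
have h5 : g * (u / m) + (1 - g) * m^-1 = 1.
  by rewrite mulrA -mulrDl [X in X / m](_ : _ = m) ?divff ?gt_eqF// /m; ring.
rewrite /powR gt_eqF// -[ltRHS](@lnK _ m) ?posrE// ltr_expR.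
by rewrite -subr_gt0; lra.
Qed.

Lemma powR_lt_tangent (R : realType) (g x x1 : R) : 0 < g < 1 -> 0 <= x ->
  0 < x1 -> x != x1 -> x `^ g < x1 `^ g + g * x1 `^ (g - 1) * (x - x1).
Proof.
move=> g01 x0 x10 xx1.
have x1g : 0 < x1 `^ g by rewrite powR_gt0.
have u1 : x / x1 != 1.
  by apply: contra xx1 => /eqP/divr1_eq ->.
have := powR_lt_tangent1 g01 (divr_ge0 x0 (ltW x10)) u1.
rewrite -(ltr_pM2r x1g) -powRM ?divr_ge0 ?(ltW x10)// divfK ?gt_eqF//.
suff -> : (1 + g * (x / x1 - 1)) * x1 `^ g =
  x1 `^ g + g * x1 `^ (g - 1) * (x - x1) by [].
by rewrite -(mulr_powRB1 (ltW x10) (andP g01).1); field; exact: lt0r_neq0.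
Qed.

Lemma powR_le_tangent (R : realType) (g x x1 : R) : 0 < g < 1 -> 0 <= x ->
  0 < x1 -> x `^ g <= x1 `^ g + g * x1 `^ (g - 1) * (x - x1).
Proof.
move=> g01 x0 x10; have [->|/(powR_lt_tangent g01 x0 x10)/ltW//] := eqVneq x x1.
by rewrite subrr mulr0 addr0.
Qed.

(** Subadditivity of the power: t <= t^s on [0, 1], applied to the fractions x / y and (y - x) / y,
    whose sum is 1. *)
Lemma powRB_le (R : realType) (s x y : R) : 0 < s <= 1 -> 0 <= x <= y ->
  y `^ s - x `^ s <= (y - x) `^ s.
Proof.
move=> /andP[s0 s1] /andP[x0 xy].
have [y0|y0] := leP y 0.
  have -> : y = 0 by lra.
  have -> : x = 0 by lra.
  by rewrite subr0 powR0 ?gt_eqF// subr0.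
have h z : 0 <= z <= 1 -> z <= z `^ s.
  move=> /andP[]; rewrite le_eqVlt => /predU1P[<- _|z0 z1].
    by rewrite powR_ge0.
  by rewrite ger1_powR ?z0.
have xy1 : 0 <= x / y <= 1 by rewrite divr_ge0 ?(ltW y0)//= ler_pdivrMr ?mul1r.
have xy2 : 0 <= (y - x) / y <= 1.
  by rewrite divr_ge0 ?subr_ge0 ?(ltW y0)//= ler_pdivrMr ?mul1r//; lra.
have h1 := h _ xy1; have h2 := h _ xy2.
have ys : 0 <= y `^ s by rewrite powR_ge0.
have e1 : x `^ s = (x / y) `^ s * y `^ s.
  by rewrite -powRM ?divfK ?gt_eqF ?divr_ge0// ltW.
have e2 : (y - x) `^ s = ((y - x) / y) `^ s * y `^ s.
  by rewrite -powRM ?divfK ?gt_eqF ?divr_ge0 ?subr_ge0// ltW.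
have h3 : 1 <= (x / y) `^ s + ((y - x) / y) `^ s.
  by rewrite (le_trans _ (lerD h1 h2))// -mulrDl addrC subrK divff ?gt_eqF.
rewrite lerBlDr e1 e2 -mulrDl -[leLHS]mul1r ler_wpM2r// addrC//.
Qed.

Lemma powR1D_bounded (R : realType) (a : R) :
  exists C : R, forall x : R, `|x| <= 1 / 2 -> `|(1 + x) `^ a| <= C.
Proof.
exists (expR `|a|) => x x12.
have x0 : 0 < 1 + x by move: x12; rewrite ler_norml => /andP[]; lra.
rewrite ger0_norm ?powR_ge0// /powR gt_eqF// ler_expR.
rewrite (le_trans (ler_norm _))// normrM -[leRHS]mulr1 ler_wpM2l//.
have h1 : ln (1 + x) <= x by apply: le_ln1Dx; lra.
have h2 : ln ((1 + x)^-1) <= (1 + x)^-1 - 1.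
  rewrite -[in leLHS](subrK 1 (1 + x)^-1) addrC le_ln1Dx//.
  by rewrite ltrBrDl subrr invr_gt0.
rewrite lnV ?posrE// in h2.
have h3 : (1 + x)^-1 <= 2.
  by rewrite -[leRHS]invrK lef_pV2 ?posrE ?invr_gt0//; move: x12;
     rewrite ler_norml => /andP[]; lra.
by rewrite ler_norml; move: x12; rewrite ler_norml => /andP[] *; apply/andP; split; lra.
Qed.

(** Mean value theorem. Each use turns a bound on the derivative into one with an additional power
    of |x|; starting from boundedness of the power function, three uses give the third-order Taylor
    bound. The constant C is kept, not divided by n + 1. *)
Lemma le_deriv_pow (R : realType) (h dh : R -> R) (n : nat) (C : R) : h 0 = 0 ->
  (forall x : R, `|x| <= 1 / 2 -> is_derive x 1 h (dh x)) ->
  (forall x : R, `|x| <= 1 / 2 -> `|dh x| <= C * `|x| ^+ n) ->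
  forall x : R, `|x| <= 1 / 2 -> `|h x| <= C * `|x| ^+ n.+1.
Proof.
move=> h0 hd hb x x12.
have C0 : 0 <= C * `|x| ^+ n by rewrite (le_trans _ (hb x x12)).
have hc (a b : R) : `|a| <= 1 / 2 -> `|b| <= 1 / 2 -> {within `[a, b], continuous h}.
  move=> a12 b12; apply: continuous_in_subspaceT => y; rewrite inE/= in_itv/= => /andP[ay yb].
  have y12 : `|y| <= 1 / 2.
    by move: a12 b12; rewrite !ler_norml => /andP[? ?] /andP[? ?]; apply/andP; split; lra.
  by apply: differentiable_continuous; apply/derivable1_diffP; have [] := hd y y12.
have hz : `|0 : R| <= 1 / 2 by rewrite normr0; lra.
have key (y : R) : `|y| <= `|x| -> `|dh y| * `|x| <= C * `|x| ^+ n.+1.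
  move=> yx; rewrite exprSr mulrA ler_wpM2r//.
  rewrite (le_trans (hb _ (le_trans yx x12)))//.
  have [n0|n0] := posnP n; first by rewrite n0 !expr0.
  have [xn0|xn0] := eqVneq x 0.
    by move: yx; rewrite xn0 normr0 => yx; rewrite (_ : `|y| = 0)//; apply/eqP; rewrite eq_le yx/=.
  rewrite ler_wpM2l//; last by rewrite lerXn2r ?nnegrE.
  by move: C0; rewrite pmulr_lge0// exprn_gt0// normr_gt0.
have [x0|x0] := leP 0 x.
- have [| |c] := @MVT_segment _ h dh 0 x x0.
  + move=> y; rewrite in_itv/= => /andP[y0 yx]; apply: hd.
    by rewrite (le_trans _ x12)// !ger0_norm// ltW.
  + exact: hc.
  rewrite in_itv/= => /andP[c0 cx]; rewrite h0 !subr0 => ->.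
  by rewrite normrM key// !ger0_norm.
- have [| |c] := @MVT_segment _ h dh x 0 (ltW x0).
  + move=> y; rewrite in_itv/= => /andP[y0 yx]; apply: hd.
    by rewrite (le_trans _ x12)// !ltr0_norm// lerN2 ltW.
  + exact: hc.
  rewrite in_itv/= => /andP[c0 cx]; rewrite h0 !sub0r => /eqP.
  rewrite mulrN eqr_opp => /eqP ->.
  by rewrite normrM key// !ler0_norm ?lerN2// ltW.
Qed.

Lemma is_derive_powR1D (R : realType) (a x : R) : `|x| <= 1 / 2 ->
  is_derive x 1 (fun y => (1 + y) `^ a) (a * (1 + x) `^ (a - 1)).
Proof.
move=> x12; have x0 : 0 < 1 + x by move: x12; rewrite ler_norml => /andP[]; lra.
have h1 : is_derive x 1 (fun y : R => 1 + y) 1.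
  have := is_deriveD (is_derive_cst (1 : R) x 1) (is_derive_id x 1).
  by rewrite add0r.
have := @is_derive1_comp _ (fun y : R => y `^ a) (fun y : R =>
  1 + y) x _ _ (is_derive1_powR a x0) h1.
by rewrite mulr1.
Qed.

Lemma powR1D_taylor1 (R : realType) (a : R) :
  exists C : R, forall x : R, `|x| <= 1 / 2 -> `|(1 + x) `^ a - 1| <= C * `|x|.
Proof.
have [C hC] := powR1D_bounded (a - 1).
exists (`|a| * C) => x x12; rewrite -[`|x|]expr1.
apply: (@le_deriv_pow _ (fun y => (1 + y) `^ a - 1) (fun y => a * (1 + y) `^ (a - 1)) 0%N) => //.
- by rewrite addr0 powR1 subrr.
- move=> y y12; have ? := is_derive_powR1D a y12.
  by apply: is_derive_eq; rewrite subr0.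
- by move=> y y12; rewrite expr0 mulr1 normrM ler_wpM2l// hC.
Qed.

Lemma powR1D_taylor2 (R : realType) (a : R) :
  exists C : R, forall x : R, `|x| <= 1 / 2 ->
    `|(1 + x) `^ a - (1 + a * x)| <= C * `|x| ^+ 2.
Proof.
have [C hC] := powR1D_taylor1 (a - 1).
exists (`|a| * C) => x x12.
apply: (@le_deriv_pow _ (fun y => (1 + y) `^ a - (1 + a * y)) (fun y =>
  a * (1 + y) `^ (a - 1) - a) 1%N) => //.
- by rewrite addr0 powR1 mulr0 addr0 subrr.
- move=> y y12; have ? := is_derive_powR1D a y12.
  by apply: is_derive_eq; rewrite /GRing.scale/=; ring.
- move=> y y12; rewrite expr1 -[X in _ - X]mulr1 -mulrBr normrM -mulrA.
  by rewrite ler_wpM2l// hC.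
Qed.

Lemma powR1D_taylor3 (R : realType) (a : R) :
  exists C : R, forall x : R, `|x| <= 1 / 2 ->
    `|(1 + x) `^ a - (1 + a * x + a * (a - 1) / 2 * x ^+ 2)| <= C * `|x| ^+ 3.
Proof.
have [C hC] := powR1D_taylor2 (a - 1).
exists (`|a| * C) => x x12.
apply: (@le_deriv_pow _ (fun y => (1 + y) `^ a - (1 + a * y + a * (a - 1) / 2 * y ^+ 2))
  (fun y => a * (1 + y) `^ (a - 1) - (a + a * (a - 1) * y)) 2%N) => //.
- by rewrite addr0 powR1 mulr0 addr0 expr0n/= mulr0 addr0 subrr.
- move=> y y12; have ? := is_derive_powR1D a y12.
  by apply: is_derive_eq; rewrite /GRing.scale/= ?expr1; field.
- move=> y y12.
  have -> : a * (1 + y) `^ (a - 1) - (a + a * (a - 1) * y) =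
    a * ((1 + y) `^ (a - 1) - (1 + (a - 1) * y)) by ring.
  by rewrite normrM -mulrA ler_wpM2l// hC.
Qed.

Lemma atan_lipschitz (R : realType) (x y : R) : x <= y -> atan y - atan x <= y - x.
Proof.
move=> xy; have [|c _ ->] := @MVT_segment _ atan (fun x => (1 + x ^+ 2)^-1) x y xy.
- by apply: continuous_subspaceT => z; exact: continuous_atan.
- by rewrite ler_piMl ?subr_ge0// invf_le1 ?lerDl ?sqr_ge0// ltr_wpDr ?sqr_ge0.
Qed.

Lemma atanV (R : realType) (x : R) : 0 < x -> atan x^-1 = pi / 2 - atan x.
Proof.
move=> x0.
have a0 : 0 < atan x by rewrite -atan0 lt_atan.
have a1 := atan_ltpi2 x.
rewrite -[LHS](_ : atan (tan (pi / 2 - atan x)) = _).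
  by rewrite tanK// in_itv/=; apply/andP; split; have := @pi_gt0 R; lra.
congr atan; rewrite /tan sinB cosB sin_pihalf cos_pihalf !mul0r !mul1r subr0 add0r.
by rewrite -{3}(atanK x) /tan invf_div.
Qed.

(** * The boundary point hit by a ray *)

Lemma theta_gt0 (R : realType) (g z : R) : 0 < g -> 0 <= z -> 0 < theta g z.
Proof.
move=> g0 z0; rewrite /theta; case: ifPn => [_|zn0]; first by have := @pi_gt0 R; lra.
by rewrite -atan0 lt_atan// mulr_gt0// powR_gt0// lt_neqAle eq_sym zn0.
Qed.

Lemma theta_ltpihalf (R : realType) (g z : R) : 0 < z -> theta g z < pi / 2.
Proof. by move=> z0; rewrite /theta gt_eqF// atan_ltpi2. Qed.

Lemma theta_lepihalf (R : realType) (g z : R) : theta g z <= pi / 2.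
Proof. by rewrite /theta; case: ifPn => // _; rewrite ltW// atan_ltpi2. Qed.

Lemma tan_theta (R : realType) (g z : R) : 0 < z ->
  tan (theta g z) = g * z `^ (g - 1).
Proof. by move=> z0; rewrite /theta gt_eqF// atanK. Qed.

Lemma theta_le (R : realType) (g z : R) : 0 < g -> 0 < z ->
  theta g z <= g * z `^ (g - 1).
Proof.
move=> g0 z0; rewrite /theta gt_eqF// -[leLHS]subr0 -[X in _ - X](@atan0 R).
rewrite (le_trans (atan_lipschitz _)) ?subr0//.
by rewrite mulr_ge0 ?powR_ge0// ltW.
Qed.

(** This form has no special case at the tip, since 0^(1 - g) = 0, and exhibits theta as a Lipschitz
    function of z^(1 - g), whereas g z^(g - 1) blows up there. *)
Lemma thetaE (R : realType) (g z : R) : 0 < g < 1 -> 0 <= z ->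
  theta g z = pi / 2 - atan (z `^ (1 - g) / g).
Proof.
move=> /andP[g0 g1]; rewrite le_eqVlt => /predU1P[<-|z0].
  by rewrite /theta eqxx powR0 ?mul0r ?atan0 ?subr0// subr_eq0 gt_eqF.
rewrite /theta gt_eqF// -atanV ?divr_gt0 ?powR_gt0// invf_div -powRN.
by rewrite opprB.
Qed.

(** Combines the Lipschitz bound for [atan] with subadditivity of the power. The bound does not
    involve z, so it yields a distance over which theta falls by at most a given amount, uniformly
    down to the tip. *)
Lemma theta_holder (R : realType) (g z u : R) : 0 < g < 1 -> 0 <= z -> 0 <= u ->
  theta g z - theta g (z + u) <= u `^ (1 - g) / g.
Proof.
move=> g01 z0 u0; have /andP[g0 g1] := g01.
have zu : z <= z + u by lra.
have zug : z `^ (1 - g) <= (z + u) `^ (1 - g).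
  by rewrite ge0_ler_powR ?nnegrE//; lra.
rewrite !thetaE// ?addr_ge0// opprD opprK addrACA subrr add0r addrC.
rewrite (le_trans (atan_lipschitz _))// ?ler_pM2r ?invr_gt0//.
rewrite -mulrBl ler_pM2r ?invr_gt0//.
have := @powRB_le R (1 - g) z (z + u); rewrite (addrC z u) addrK; apply; lra.
Qed.

Lemma boundaryE (R : realType) (g : R) (p : R * R) :
  boundary g p <-> 0 <= p.1 /\ `|p.2| = p.1 `^ g.
Proof.
split=> [[z [j [z0 j1 ->]]]|[p0 pE]]/=.
  by split=> //; case: j1 => ->; rewrite ?mulN1r ?mul1r ?normrN ger0_norm ?powR_ge0.
exists p.1, (sgn p.2); split=> //; first by rewrite /sgn; case: ifPn; [left|right].
rewrite [LHS]surjective_pairing -pE /sgn; congr pair.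
by case: (leP 0 p.2) => p2; rewrite ?mul1r ?mulN1r ?(ger0_norm p2) ?(ltr0_norm p2) ?opprK.
Qed.

Lemma cos_le0_pihalf (R : realType) (x : R) :
  pi / 2 < x < pi + pi / 2 -> cos x < 0.
Proof.
move=> /andP[x1 x2]; rewrite -[x](subrK pi) cosDpi oppr_lt0 cos_gt0_pihalf//.
by apply/andP; split; lra.
Qed.

Lemma sin_cos_neq0 (R : realType) (x : R) : sin x = 0 -> cos x = 0 -> False.
Proof. by move=> s c; have := cos2Dsin2 x; rewrite s c expr0n/= addr0 => /eqP;
  rewrite eq_sym oner_eq0. Qed.

(* Strict concavity of [x ^ g]. *)
Lemma boundary_between (R : realType) (g x0 y0 a b t1 t2 : R) : 0 < g < 1 ->
  0 < t1 -> t1 < t2 -> boundary g (x0, y0) ->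
  boundary g (x0 + t1 * a, y0 + t1 * b) ->
  boundary g (x0 + t2 * a, y0 + t2 * b) -> a = 0 /\ b = 0.
Proof.
move=> g01 t10 t12 /boundaryE[/= x00 y0E] /boundaryE[/= x10 y1E] /boundaryE[/= x20 y2E].
have /andP[g0 g1] := g01.
have t20 : 0 < t2 by lra.
have [x1e|x1p] := eqVneq (x0 + t1 * a) 0.
  have a0 : a = 0.
    apply/eqP; rewrite eq_le; apply/andP; split.
      by rewrite -(pmulr_rle0 _ t10); lra.
    have : 0 <= (t2 - t1) * a by lra.
    by rewrite pmulr_rge0//; lra.
  split=> //; have x0e : x0 = 0 by move: x1e; rewrite a0; lra.
  move: y0E y1E; rewrite x1e x0e powR0 ?gt_eqF// => /normr0_eq0 -> /normr0_eq0.
  by rewrite add0r => /eqP; rewrite mulf_eq0 gt_eqF//= => /eqP.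
have x1p' : 0 < x0 + t1 * a by rewrite lt_neqAle eq_sym x1p.
(* By reflection in the axis the middle point may be taken on the upper branch. The end points
   satisfy y <= x^g on either branch, the tangent at the middle point dominates x^g, strictly at
   [x0], and interpolation along the line gives a contradiction; a vertical line is treated
   apart. *)
wlog y1p : y0 b y0E y1E y2E / 0 <= y0 + t1 * b.
  move=> H; have [|y1n] := leP 0 (y0 + t1 * b); first exact: H.
  have [||||->//] := H (- y0) (- b); rewrite ?normrN// ?mulrN -?opprD ?normrN//; first by lra.
  by move/eqP; rewrite oppr_eq0 => /eqP.
rewrite (ger0_norm y1p) in y1E.
have h0 : y0 <= x0 `^ g by rewrite -y0E ler_norm.
have h2 : y0 + t2 * b <= (x0 + t2 * a) `^ g by rewrite -y2E ler_norm.
set x1 := x0 + t1 * a in x1p' x10 y1E *.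
set m := g * x1 `^ (g - 1).
have l2 : (x0 + t2 * a) `^ g <= x1 `^ g + m * (x0 + t2 * a - x1) by apply: powR_le_tangent.
have [a0|an0] := eqVneq a 0.
  split=> //; apply/eqP; rewrite eq_le; move: h0 h2 y1E; rewrite /x1 a0 !mulr0 !addr0 => h0 h2 y1E.
  apply/andP; split.
    have : (t2 - t1) * b <= 0 by lra.
    by rewrite pmulr_rle0//; lra.
  have : 0 <= t1 * b by lra.
  by rewrite pmulr_rge0.
have l0 : x0 `^ g < x1 `^ g + m * (x0 - x1).
  apply: powR_lt_tangent => //; rewrite /x1 -subr_eq0 opprD addrA subrr add0r oppr_eq0.
  by rewrite mulf_neq0// gt_eqF.
have e : (t2 - t1) * y0 + t1 * (y0 + t2 * b) = t2 * x1 `^ g by rewrite -y1E; ring.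
have k0 : (t2 - t1) * y0 < (t2 - t1) * (x1 `^ g + m * (x0 - x1)).
  by rewrite ltr_pM2l ?subr_gt0// (le_lt_trans h0).
have k2 : t1 * (y0 + t2 * b) <= t1 * (x1 `^ g + m * (x0 + t2 * a - x1)).
  by rewrite ler_pM2l// (le_trans h2).
have e2 : (t2 - t1) * (x1 `^ g + m * (x0 - x1)) + t1 * (x1 `^ g + m * (x0 + t2 * a - x1)) = t2
  * x1 `^ g.
  by rewrite /x1; ring.
by exfalso; lra.
Qed.

Lemma hit_unique (R : realType) (g z j b t1 t2 : R) : 0 < g < 1 -> 0 <= z ->
  j = 1 \/ j = -1 -> 0 < t1 -> 0 < t2 ->
  boundary g (ray g z j b t1) -> boundary g (ray g z j b t2) -> t1 = t2.
Proof.
move=> g01 z0 j1.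
have bz : boundary g (z, j * z `^ g) by exists z, j.
wlog t12 : t1 t2 / t1 < t2.
  move=> H t10 t20 b1 b2; have [t12|t12|//] := ltgtP t1 t2; first exact: H.
  by apply/esym; exact: H.
move=> t10 t20 b1 b2.
have [||s0 /eqP] := @boundary_between R g z (j * z `^ g) (sin (theta g z + b))
  (- (j * cos (theta g z + b))) t1 t2 g01 t10 t12 bz; rewrite ?mulrN//.
rewrite oppr_eq0 mulf_eq0 => /orP[/eqP j0|/eqP c0].
  by case: j1; rewrite j0 => /eqP; rewrite ?(eq_sym 0) ?oppr_eq0 ?oner_eq0.
by case: (sin_cos_neq0 s0 c0).
Qed.

(** By uniqueness the infimum in the hitting time runs over a single value: any boundary point found
    on the open ray is the hit point, and it never has to be shown to be the first one. *)
Lemma hit_pointE (R : realType) (g z j b t : R) : 0 < g < 1 -> 0 <= z ->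
  j = 1 \/ j = -1 -> 0 < t -> boundary g (ray g z j b t) ->
  hit_point g z j b = ray g z j b t.
Proof.
move=> g01 z0 j1 t0 bt; rewrite /hit_point /hit_time.
rewrite (_ : [set t%:E | t in _] = [set t%:E]) ?ereal_inf1//.
apply/seteqP; split=> [_/= [s [s0 bs] <-]|_/= ->]; last by exists t.
by rewrite (hit_unique g01 z0 j1 s0 t0 bs bt).
Qed.

Lemma hit_pointP (R : realType) (g z j b : R) : 0 < g < 1 -> 0 <= z ->
  j = 1 \/ j = -1 -> hit_point g z j b = (0, 0) \/
  exists t, [/\ 0 < t, boundary g (ray g z j b t) & hit_point g z j b = ray g z j b t].
Proof.
move=> g01 z0 j1.
have [[t [t0 bt]]|nt] := pselect (exists t, 0 < t /\ boundary g (ray g z j b t)).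
  by right; exists t; split=> //; exact: hit_pointE.
left; rewrite /hit_point /hit_time (_ : [set t%:E | t in _] = set0) ?ereal_inf0//.
by apply/seteqP; split=> // x [t [t0 bt] _]; apply: nt; exists t.
Qed.

Lemma cos_theta_gt0 (R : realType) (g z : R) : 0 < g -> 0 < z -> 0 < cos (theta g z).
Proof.
move=> g0 z0; apply: cos_gt0_pihalf.
have := theta_gt0 g0 (ltW z0); have := theta_ltpihalf g z0.
by move=> ? ?; apply/andP; split; have := @pi_gt0 R; lra.
Qed.

Lemma sin_theta (R : realType) (g z : R) : 0 < g -> 0 < z ->
  sin (theta g z) = g * z `^ (g - 1) * cos (theta g z).
Proof.
by move=> g0 z0; rewrite -tan_theta// /tan divfK// gt_eqF// cos_theta_gt0.
Qed.

Lemma cos_ge0_lower (R : realType) (phi th : R) : - (pi / 2) < phi < pi ->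
  0 < th < pi / 2 -> 0 <= cos (phi + th) -> - (pi / 2) <= phi + th <= pi / 2.
Proof.
move=> /andP[p1 p2] /andP[t1 t2] c0; apply/andP; split; first by lra.
rewrite leNgt; apply/negP => h4.
have : cos (phi + th) < 0 by apply: cos_le0_pihalf; apply/andP; split; lra.
by rewrite ltNge c0.
Qed.

Lemma cos_le0_right (R : realType) (phi th : R) : 0 <= phi < pi ->
  0 < th < pi / 2 -> cos (phi - th) <= 0 -> pi / 2 <= phi - th <= pi.
Proof.
move=> /andP[p1 p2] /andP[t1 t2] c0; apply/andP; split; last by lra.
rewrite leNgt; apply/negP => h4.
have : 0 < cos (phi - th) by apply: cos_gt0_pihalf; apply/andP; split; lra.
by rewrite ltNge c0.
Qed.

Lemma cos_le0_left (R : realType) (phi th : R) : - (pi / 2) < phi < pi / 2 ->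
  0 < th < pi / 2 -> cos (phi - th) <= 0 -> - pi <= phi - th <= - (pi / 2).
Proof.
move=> /andP[p1 p2] /andP[t1 t2] c0; apply/andP; split; first by lra.
rewrite leNgt; apply/negP => h4.
have : 0 < cos (phi - th) by apply: cos_gt0_pihalf; apply/andP; split=> //; lra.
by rewrite ltNge c0.
Qed.

Lemma sin_ge0_le (R : realType) (b th : R) : 0 <= b < pi / 2 -> 0 < th < pi / 2 ->
  0 <= sin (b - th) -> th <= b.
Proof.
move=> /andP[b1 b2] /andP[t1 t2] s0; rewrite leNgt; apply/negP => h.
have : 0 < sin (- (b - th)) by apply: sin_gt0_pihalf; apply/andP; split; lra.
by rewrite sinN oppr_gt0 ltNge s0.
Qed.

(** At the tip the angle is left free: a ray that misses the boundary is sent to (0, 0) with an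
    incoming angle that can leave [angles], and the outgoing law at the tip does not depend on
    it. *)
Definition good_state (R : realType) (s : R * R * R) : Prop :=
  let: (z, j, alpha) := s in
  [/\ 0 <= z, j = 1 \/ j = -1 & 0 < z -> alpha \in angles].

(** The tangent at the hit point lies above the graph of x^g. Evaluated at the starting abscissa it
    fixes the sign of cos (phi + th') if the two sides are opposite, of cos (phi - th') if they
    agree, and of sin (|b| - th') from the tip. The a priori range of phi = theta z + b then selects
    the right arc. *)
Lemma next_state_good (R : realType) (g theta0 : R) (s : R * R * R) (b : R) :
  0 < g < 1 -> 0 < theta0 < pi / 2 -> good_state s -> `|b| <= theta0 ->
  good_state (next_state g s b).
Proof.
case: s => [[z j] a] g01 /andP[t00 t02] [z0 j1 _] b0; have /andP[g0 g1] := g01.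
have sgn1 (x : R) : sgn x = 1 \/ sgn x = -1 by rewrite /sgn; case: ifPn; [left|right].
rewrite /next_state /=.
have [->|[t [tp bt ->]]] := hit_pointP b g01 z0 j1; first by split=> //=; rewrite ltxx.
have /boundaryE[x'0 y'E] := bt.
split=> // x'p; rewrite /incoming_angle (hit_pointE g01 z0 j1 tp bt).
have hp : 0 < (pi : R) := @pi_gt0 R.
have bpi : `|b| < pi / 2 := le_lt_trans b0 t02.
have [b1 b2] : - (pi / 2) < b /\ b < pi / 2 by move: bpi; rewrite ltr_norml => /andP[].
set p := ray g z j b t in bt x'0 y'E x'p *.
set th' := theta g p.1.
have th'2 : 0 < th' < pi / 2 by rewrite theta_gt0//= theta_ltpihalf.
have cth' : 0 < cos th' by apply: cos_theta_gt0.
set m := g * p.1 `^ (g - 1).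
have sth' : sin th' = m * cos th' by apply: sin_theta.
have tang x : 0 <= x -> x `^ g <= p.1 `^ g + m * (x - p.1) by move=> ?; apply: powR_le_tangent.
have jj : j * j = 1 by case: j1 => ->; rewrite ?mulrNN mul1r.
have nj : `|j| = 1 by case: j1 => ->; rewrite ?normrN1 ?normr1.
have p1E : p.1 = z + t * sin (theta g z + b) by [].
have p2E : p.2 = j * (z `^ g - t * cos (theta g z + b)) by rewrite /p /ray/=; ring.
move: p p1E p2E @th' @m {bt} x'0 y'E x'p th'2 cth' sth' tang =>
  p p1E p2E th' m x'0 y'E x'p th'2 cth' sth' tang.
suff: - (pi / 2) <= (if z == 0 then pi / 2 - `|b| + th' else
    if j * p.2 < 0 then b + theta g z + th' else sgn b * pi - b - theta g z + th') <= pi / 2.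
  by move=> ?; apply/mem_set.
have [z0E|zn0] := eqVneq z 0.
  have cb : cos b = cos `|b| by rewrite cos_norm.
  have sb : `|sin b| = sin `|b|.
    have [bs|bs] := leP 0 b; last rewrite -normrN -sinN (ltr0_norm bs).
      by rewrite (ger0_norm bs) ger0_norm//; apply: sin_ge0_pi; apply/andP; split; lra.
    by rewrite ger0_norm//; apply: sin_ge0_pi; apply/andP; split; lra.
  have hz := tang 0 (lexx _).
  rewrite powR0 ?gt_eqF// sub0r -y'E p2E p1E z0E /theta eqxx in hz.
  rewrite (addrC _ b) powR0 ?gt_eqF// sub0r add0r sinDpihalf cosDpihalf in hz.
  rewrite !mulrN opprK !normrM nj (gtr0_norm tp) cb sb mul1r in hz.
  have h1 : 0 <= t * (sin `|b| - m * cos `|b|) by clear -hz; lra.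
  rewrite pmulr_rge0// in h1.
  have h3 : th' <= `|b|.
    apply: sin_ge0_le => //; first by rewrite normr_ge0.
    rewrite sinB sth' (_ : _ - _ = cos th' * (sin `|b| - m * cos `|b|)); last by ring.
    by rewrite mulr_ge0 ?(ltW cth').
  by clear -bpi h3 th'2 hp; have := normr_ge0 b; lra.
have zp : 0 < z by rewrite lt_neqAle eq_sym zn0.
have th0 : 0 < theta g z by apply: theta_gt0.
have th2 : theta g z < pi / 2 by apply: theta_ltpihalf.
have jp2 : j * p.2 = z `^ g - t * cos (theta g z + b) by rewrite p2E mulrA jj mul1r.
have p2j : `|p.2| = `|j * p.2| by rewrite normrM nj mul1r.
have hz := tang z z0; have zg0 := powR_ge0 z g.
rewrite -y'E p2j p1E in hz.
set phi := theta g z + b in jp2 p1E hz *.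
have phi1 : - (pi / 2) < phi < pi by rewrite /phi; clear -th0 th2 b1 b2; lra.
have bphi : b + theta g z = phi by rewrite addrC.
clearbody phi.
case: ifPn => [jn|]; last rewrite -leNgt => jn.
  rewrite (ltr0_norm jn) jp2 in hz.
  have h1 : 0 <= t * (cos phi - m * sin phi) by clear -hz zg0; lra.
  rewrite pmulr_rge0// in h1.
  rewrite bphi cos_ge0_lower// cosD sth'.
  rewrite (_ : _ - _ = cos th' * (cos phi - m * sin phi)); last by ring.
  by rewrite mulr_ge0 ?(ltW cth').
rewrite (ger0_norm jn) jp2 in hz.
have h1 : 0 <= t * - (cos phi + m * sin phi) by clear -hz; lra.
rewrite pmulr_rge0// oppr_ge0 in h1.
have h2 : cos (phi - th') <= 0.
  rewrite cosB sth' (_ : _ + _ = cos th' * (cos phi + m * sin phi)); last by ring.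
  by rewrite pmulr_rle0.
rewrite (_ : _ + th' = sgn b * pi - (phi - th')) ?/sgn; last by rewrite -bphi; ring.
case: (leP 0 b) => bs.
  have h3 : pi / 2 <= phi - th' <= pi.
    by apply: cos_le0_right => //; clear -bphi bs th0 phi1; lra.
  by clear -hp h3; lra.
have h3 : - pi <= phi - th' <= - (pi / 2).
  by apply: cos_le0_left => //; clear -bphi bs th2 phi1; lra.
by clear -hp h3; lra.
Qed.

(** * Existence of the hit point and size of the jump *)

Lemma le_tan (R : realType) (x y : R) : - (pi / 2) < x < pi / 2 ->
  - (pi / 2) < y < pi / 2 -> x <= y -> tan x <= tan y.
Proof. by move=> hx hy; rewrite !leNgt ltr_tan ?in_itv. Qed.

Lemma continuous_powR_line (R : realType) (g z s C k a b : R) :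
  (forall t, a <= t <= b -> 0 < z + t * s) ->
  {within `[a, b], continuous (fun t : R => (z + t * s) `^ g + C - t * k)}.
Proof.
move=> h; apply: continuous_in_subspaceT => t; rewrite inE/= in_itv/= => tab.
apply: differentiable_continuous; apply/derivable1_diffP.
have h1 : is_derive t 1 (fun t : R => z + t * s) s.
  have := is_deriveD (is_derive_cst z t 1) (is_deriveM (is_derive_id t 1) (is_derive_cst s t 1)).
  by rewrite scaler0 !add0r /GRing.scale/= mulr1.
have h2 := @is_derive1_comp _ (fun y : R => y `^ g) (fun t : R =>
  z + t * s) t _ _ (is_derive1_powR g (h t tab)) h1.
by apply: ex_derive.
Qed.

Lemma powR_line_root (R : realType) (g z s C k t0 : R) : 0 < g < 1 -> 0 < s ->
  0 < k -> 0 <= t0 -> 0 < z + t0 * s -> 0 <= (z + t0 * s) `^ g + C - t0 * k ->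
  exists2 t, t0 <= t & (z + t * s) `^ g + C - t * k = 0.
Proof.
move=> g01 s0 k0 t00 zt0 h0; have /andP[g0 g1] := g01.
(* [x1] is the abscissa where x^g has slope m. The tangent there bounds the power by a line that
   uses up only half of t k, so the expression is nonpositive once t exceeds [t0] by 2 |A| / k. *)
pose m := k / (2 * s).
pose x1 := (m / g) `^ (g - 1)^-1.
have m0 : 0 < m by rewrite divr_gt0// mulr_gt0.
have x10 : 0 < x1 by rewrite powR_gt0// divr_gt0.
have x1m : g * x1 `^ (g - 1) = m.
  rewrite /x1 -powRrM mulVf ?powRr1 ?(divr_ge0 (ltW m0) (ltW g0))//; last by rewrite lt_eqF//; lra.
  by rewrite mulrC divfK// gt_eqF.
pose A := x1 `^ g + m * (z - x1) + C.
pose T := t0 + 2 * `|A| / k.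
have T0 : t0 <= T by rewrite lerDl divr_ge0 ?mulr_ge0// ltW.
have hT : (z + T * s) `^ g + C - T * k <= 0.
  have zT : 0 <= z + T * s.
    by rewrite (le_trans (ltW zt0))// lerD2l ler_pM2r.
  have := powR_le_tangent g01 zT x10; rewrite x1m => h1.
  have ms : m * s = k / 2 by rewrite /m; field; exact: lt0r_neq0.
  have h2 : x1 `^ g + m * (z + T * s - x1) + C - T * k = A - T * (k / 2).
    have kE : k = m * s * 2 by rewrite ms; field.
    by rewrite /A kE; field.
  have h3 : T * (k / 2) = t0 * (k / 2) + `|A| by rewrite /T; field; exact: lt0r_neq0.
  have h4 := ler_norm A.
  have h5 : 0 <= t0 * (k / 2) by rewrite mulr_ge0// divr_ge0// ltW.
  by lra.
have hc : {within `[t0, T], continuous (fun t : R => (z + t * s) `^ g + C - t * k)}.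
  apply: continuous_powR_line => t /andP[tt0 _].
  by rewrite (lt_le_trans zt0)// lerD2l ler_pM2r.
have [|t] := IVT T0 hc (v := 0).
  by rewrite ge_min le_max h0 hT orbT.
by rewrite in_itv/= => /andP[t0t _] ht; exists t.
Qed.

(** Here s may have either sign. Up to the time T = 4 z^g / k the abscissa moves by at most z / 2,
    so the ray has to bridge at most (2 z)^g + z^g <= 3 z^g, which is less than T k. *)
Lemma far_root (R : realType) (g z s k : R) : 0 < g < 1 -> 0 < z -> 0 < k ->
  `|s| / k * z `^ (g - 1) <= 1 / 8 ->
  exists t, [/\ 0 < t, z / 2 <= z + t * s <= 2 * z &
    (z + t * s) `^ g + z `^ g - t * k = 0].
Proof.
move=> g01 z0 k0 hs; have /andP[g0 g1] := g01.
have zg : 0 < z `^ g by rewrite powR_gt0.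
have zE : z `^ g = z * z `^ (g - 1) by rewrite mulr_powRB1// ltW.
pose T := 4 * z `^ g / k.
have T0 : 0 <= T by rewrite divr_ge0 ?(ltW k0)// mulr_ge0// ltW.
have Ts : T * `|s| <= z / 2.
  have : 4 * z * (`|s| / k * z `^ (g - 1)) <= 4 * z * (1 / 8) by rewrite ler_pM2l// mulr_gt0.
  suff -> : T * `|s| = 4 * z * (`|s| / k * z `^ (g - 1)) by lra.
  by rewrite /T zE; field; exact: lt0r_neq0.
have hb t : 0 <= t <= T -> z / 2 <= z + t * s <= 2 * z.
  move=> /andP[t0 tT].
  have : `|t * s| <= z / 2.
    by rewrite normrM (ger0_norm t0) (le_trans _ Ts)// ler_wpM2r.
  by rewrite ler_norml => /andP[? ?]; apply/andP; split; lra.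
have hc : {within `[0, T], continuous (fun t : R => (z + t * s) `^ g + z `^ g - t * k)}.
  by apply: continuous_powR_line => t /hb /andP[? _]; lra.
have hT : (z + T * s) `^ g + z `^ g - T * k <= 0.
  have /andP[l u] : z / 2 <= z + T * s <= 2 * z by apply: hb; rewrite T0 lexx.
  have h1 : (z + T * s) `^ g <= (2 * z) `^ g.
    by apply: ge0_ler_powR; rewrite ?nnegrE//; lra.
  have h2 : (2 * z) `^ g <= 2 * z `^ g.
    by rewrite powRM// ?(ltW z0)// ler_wpM2r ?(ltW zg)// ler1_powR ?ler1n// ltW.
  have -> : T * k = 4 * z `^ g by rewrite /T divfK// gt_eqF.
  by lra.
have h0 : 0 <= (z + 0 * s) `^ g + z `^ g - 0 * k by rewrite !mul0r subr0 addr_ge0// powR_ge0.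
have [|t] := IVT T0 hc (v := 0); first by rewrite ge_min le_max h0 hT orbT.
rewrite in_itv/= => /andP[t0 tT] ht; exists t; split=> //; last by apply: hb; rewrite t0.
rewrite lt_neqAle t0 andbT; apply/eqP => t0E; move: ht.
by rewrite -t0E !mul0r addr0 subr0; lra.
Qed.

(** Lower and upper are relative to j. Here the descent t cos phi uses up both half-widths, which
    puts the point on the side opposite to j; in the next lemma it lies on the side of j. *)
Lemma ray_lower (R : realType) (g z j b t : R) : 0 <= z + t * sin (theta g z + b) ->
  (z + t * sin (theta g z + b)) `^ g + z `^ g - t * cos (theta g z + b) = 0 ->
  ray g z j b t = (z + t * sin (theta g z + b), - j * (z + t * sin (theta g z + b)) `^ g).
Proof.
move=> x0 e; rewrite /ray; congr pair.
by rewrite (_ : _ - _ = - j * - (z `^ g - t * cos (theta g z + b))); [congr (_ * _); lra|ring].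
Qed.

Lemma ray_upper (R : realType) (g z j b t : R) : 0 <= z + t * sin (theta g z + b) ->
  (z + t * sin (theta g z + b)) `^ g - z `^ g + t * cos (theta g z + b) = 0 ->
  ray g z j b t = (z + t * sin (theta g z + b), j * (z + t * sin (theta g z + b)) `^ g).
Proof.
move=> x0 e; rewrite /ray; congr pair.
by rewrite (_ : _ - _ = j * (z `^ g - t * cos (theta g z + b))); [congr (_ * _); lra|ring].
Qed.

(** Two regimes. For phi < pi / 2 the ray crosses to the other side; then z is bounded below, the
    descent is at least z^g, and the horizontal advance per unit of descent is at least tan e. For
    phi > pi / 2 it comes back to its own side, but the boundary bends too slowly for this to happen
    within distance [c2]. At phi = pi / 2 the ray is horizontal and misses the boundary. *)
Lemma hit_point_growth (R : realType) (g e theta0 : R) : 0 < g < 1 -> 0 < e ->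
  theta0 < pi / 2 -> exists2 c : R, 0 < c &
  forall z j b : R, 0 <= z -> j = 1 \/ j = -1 -> e <= b <= theta0 ->
    theta g z + b != pi / 2 -> z + c <= (hit_point g z j b).1.
Proof.
move=> g01 e0 t02; have /andP[g0 g1] := g01.
have hp : 0 < (pi : R) := @pi_gt0 R.
have [te|et] := ltP theta0 e; first by exists 1 => // z j b _ _ ?; exfalso; lra.
have tane : 0 < tan e.
  by rewrite /tan divr_gt0 ?sin_gt0_pihalf ?cos_gt0_pihalf//; apply/andP; split; lra.
(* [c1] is z^g tan e at the lower bound on z forced by theta z + e < pi / 2; [c2] is a distance over
   which theta falls by at most (pi / 2 - theta0) / 2. *)
pose c1 := ((g * tan e) `^ (1 - g)^-1) `^ g * tan e.
pose c2 := (g * ((pi / 2 - theta0) / 2)) `^ (1 - g)^-1.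
have c10 : 0 < c1 by rewrite mulr_gt0// !powR_gt0// mulr_gt0.
have c20 : 0 < c2 by rewrite powR_gt0// mulr_gt0//; lra.
exists (Num.min c1 c2); first by rewrite lt_min c10.
move=> z j b z0 j1 /andP[eb bt].
have th0 := theta_gt0 g0 z0; have th2 := theta_lepihalf g z.
have g1' : 0 < 1 - g by lra.
set phi := theta g z + b => phi2.
have sphi : 0 < sin phi by rewrite sin_gt0_pi// /phi; apply/andP; split; lra.
have [phi_lt|phi_ge] := ltP phi (pi / 2).
  have zp : 0 < z.
    rewrite lt_neqAle z0 andbT; apply/eqP => zE; move: phi_lt.
    by rewrite /phi -zE /theta eqxx; lra.
  have cphi : 0 < cos phi by rewrite cos_gt0_pihalf//; apply/andP; split;
    rewrite ?phi_lt// /phi; lra.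
  have [t t0 ht] : exists2 t, 0 <= t & (z + t * sin phi) `^ g + z `^ g - t * cos phi = 0.
    by apply: powR_line_root; rewrite ?mul0r ?addr0 ?subr0 ?addr_ge0 ?powR_ge0.
  have x0 : 0 < z + t * sin phi by rewrite ltr_wpDr// mulr_ge0// ltW.
  have tp : 0 < t.
    rewrite lt_neqAle t0 andbT; apply/eqP => tE; move: ht.
    by rewrite -tE !mul0r addr0 subr0; have := powR_gt0 g zp; lra.
  have rE := ray_lower j (ltW x0) ht.
  rewrite (@hit_pointE _ g z j b t)// ?rE; last first.
    by exists (z + t * sin phi), (- j); split => //; [exact: ltW|case: j1 => ->;
      rewrite ?opprK; [right|left]].
  rewrite /= lerD2l (le_trans (_ : _ <= c1)) ?ge_min ?lexx//.
  have h1 : tan e < z `^ (1 - g) / g.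
    rewrite ltNge; apply/negP => /(@le_atan R).
    rewrite tanK; last by rewrite in_itv/=; apply/andP; split; lra.
    by move: phi_lt; rewrite /phi thetaE//; lra.
  have h2 : (g * tan e) `^ (1 - g)^-1 <= z.
    have zE : z = (z `^ (1 - g)) `^ (1 - g)^-1 by rewrite -powRrM mulfV ?gt_eqF// powRr1.
    rewrite [leRHS]zE; apply: ge0_ler_powR; rewrite ?nnegrE ?powR_ge0//.
    - by rewrite invr_ge0 ltW.
    - by rewrite mulr_ge0// ltW.
    - by rewrite mulrC -ler_pdivlMr// ltW.
  have h3 : z `^ g <= t * cos phi by have := powR_ge0 (z + t * sin phi) g; lra.
  have h4 : tan e * cos phi <= sin phi.
    have ce : 0 < cos e by rewrite cos_gt0_pihalf//; apply/andP; split; lra.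
    rewrite /tan mulrAC ler_pdivrMr// -subr_ge0 (mulrC (sin e)) -sinB sin_ge0_pi//.
    by rewrite /phi; apply/andP; split; lra.
  apply: (@le_trans _ _ (t * cos phi * tan e)).
    by rewrite ler_pM2r// (le_trans _ h3)// ge0_ler_powR ?nnegrE ?powR_ge0// ltW.
  by rewrite -mulrA ler_pM2l// mulrC.
have phi_gt : pi / 2 < phi by rewrite lt_neqAle eq_sym phi2.
have cphi : cos phi < 0 by rewrite cos_le0_pihalf//; apply/andP; split; rewrite ?phi_gt// /phi; lra.
pose th' := theta g (z + c2).
have zc2 : 0 < z + c2 by rewrite ltr_wpDl.
have th'0 : 0 < th' by apply: theta_gt0 => //; exact: ltW.
have th'2 : th' < pi / 2 by apply: theta_ltpihalf.
(* At abscissa z + c2 the ray has not yet left through its own side: theta has dropped so little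
   that phi - th' is still below pi / 2, and the tangent at z + c2 passes above the starting
   point. *)
have ht0 : 0 <= (z + c2 / sin phi * sin phi) `^ g + - z `^ g - c2 / sin phi * - cos phi.
  rewrite divfK ?gt_eqF//.
  have h1 := theta_holder g01 z0 (ltW c20).
  have h2 : c2 `^ (1 - g) / g = (pi / 2 - theta0) / 2.
    rewrite /c2 -powRrM mulVf ?gt_eqF// powRr1; last by rewrite mulr_ge0// ?(ltW g0)//; lra.
    by rewrite mulrC mulKf// gt_eqF.
  have h3 : 0 < cos (phi - th').
    by apply: cos_gt0_pihalf; rewrite /phi /th'; rewrite h2 in h1; apply/andP; split;
      move: phi_gt th'2; rewrite /phi /th'; lra.
  have cth' : 0 < cos th' by apply: cos_theta_gt0.
  have h4 := powR_le_tangent g01 z0 zc2.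
  set m := g * (z + c2) `^ (g - 1) in h4.
  have sth' : sin th' = m * cos th' by apply: sin_theta.
  have h5 : 0 < cos th' * (cos phi + m * sin phi).
    by move: h3; rewrite cosB sth' (_ : _ + _ = cos th' * (cos phi + m * sin phi))//; ring.
  rewrite pmulr_rgt0// in h5.
  have h6 : 0 <= c2 / sin phi * (cos phi + m * sin phi) by rewrite mulr_ge0 ?divr_ge0// ltW.
  have h7 : c2 / sin phi * (cos phi + m * sin phi) = c2 / sin phi * cos phi + m * c2.
    by field; exact: lt0r_neq0.
  by rewrite opprD addrA subrr sub0r in h4; lra.
have [t tt0 ht] : exists2 t, c2 / sin phi <= t & (z + t * sin phi) `^ g + - z `^ g - t * - cos
  phi = 0.
  by apply: powR_line_root; rewrite ?oppr_gt0 ?divr_ge0 ?(ltW c20) ?(ltW sphi)// divfK ?gt_eqF.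
have tp : 0 < t by rewrite (lt_le_trans _ tt0)// divr_gt0.
have x0 : 0 < z + t * sin phi by rewrite ltr_wpDl// mulr_gt0.
have ht' : (z + t * sin phi) `^ g - z `^ g + t * cos phi = 0 by rewrite -[RHS]ht mulrN opprK.
have rE := ray_upper j (ltW x0) ht'.
rewrite (@hit_pointE _ g z j b t)// ?rE; last first.
  by exists (z + t * sin phi), j; split => //; exact: ltW.
rewrite /= lerD2l (le_trans (_ : _ <= c2)) ?ge_min ?lexx ?orbT//.
by rewrite -ler_pdivrMr.
Qed.

Lemma far_next_state (R : realType) (g theta0 : R) : 0 < g < 1 ->
  0 < theta0 < pi / 2 -> exists y0 T : R, [/\ 0 < y0, 0 < T &
  forall z j a b : R, 0 < z -> z `^ (g - 1) <= y0 -> j = 1 \/ j = -1 ->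
    `|b| <= theta0 -> exists z' : R, [/\ z / 2 <= z' <= 2 * z,
      `|tan (theta g z + b)| <= T, 0 < cos (theta g z + b),
      z' - z = (z `^ g + z' `^ g) * tan (theta g z + b) &
      next_state g (z, j, a) b =
        (z', sgn (- j * z' `^ g), b + theta g z + theta g z')]].
Proof.
move=> g01 /andP[t0 t2]; have /andP[g0 g1] := g01.
have hp : 0 < (pi : R) := @pi_gt0 R.
pose d := (pi / 2 - theta0) / 2.
have d0 : 0 < d by rewrite /d; lra.
pose T := tan (theta0 + d).
have T0 : 0 < T.
  by rewrite /T /tan divr_gt0 ?sin_gt0_pihalf ?cos_gt0_pihalf//; apply/andP; split; rewrite /d; lra.
(* The first bound gives theta z <= d, which keeps |phi| at most theta0 + d < pi / 2; the second is
   the smallness that [far_root] asks for. *)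
exists (Num.min (d / g) (1 / 8 / T)), T; split => //.
  by rewrite lt_min (divr_gt0 d0 g0) divr_gt0//; lra.
move=> z j a b z0; rewrite le_min => /andP[zy1 zy2] j1 b0.
have th0 := theta_gt0 g0 (ltW z0).
have th1 : theta g z <= d.
  by rewrite (le_trans (theta_le g0 z0))// mulrC -ler_pdivlMr.
move: b0; rewrite ler_norml => /andP[b1 b2].
set phi := theta g z + b.
have phi1 : `|phi| <= theta0 + d by rewrite ler_norml /phi; apply/andP; split; lra.
have phi2 : theta0 + d < pi / 2 by rewrite /d; lra.
have /andP[phi3 phi4] : - (pi / 2) < phi < pi / 2.
  by rewrite -ltr_norml (le_lt_trans phi1).
have cphi : 0 < cos phi by rewrite cos_gt0_pihalf// phi3.
have tphi : `|tan phi| <= T.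
  move: phi1; rewrite !ler_norml => /andP[p1 p2].
  by rewrite /T -tanN !le_tan//; apply/andP; split=> //; lra.
have [|t [tp hb ht]] := @far_root _ g z (sin phi) (cos phi) g01 z0 cphi.
  have -> : `|sin phi| / cos phi = `|tan phi| by rewrite /tan normrM normrV ?unitfE ?gt_eqF//
    (gtr0_norm cphi).
  have -> : 1 / 8 = T * (1 / 8 / T) by rewrite (mulrC T) divfK ?gt_eqF.
  by rewrite ler_pM ?powR_ge0.
have x0 : 0 < z + t * sin phi by move/andP: hb => [? _]; lra.
have rE := ray_lower j (ltW x0) ht.
exists (z + t * sin phi); split=> //.
  have -> : z `^ g + (z + t * sin phi) `^ g = t * cos phi by lra.
  by rewrite /tan; field; exact: lt0r_neq0.
have hE : hit_point g z j b = (z + t * sin phi, - j * (z + t * sin phi) `^ g).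
  rewrite -/phi in rE; rewrite -rE; apply: hit_pointE => //; [exact: ltW|rewrite rE].
  by exists (z + t * sin phi), (- j); split => //; [exact: ltW|case: j1 => ->; rewrite ?opprK;
    [right|left]].
rewrite /next_state /incoming_angle hE /= gt_eqF// mulrA mulrN.
have -> : j * j = 1 by case: j1 => ->; rewrite ?mulrNN mul1r.
by rewrite mulN1r oppr_lt0 powR_gt0.
Qed.

(** * Expansion of a jump *)

(** Calculus of error terms: [bounded_on P (fun i => f i / y i ^+ n)] stands for f = O(y^n),
    uniformly over the indices in P. *)
Definition bounded_on (R : realType) (I : Type) (P : I -> Prop) (f : I -> R) : Prop :=
  exists C : R, forall i, P i -> `|f i| <= C.

Lemma bounded_on_cst (R : realType) (I : Type) (P : I -> Prop) (c : R) :
  bounded_on P (fun=> c).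
Proof. by exists `|c|. Qed.

Lemma bounded_onD (R : realType) (I : Type) (P : I -> Prop) (f h : I -> R) :
  bounded_on P f -> bounded_on P h -> bounded_on P (fun i => f i + h i).
Proof.
move=> [C hC] [D hD]; exists (C + D) => i Pi.
by rewrite (le_trans (ler_normD _ _))// lerD ?hC ?hD.
Qed.

Lemma bounded_onM (R : realType) (I : Type) (P : I -> Prop) (f h : I -> R) :
  bounded_on P f -> bounded_on P h -> bounded_on P (fun i => f i * h i).
Proof.
by move=> [C hC] [D hD]; exists (C * D) => i Pi; rewrite normrM ler_pM ?hC ?hD.
Qed.

Lemma bounded_onN (R : realType) (I : Type) (P : I -> Prop) (f : I -> R) :
  bounded_on P f -> bounded_on P (fun i => - f i).
Proof. by move=> [C hC]; exists C => i Pi; rewrite normrN hC. Qed.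

Lemma bounded_onX (R : realType) (I : Type) (P : I -> Prop) (f : I -> R) (n : nat) :
  bounded_on P f -> bounded_on P (fun i => f i ^+ n).
Proof.
move=> bf; elim: n => [|n IH]; first exact: bounded_on_cst.
by have [C hC] := bounded_onM bf IH; exists C => i Pi; rewrite exprS hC.
Qed.

Lemma eq_bounded_on (R : realType) (I : Type) (P : I -> Prop) (f h : I -> R) :
  (forall i, P i -> f i = h i) -> bounded_on P h -> bounded_on P f.
Proof. by move=> fh [C hC]; exists C => i Pi; rewrite fh// hC. Qed.

Lemma bounded_on_ratio (R : realType) (I : Type) (P : I -> Prop) (f h : I -> R) (C : R) :
  (forall i, P i -> `|f i| <= C * `|h i|) -> bounded_on P (fun i => f i / h i).
Proof.
move=> hC; exists `|C| => i Pi; have [->|h0] := eqVneq (h i) 0; first by rewrite invr0 mulr0 normr0.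
rewrite normrM normrV ?unitfE// ler_pdivrMr ?normr_gt0//.
by rewrite (le_trans (hC i Pi))// ler_wpM2r// ler_norm.
Qed.

Ltac bnd := repeat first [assumption | apply: bounded_on_cst | apply: bounded_onD
  | apply: bounded_onN | apply: bounded_onX | apply: bounded_onM].

(* [d = z' / z - 1] is the relative jump, [y = z ^ (g - 1)], [T = tan b] and
   [t = tan (theta z + b)]. *)
Lemma jump_expansion (R : realType) (I : Type) (P : I -> Prop) (g : R)
    (y T t d : I -> R) :
  (forall i, P i -> 0 < y i) -> bounded_on P y -> bounded_on P T ->
  bounded_on P t -> (forall i, P i -> `|g * y i * T i| <= 1 / 2) ->
  (forall i, P i -> t i * (1 - g * y i * T i) = g * y i + T i) ->
  (forall i, P i -> `|d i| <= 1 / 2) ->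
  (forall i, P i -> d i = y i * (1 + (1 + d i) `^ g) * t i) ->
  bounded_on P (fun i => d i / y i) /\
  bounded_on P (fun i => (d i - (2 * y i * T i + 2 * g * y i ^+ 2 * (1 + 2 * T i ^+ 2))) / y i
    ^+ 3).
Proof.
move=> y0 by_ bT bt gyT tE d12 dE.
have yn0 i : P i -> y i != 0 by move=> Pi; rewrite gt_eqF// y0.
have [C0 hC0] := powR1D_bounded g.
have br : bounded_on P (fun i => (1 + d i) `^ g) by exists C0 => i Pi; rewrite hC0// d12.
have bv : bounded_on P (fun i => d i / y i).
  apply: (@eq_bounded_on _ _ _ _ (fun i => (1 + (1 + d i) `^ g) * t i)); last by bnd.
  by move=> i Pi; rewrite {1}dE//; field; exact: yn0.
split=> //.
(* [u2] is the remainder of the addition formula t = (g y + T) / (1 - g y T) after its terms of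
   order 0 and 1 in y; [u1] below is the second-order remainder of (1 + d)^g. *)
pose u2 i := (t i - T i - g * y i * (1 + T i ^+ 2)) / y i ^+ 2.
have bu2 : bounded_on P u2.
  apply: (@eq_bounded_on _ _ _ _ (fun i => g ^+ 2 * (1 + T i ^+ 2) * T i * (1 - g * y i * T i)^-1)).
    move=> i Pi; rewrite /u2.
    have n0 : 1 - g * y i * T i != 0.
      by rewrite gt_eqF//; have := gyT i Pi; rewrite ler_norml => /andP[]; lra.
    have -> : t i = (g * y i + T i) / (1 - g * y i * T i) by rewrite -tE// mulfK.
    by field; rewrite ?n0 ?yn0.
  bnd; exists 2 => i Pi; have := gyT i Pi; rewrite ler_norml => /andP[h1 h2].
  by rewrite gtr0_norm ?invr_gt0; [rewrite -[leRHS]invrK lef_pV2 ?posrE; lra|lra].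
have [C2 hC2] := powR1D_taylor2 g.
pose u1 i := ((1 + d i) `^ g - (1 + g * d i)) / d i ^+ 2.
have bu1 : bounded_on P u1.
  by apply: (@bounded_on_ratio _ _ _ _ _ C2) => i Pi; rewrite normrX hC2// d12.
have u1E i : P i -> (1 + d i) `^ g = 1 + g * d i + u1 i * d i ^+ 2.
  move=> Pi; rewrite /u1; have [d0|d0] := eqVneq (d i) 0.
    by rewrite d0 addr0 powR1 expr0n/= !mulr0 !addr0.
  by rewrite divfK ?expf_neq0//; ring.
have u2E i : P i -> t i = T i + g * y i * (1 + T i ^+ 2) + u2 i * y i ^+ 2.
  by move=> Pi; rewrite /u2 divfK ?expf_neq0 ?yn0//; ring.
(* Bootstrap on the implicit equation for v = d / y: boundedness of v gives v = 2 T + y w, and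
   inserting this once more gives v = 2 T + 2 g y (1 + 2 T^2) + y^2 x with x bounded. *)
pose v i := d i / y i; rewrite -/v in bv.
have vE i : P i -> d i = y i * v i by move=> Pi; rewrite /v; field; exact: yn0.
have vE2 i : P i -> v i = (2 + g * (y i * v i) + u1 i * (y i * v i) ^+ 2) *
    (T i + g * y i * (1 + T i ^+ 2) + u2 i * y i ^+ 2).
  move=> Pi; rewrite -vE// -u2E// {1}/v {1}dE// u1E//.
  by field; rewrite yn0.
pose w i := (g * v i + u1 i * y i * v i ^+ 2) * (T i + g * y i * (1 + T i ^+ 2) + u2 i * y i ^+ 2)
  + 2 * (g * (1 + T i ^+ 2) + u2 i * y i).
have bw : bounded_on P w by rewrite /w; bnd.
have wE i : P i -> v i = 2 * T i + y i * w i.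
  by move=> Pi; rewrite [LHS]vE2// /w; ring.
pose x i := (g * w i + u1 i * v i ^+ 2) * (T i + g * y i * (1 + T i ^+ 2) + u2 i * y i ^+ 2)
  + (2 * g * T i) * (g * (1 + T i ^+ 2) + u2 i * y i) + 2 * u2 i.
apply: (@eq_bounded_on _ _ _ _ x); last by rewrite /x; bnd.
move=> i Pi.
have hx : v i = 2 * T i + 2 * g * y i * (1 + 2 * T i ^+ 2) + y i ^+ 2 * x i.
  rewrite [LHS]vE2// {1}wE// /x; ring.
rewrite vE// {1}hx; field; exact: yn0.
Qed.

(** Third-order Taylor formula for (1 + d)^a with the expansion of d inserted. The term 2 a (a - 1)
    T^2 is a (a - 1) / 2 times the square of 2 T, the leading part of d / y. *)
Lemma jump_expansion_powR (R : realType) (I : Type) (P : I -> Prop) (g a : R)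
    (y T d : I -> R) :
  (forall i, P i -> 0 < y i) -> bounded_on P y -> bounded_on P T ->
  (forall i, P i -> `|d i| <= 1 / 2) -> bounded_on P (fun i => d i / y i) ->
  bounded_on P (fun i => (d i - (2 * y i * T i + 2 * g * y i ^+ 2 * (1 + 2 * T i ^+ 2))) / y i
    ^+ 3) ->
  bounded_on P (fun i => ((1 + d i) `^ a - (1 + 2 * a * y i * T i + y i ^+ 2 *
    (2 * a * g * (1 + 2 * T i ^+ 2) + 2 * a * (a - 1) * T i ^+ 2))) / y i ^+ 3).
Proof.
move=> y0 by_ bT d12 bv.
have yn0 i : P i -> y i != 0 by move=> Pi; rewrite gt_eqF// y0.
set x := fun i => _ => bx.
have xE i : P i -> d i = 2 * y i * T i + 2 * g * y i ^+ 2 * (1 + 2 * T i ^+ 2) + y i ^+ 3 * x i.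
  by move=> Pi; rewrite /x; field; exact: yn0.
have [C hC] := powR1D_taylor3 a.
pose u i := ((1 + d i) `^ a - (1 + a * d i + a * (a - 1) / 2 * d i ^+ 2)) / d i ^+ 3.
have bu : bounded_on P u.
  by apply: (@bounded_on_ratio _ _ _ _ _ C) => i Pi; rewrite normrX hC// d12.
have uE i : P i -> (1 + d i) `^ a = 1 + a * d i + a * (a - 1) / 2 * d i ^+ 2 + u i * d i ^+ 3.
  move=> Pi; rewrite /u; have [d0|d0] := eqVneq (d i) 0.
    by rewrite d0 addr0 powR1 !expr0n/= !mulr0 !addr0.
  by rewrite divfK ?expf_neq0//; ring.
pose s i := 2 * g * (1 + 2 * T i ^+ 2) + y i * x i.
pose w i := a * x i + a * (a - 1) / 2 * (4 * T i * s i + y i * s i ^+ 2) + u i * (d i / y i) ^+ 3.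
apply: (@eq_bounded_on _ _ _ _ w); last by rewrite /w /s; bnd.
move=> i Pi; rewrite uE//.
have -> : u i * d i ^+ 3 = y i ^+ 3 * (u i * (d i / y i) ^+ 3) by field; exact: yn0.
rewrite /w; set q := u i * _; rewrite xE// /s; field; exact: yn0.
Qed.

(** * The chain of angles *)

Lemma ultrafilter_image (T U : Type) (f : T -> U) (F : set_system T) :
  UltraFilter F -> UltraFilter (f @ F).
Proof.
move=> FU; split=> [|G GF sFG]; first exact: fmap_proper_filter.
apply/seteqP; split=> // A GA; have [//|nA] := in_ultra_setVsetC (f @^-1` A) FU.
have GnA : G (~` A) by apply: sFG.
by exfalso; apply: (@filter_not_empty _ G); rewrite -(setICr A); exact: filterI.
Qed.

(* A limit along an ultrafilter, i.e. a Banach limit without shift-invariance. *)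
Lemma generalized_limit (R : realType) : exists L : (nat -> R) -> R,
  [/\ forall u v, bounded_on (fun=> True) u -> bounded_on (fun=> True) v ->
        L (fun n => u n + v n) = L u + L v,
      forall c u, bounded_on (fun=> True) u -> L (fun n => c * u n) = c * L u,
      forall u v, bounded_on (fun=> True) u -> bounded_on (fun=> True) v ->
        (forall n, u n <= v n) -> L u <= L v &
      forall u (l : R), u @ \oo --> l -> L u = l].
Proof.
have [U [UU hU]] := @ultraFilterLemma nat \oo _.
exists (fun u => lim (u @ U)).
have cv (u : nat -> R) : bounded_on (fun=> True) u -> cvg (u @ U).
  move=> [C hC]; have := @segment_compact R (- C) C; rewrite compact_ultra.
  move=> /(_ (u @ U) (ultrafilter_image _ UU))[|p [_ up]]; last by apply/cvg_ex; exists p.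
  by change (U (u @^-1` `[- C, C])); apply: filterE => n;
    rewrite /preimage/= in_itv/= -ler_norml (hC n I).
split.
- by move=> u v bu bv; apply/cvg_lim => //; apply: cvgD; exact: cv.
- by move=> c u bu; apply/cvg_lim => //; apply: cvgMr; exact: cv.
- by move=> u v bu bv uv; apply: ler_lim; [exact: cv|exact: cv|apply: filterE].
- by move=> u l ul; apply/cvg_lim => //; exact: cvg_trans (cvg_app u hU) ul.
Qed.

(** * Bounded measurable functions and positive functionals *)

Definition mbounded (R : realType) (d : measure_display) (T : measurableType d)
    (h : T -> R) : Prop :=
  measurable_fun setT h /\ bounded_on (fun=> True) h.

Lemma mbounded_cst (R : realType) (d : measure_display) (T : measurableType d) (c : R) :
  mbounded (fun _ : T => c).
Proof. by split; [exact: measurable_cst|exact: bounded_on_cst]. Qed.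

Lemma mboundedD (R : realType) (d : measure_display) (T : measurableType d)
    (f h : T -> R) : mbounded f -> mbounded h ->
  mbounded (fun x => f x + h x).
Proof.
by move=> [mf bf] [mh bh]; split; [exact: measurable_funD|exact: bounded_onD].
Qed.

Lemma mboundedM (R : realType) (d : measure_display) (T : measurableType d)
    (f h : T -> R) : mbounded f -> mbounded h ->
  mbounded (fun x => f x * h x).
Proof.
by move=> [mf bf] [mh bh]; split; [exact: measurable_funM|exact: bounded_onM].
Qed.

Lemma mboundedZ (R : realType) (d : measure_display) (T : measurableType d)
    (c : R) (f : T -> R) : mbounded f ->
  mbounded (fun x => c * f x).
Proof. by apply: mboundedM; exact: mbounded_cst. Qed.

Lemma mbounded_indic (R : realType) (d : measure_display) (T : measurableType d)
    (B : set T) : measurable B -> mbounded (\1_B : T -> R).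
Proof.
move=> mB; split; first exact: measurable_indic.
by exists 1 => x _; rewrite indicE ger0_norm; case: (x \in B).
Qed.

Lemma mbounded_sum (R : realType) (d : measure_display) (T : measurableType d)
    (F : nat -> T -> R) (n : nat) :
  (forall i, mbounded (F i)) -> mbounded (fun x => \sum_(i < n) F i x).
Proof.
move=> mF; elim: n => [|n IH].
  rewrite (_ : (fun x => _) = fun=> 0); first exact: mbounded_cst.
  by apply/funext => x; rewrite big_ord0.
rewrite (_ : (fun x => _) = fun x => (\sum_(i < n) F i x) + F n x); first exact: mboundedD.
by apply/funext => x; rewrite big_ord_recr.
Qed.

(** Countable additivity is not demanded, so that limits along an ultrafilter are covered as well as
    integrals. Comparing functions on D only makes F insensitive to values outside D. *)
Definition positive_functional (R : realType) (d : measure_display) (T : measurableType d)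
    (D : set T) (F : (T -> R) -> R) :=
  [/\ forall f h, mbounded f -> mbounded h ->
        F (fun x => f x + h x) = F f + F h,
      forall c f, mbounded f -> F (fun x => c * f x) = c * F f &
      forall f h, mbounded f -> mbounded h -> (forall x, D x -> f x <= h x) ->
        F f <= F h].

Lemma positive_functional_sum (R : realType) (d : measure_display) (T : measurableType d)
    (D : set T) F (f : nat -> T -> R) (n : nat) :
  positive_functional D F -> (forall i, mbounded (f i)) ->
  F (fun x => \sum_(i < n) f i x) = \sum_(i < n) F (f i).
Proof.
move=> [FD FZ _] mf; elim: n => [|n IH].
  rewrite big_ord0 (_ : (fun x => _) = fun x => 0 * (fun=> 0) x).
    by rewrite FZ ?mul0r//; exact: mbounded_cst.
  by apply/funext => x; rewrite big_ord0 mul0r.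
rewrite big_ord_recr/= -IH -FD//; last exact: mbounded_sum.
by congr F; apply/funext => x; rewrite big_ord_recr.
Qed.

(** The sum is the minimum of N and the integer part of t. The last clause carries the induction. *)
Lemma count_le (R : realType) (t : R) (N : nat) : 0 <= t ->
  let s := \sum_(i < N) (i.+1%:R <= t)%R%:R in
  s <= t /\ (t <= N%:R -> t - 1 <= s) /\ (N%:R <= t -> s = N%:R).
Proof.
move=> t0; elim: N => [|N [IH1 [IH2 IH3]]] /=.
  rewrite big_ord0; split=> //; split=> //; lra.
rewrite big_ord_recr/=; set s := \sum_(_ < _) _ in IH1 IH2 IH3 *.
have e : N.+1%:R = N%:R + 1 :> R by rewrite -natr1.
have [h|h] := leP N.+1%:R t.
  rewrite IH3 ?e; last by lra.
  have -> : true%:R = 1 :> R by [].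
  by split; [lra|split; lra].
rewrite addr0; split=> //; split=> [tN|]; last by lra.
have [tN'|tN'] := leP t N%:R; first exact: IH2.
by rewrite IH3; lra.
Qed.

(** Finite additivity permits no passage to monotone limits, so h is approximated uniformly: a step
    function with N equal levels is within 1 / N of h and is a combination of indicators. *)
Lemma positive_functional_eq01 (R : realType) (d : measure_display) (T : measurableType d)
    (D : set T) F1 F2 (h : T -> R) :
  positive_functional D F1 -> positive_functional D F2 ->
  (forall B, measurable B -> F1 \1_B = F2 \1_B) ->
  mbounded h -> (forall x, 0 <= h x <= 1) -> F1 h <= F2 h.
Proof.
move=> pF1 pF2 F12 mh h01.
have [F1D F1Z F1le] := pF1; have [F2D F2Z F2le] := pF2.
apply/ler_addgt0Pr => e e0.
pose c : R := `|F1 (fun=> 1)|.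
pose N := (Num.truncn ((c + 1) / e)).+1.
have N0 : 0 < N%:R :> R by rewrite ltr0n.
have NE : c / N%:R <= e.
  rewrite ler_pdivrMr// mulrC -ler_pdivrMr//.
  rewrite (@le_trans _ _ ((c + 1) / e))//; last exact/ltW/truncnS_gt.
  by rewrite ler_pM2r ?invr_gt0//; lra.
pose B i := [set x | i.+1%:R <= N%:R * h x].
have mB i : measurable (B i).
  rewrite -[B i]setTI; apply: (@measurable_fun_le _ _ _ setT (fun=> i.+1%:R) (fun x =>
    N%:R * h x)) => //.
  by apply: measurable_funM => //; case: mh.
pose hN (x : T) : R := N%:R^-1 * \sum_(i < N) (\1_(B i) : T -> R) x.
have mS : mbounded (fun x => \sum_(i < N) (\1_(B i) : T -> R) x).
  by apply: (@mbounded_sum _ _ _ (fun i => \1_(B i))) => i; exact: mbounded_indic.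
have mhN : mbounded hN := mboundedZ N%:R^-1 mS.
have hNE x : \sum_(i < N) (\1_(B i) : T -> R) x = \sum_(i < N) (i.+1%:R <= N%:R * h x)%R%:R.
  apply: eq_bigr => i _; rewrite indicE; congr (_%:R); congr nat_of_bool.
  by apply/idP/idP => [/set_mem//|?]; exact/mem_set.
have hN1 x : hN x <= h x.
  rewrite /hN hNE mulrC ler_pdivrMr// (mulrC (h x)).
  have /andP[h0 _] := h01 x.
  by have [] := count_le N (mulr_ge0 (ltW N0) h0).
have hN2 x : h x <= hN x + N%:R^-1 * 1.
  rewrite /hN hNE -mulrDr mulrC ler_pdivlMr// (mulrC (h x)) -lerBlDr.
  have /andP[h0 h1] := h01 x.
  have [_ [+ _]] := count_le N (mulr_ge0 (ltW N0) h0); apply.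
  by rewrite -[leRHS]mulr1 ler_pM2l.
have m1 := mbounded_cst T (1 : R).
have FN : F1 hN = F2 hN.
  rewrite F1Z// F2Z//; congr (_ * _).
  rewrite (positive_functional_sum N pF1 (fun i => mbounded_indic R (mB i))).
  rewrite (positive_functional_sum N pF2 (fun i => mbounded_indic R (mB i))).
  by apply: eq_bigr => i _; exact: F12.
apply: (@le_trans _ _ (F1 hN + N%:R^-1 * F1 (fun=> 1))).
  rewrite -F1Z// -F1D//; last exact: mboundedZ.
  by apply: F1le => //; apply: mboundedD => //; exact: mboundedZ.
rewrite FN lerD ?F2le//.
by rewrite (le_trans _ NE)// mulrC ler_pM2r ?invr_gt0// ler_norm.
Qed.

Lemma positive_functional_eq (R : realType) (d : measure_display) (T : measurableType d)
    (D : set T) F1 F2 (h : T -> R) :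
  positive_functional D F1 -> positive_functional D F2 ->
  (forall B, measurable B -> F1 \1_B = F2 \1_B) -> mbounded h -> F1 h = F2 h.
Proof.
move=> pF1 pF2 F12 mh; have [C hC] := mh.2.
have [F1D F1Z _] := pF1; have [F2D F2Z _] := pF2.
have C0 : 0 <= C by apply: le_trans (hC point Logic.I).
(* Affine rescaling of h to [0, 1]; C + 1 in place of C keeps the scale positive. *)
pose D2 := 2 * (C + 1).
have D20 : 0 < D2 by rewrite /D2; lra.
pose h' x := D2^-1 * (h x + (C + 1)).
have mh1 : mbounded (fun x => h x + (C + 1)) by apply: mboundedD => //; exact: mbounded_cst.
have mh' : mbounded h' by exact: mboundedZ.
have h'01 x : 0 <= h' x <= 1.
  have := hC x I; rewrite ler_norml => /andP[h1 h2].
  rewrite /h' mulr_ge0 ?invr_ge0 ?(ltW D20)//=; last by lra.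
  by rewrite mulrC ler_pdivrMr// /D2; lra.
have e : F1 h' = F2 h'.
  by apply/le_anti; rewrite !(@positive_functional_eq01 _ _ _ D)// => B mB; rewrite F12.
have m1 := mbounded_cst T (1 : R).
have F11 : F1 (fun=> 1) = F2 (fun=> 1).
  have := F12 setT measurableT; rewrite (_ : \1_setT = fun=> 1)//.
  by apply/funext => x; rewrite indicT.
have hE : h = fun x => D2 * h' x + - (C + 1) * 1.
  by apply/funext => x; rewrite /h' mulrA divff ?gt_eqF// mul1r mulr1 addrK.
have m2 : mbounded (fun x => D2 * h' x) by exact: mboundedZ.
have m3 : mbounded (fun _ : T => - (C + 1) * 1) by exact: mbounded_cst.
by rewrite hE F1D// F2D// (F1Z D2)// (F2Z D2)// (F1Z _ (fun=> 1))// (F2Z _ (fun=> 1))// F11 e.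
Qed.

Lemma bounded_integrable (R : realType) (d : measure_display)
    (T : measurableType d) (mu : {measure set T -> \bar R})
    (D : set T) (h : T -> R) : measurable D -> (mu D < +oo)%E ->
  measurable_fun D h -> bounded_on D h -> mu.-integrable D (EFin \o h).
Proof.
move=> mD muD mh [C hC]; apply: measurable_bounded_integrable => //.
by exists C; split=> [|M CM x Dx]; [exact: num_real|exact: le_trans (hC x Dx) (ltW CM)].
Qed.

Lemma mbounded_integrable (R : realType) (d : measure_display) (T : measurableType d)
    (mu : {measure set T -> \bar R}) (D : set T) (h : T -> R) : measurable D ->
      (mu D < +oo)%E -> mbounded h ->
  mu.-integrable D (EFin \o h).
Proof.
move=> mD muD [mh [C hC]]; apply: bounded_integrable => //.
  exact: measurable_funTS.
by exists C => x _; exact: hC.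
Qed.

Lemma Rintegral_indic (R : realType) (d : measure_display) (T : measurableType d)
    (mu : {measure set T -> \bar R}) (D B : set T) : measurable D -> measurable B ->
  \int[mu]_(x in D) \1_B x = fine (mu (B `&` D)).
Proof. by move=> mD mB; rewrite /Rintegral integral_indic. Qed.

Lemma probability_lty (R : realType) (d : measure_display) (T : measurableType d)
    (p : probability T R) (D : set T) :
  measurable D -> (p D < +oo)%E.
Proof. by move=> mD; rewrite (le_lt_trans (probability_le1 p mD))// ltry. Qed.

Lemma positive_functional_Rintegral (R : realType) (d : measure_display) (T : measurableType d)
    (mu : {measure set T -> \bar R}) (D : set T) : measurable D -> (mu D < +oo)%E ->
  positive_functional D (fun h => \int[mu]_(x in D) h x).
Proof.
move=> mD muD; split.
- by move=> f h mf mh; rewrite RintegralD//; exact: mbounded_integrable.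
- by move=> c f mf; rewrite RintegralZl//; exact: mbounded_integrable.
- by move=> f h mf mh fh; apply: le_Rintegral => //; exact: mbounded_integrable.
Qed.

Lemma integrable_density (R : realType) (d : measure_display)
    (T : measurableType d) (mu : {measure set T -> \bar R})
    (D : set T) (k h : T -> R) : measurable D -> mu.-integrable D (EFin \o k) ->
  measurable_fun D h -> bounded_on D h ->
  mu.-integrable D (EFin \o (fun x => k x * h x)).
Proof.
move=> mD ik mh [C hC].
have := @integrableMl _ _ _ mu D mD (EFin \o k) h ik mh.
by apply; exists C; split=> [|M CM x Dx]; [exact: num_real|exact: le_trans (hC x Dx) (ltW CM)].
Qed.

Lemma mbounded_on (R : realType) (d : measure_display) (T : measurableType d)
    (D : set T) (h : T -> R) : mbounded h ->
  measurable_fun D h /\ bounded_on D h.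
Proof.
by move=> [mh [C hC]]; split; [exact: measurable_funTS|exists C => x _; exact: hC].
Qed.

Lemma positive_functional_density (R : realType) (mu : {measure set (measurableTypeR R) -> \bar R})
    (D : set R) (k : R -> R) : measurable D -> mu.-integrable D (EFin \o k) ->
  (forall x, D x -> 0 <= k x) ->
  positive_functional D (fun h => \int[mu]_(x in D) (k x * h x)).
Proof.
move=> mD ik k0; split.
- move=> f h mf mh; rewrite -RintegralD//; [|by have [? ?] := mbounded_on D mf;
  exact: integrable_density|by have [? ?] := mbounded_on D mh; exact: integrable_density].
  by congr Rintegral; apply/funext => x; rewrite mulrDr.
- move=> c f mf; rewrite -RintegralZl//; last by have [? ?] := mbounded_on D mf;
  exact: integrable_density.
  by congr Rintegral; apply/funext => x; rewrite mulrCA.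
- move=> f h mf mh fh; apply: le_Rintegral => //; [by have [? ?] := mbounded_on D mf;
  exact: integrable_density|by have [? ?] := mbounded_on D mh; exact: integrable_density|].
  by move=> x Dx; rewrite ler_wpM2l ?k0 ?fh.
Qed.

(** Both integrals are positive functionals of h, and the density hypothesis says that they agree on
    indicators. *)
Lemma Rintegral_density (R : realType) (p : {measure set R -> \bar R})
    (mu : {measure set (measurableTypeR R) -> \bar R}) (D : set R) (k h : R -> R) :
  measurable D -> (p D < +oo)%E -> measurable_fun D k ->
  (forall x, D x -> 0 <= k x) ->
  (forall B, measurable B -> B `<=` D -> p B = (\int[mu]_(x in B) (k x)%:E)%E) ->
  mbounded h ->
  mu.-integrable D (EFin \o k) /\ \int[p]_(x in D) h x = \int[mu]_(x in D) (k x * h x).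
Proof.
move=> mD pD mk k0 pk mh.
have ik : mu.-integrable D (EFin \o k).
  apply/integrableP; split; first exact/measurable_EFinP.
  have -> : (\int[mu]_(x in D) `|(EFin \o k) x| = \int[mu]_(x in D) (k x)%:E)%E.
    by apply: eq_integral => x /set_mem Dx /=; rewrite ger0_norm// k0.
  by rewrite -pk.
split=> //.
apply: (@positive_functional_eq _ _ _ D (fun h => \int[p]_(x in D) h x)
  (fun h => \int[mu]_(x in D) (k x * h x))) => //.
- exact: positive_functional_Rintegral.
- exact: positive_functional_density.
- move=> B mB; transitivity (fine (p (B `&` D))); first exact: Rintegral_indic.
  rewrite pk//; last exact: measurableI.
  rewrite setIC -[LHS]/(Rintegral mu (D `&` B) k) Rintegral_mkcondr.
  congr Rintegral; apply/funext => x.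
  by rewrite patchE indicE; case: ifPn; rewrite ?mulr1 ?mulr0.
Qed.

Lemma indicU_disjoint (R : realType) (A B : set R) : A `&` B = set0 ->
  (\1_(A `|` B) : R -> R) = fun x => \1_A x + \1_B x.
Proof.
move=> AB; apply/funext => x; rewrite !indicE in_setU.
have [/set_mem Ax|] := boolP (x \in A); have [/set_mem Bx|] := boolP (x \in B) => //=;
  rewrite ?addr0 ?add0r//.
by have : (A `&` B) x by []; rewrite AB.
Qed.

(** Linearity gives finite additivity. Domination by the finite measure [lam] gives the rest: the
    tails of a disjoint union decrease to the empty set, so their mass tends to 0. *)
Lemma probability_of_functional (R : realType) (lam : {measure set (measurableTypeR R) -> \bar R})
    (D : set R) (F : (R -> R) -> R) (M : R) : measurable D -> (lam D < +oo)%E ->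
  positive_functional D F -> F (fun=> 1) = 1 ->
  (forall B, measurable B -> F \1_B <= M * fine (lam (B `&` D))) ->
  exists p : probability R R, forall B, measurable B -> p B = (F \1_B)%:E.
Proof.
move=> mD lamD pF F1 FM; have [FD FZ Fle] := pF.
have F0 : F (fun=> 0) = 0.
  rewrite -[RHS](mul0r (F (fun=> 1))) -FZ; last exact: mbounded_cst.
  by congr F; apply/funext => x; rewrite mul0r.
pose nu (B : set R) : \bar R := if `[< measurable B >] then (F \1_B)%:E else 0%E.
have nuE B : measurable B -> nu B = (F \1_B)%:E by move=> mB; rewrite /nu asboolT.
have Fge0 B : measurable B -> 0 <= F \1_B.
  move=> mB; rewrite -F0; apply: Fle; [exact: mbounded_cst|exact: mbounded_indic|].
  by move=> x _; rewrite indicE.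
have nu0 : nu set0 = 0%E by rewrite nuE// indic0 F0.
have nu_ge0 B : (0 <= nu B)%E.
  by rewrite /nu; case: asboolP => // mB; rewrite lee_fin Fge0.
have nuU A B : measurable A -> measurable B -> A `&` B = set0 ->
    F \1_(A `|` B) = F \1_A + F \1_B.
  by move=> mA mB AB; rewrite indicU_disjoint// FD//; exact: mbounded_indic.
have nu_sigma : semi_sigma_additive nu.
  move=> A mA tA mUA; rewrite nuE//.
  pose T n := \bigcup_(i in [set i | (n <= i)%N]) A i.
  have mT n : measurable (T n) by apply: bigcup_measurable.
  have T0 : T 0%N = \bigcup_i A i by congr bigcup; apply/seteqP.
  have TS n : T n = A n `|` T n.+1.
    apply/seteqP; split=> [x [i /= ni Aix]|x [Ax|[i /= ni Aix]]].
    - by move: ni; rewrite leq_eqVlt => /predU1P[->|ni]; [left|right; exists i].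
    - by exists n => /=.
    - by exists i => //=; exact: ltnW.
  have dT n : A n `&` T n.+1 = set0.
    apply/seteqP; split=> // x [Anx [i /= ni Aix]].
    have /(_ n i I I) := tA; have -> : n = i by apply: tA => //; exists x.
    by move=> _; move: ni; have -> : n = i by [apply: tA => //; exists x]; rewrite ltnn.
  have sE n : (\sum_(0 <= i < n) nu (A i))%E = (F \1_(\bigcup_i A i) - F \1_(T n))%:E.
    elim: n => [|n IH]; first by rewrite big_nil T0 subrr.
    rewrite big_nat_recr//= IH nuE// -EFinD; congr EFin.
    by rewrite (TS n) nuU//; ring.
  under eq_fun do rewrite sE.
  suff cv : F \1_(T n) @[n --> \oo] --> 0.
    apply: cvg_EFin; first by near=> n.
    rewrite -[X in _ --> X]subr0; apply: cvgB => //; exact: cvg_cst.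
  have cv2 : fine (lam (T n `&` D)) @[n --> \oo] --> 0.
    apply: fine_cvg.
    have -> : 0%:E = lam (\bigcap_n (T n `&` D)).
      rewrite (_ : \bigcap_n _ = set0) ?measure0//.
      apply/seteqP; split=> // x Tx; have [[i _ Aix] _] := Tx 0%N I.
      have [[j /= ij Ajx] _] := Tx i.+1 I.
      by move: ij; have -> : i = j by [apply: tA => //; exists x]; rewrite ltnn.
    apply: nonincreasing_cvg_mu.
    - apply: le_lt_trans lamD; apply: le_measure; rewrite ?inE//.
      exact: (measurableI _ _ (mT 0%N) mD).
    - by move=> i; exact: (measurableI _ _ (mT i) mD).
    - by apply: bigcapT_measurable => i; exact: (measurableI _ _ (mT i) mD).
    - move=> m n mn; apply/subsetPset => x [[i /= ni Aix] Dx]; split=> //.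
      by exists i => //=; exact: leq_trans ni.
  have cv3 : M * fine (lam (T n `&` D)) @[n --> \oo] --> 0.
    by rewrite -(mulr0 M); apply: cvgMr.
  apply: (squeeze_cvgr _ (cvg_cst 0) cv3).
  by near=> n; rewrite Fge0//= FM.
pose m := isMeasure.Build _ _ _ nu nu0 nu_ge0 nu_sigma.
pose nuM : {measure set R -> \bar R} := HB.pack nu m.
have nu1 : nuM setT = 1%E.
  by rewrite /= nuE// -F1; congr (F _)%:E; apply/funext => x; rewrite indicT.
pose p1 := Measure_isProbability.Build _ _ _ nuM nu1.
pose p : probability R R := HB.pack nu m p1.
by exists p => B mB; rewrite -nuE.
Unshelve. all: by end_near. Qed.

Lemma measurable_angles (R : realType) : measurable (angles : set R).
Proof. exact: measurable_itv. Qed.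

(** * The operator of the kernel and its Cesaro averages *)

Definition kernel_op (R : realType) (K : R.-pker R ~> R) (h : R -> R) (a : R) : R :=
  \int[K a]_(x in angles) h x.

Lemma kernel_le1 (R : realType) (K : R.-pker R ~> R) (a : R) (B : set R) :
  measurable B -> (K a B <= 1)%E.
Proof.
move=> mB; rewrite -(@prob_kernel _ _ _ _ _ K a).
by rewrite le_measure ?inE//; exact: subsetT.
Qed.

Lemma kernel_lty (R : realType) (K : R.-pker R ~> R) (a : R) (B : set R) :
  measurable B -> (K a B < +oo)%E.
Proof. by move=> mB; rewrite (le_lt_trans (kernel_le1 K a mB))// ltry. Qed.

Lemma positive_functional_kernel_op (R : realType) (K : R.-pker R ~> R) (a : R) :
  positive_functional angles (kernel_op K ^~ a).
Proof.
apply: positive_functional_Rintegral; first exact: measurable_angles.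
by apply: kernel_lty; exact: measurable_angles.
Qed.

Lemma kernel_op_bound (R : realType) (K : R.-pker R ~> R) (h : R -> R) (C : R) (a : R) :
  mbounded h -> (forall x, `|h x| <= C) -> `|kernel_op K h a| <= C.
Proof.
move=> mh hC.
have C0 : 0 <= C by apply: le_trans (hC 0).
have mA := @measurable_angles R.
have ih : (K a).-integrable angles (EFin \o h) by apply: mbounded_integrable => //;
  exact: kernel_lty.
rewrite (le_trans (le_normr_Rintegral mA ih))//.
apply: (@le_trans _ _ (\int[K a]_(x in angles) C)).
  apply: le_Rintegral => //; first exact: integrable_norm.
  by apply: (@mbounded_integrable _ _ _ _ _ (fun=> C)) => //;
    [exact: kernel_lty|exact: mbounded_cst].
rewrite Rintegral_cst// ler_piMr// -lee_fin fineK ?kernel_le1// ge0_fin_numE//.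
exact: kernel_lty.
Qed.

Lemma kernel_op_cst (R : realType) (K : R.-pker R ~> R) (c a : R) :
  markov_on_angles K -> a \in angles -> kernel_op K (fun=> c) a = c.
Proof.
move=> hK aA; rewrite /kernel_op Rintegral_cst; last exact: measurable_angles.
by rewrite hK// mulr1.
Qed.

Lemma measurable_kernel_op (R : realType) (K : R.-pker R ~> R) (h : R -> R) :
  mbounded h -> measurable_fun setT (kernel_op K h).
Proof.
move=> mh; have [C hC] := mh.2; have mA := @measurable_angles R.
have mc : mbounded (fun _ : R => C) by exact: mbounded_cst.
have mhc : mbounded (fun x => h x + C) by exact: mboundedD.
(* Adding C makes the integrand nonnegative, so that its integral is a measurable function of a; C
   times the mass of [angles] is then taken off. *)
have -> : kernel_op K h = fun a => fine (\int[K a]_x (((h x + C) * \1_angles x)%:E))%E - C *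
  fine (K a angles).
  apply/funext => a; rewrite -[X in fine X](_ : (\int[K a]_(x in angles) (h x + C)%:E)%E = _).
    rewrite -[X in X - _]/(kernel_op K (fun x => h x + C) a).
    have [KD KZ _] := positive_functional_kernel_op K a.
    rewrite KD//; have -> : kernel_op K (fun=> C) a = C * fine (K a angles) by exact: Rintegral_cst.
    by rewrite addrK.
  rewrite [LHS]integral_mkcond; apply: eq_integral => x _.
  by rewrite patchE indicE; case: ifPn; rewrite ?mulr1 ?mulr0.
apply: measurable_funB; last first.
  apply: measurable_funM => //; apply: (measurableT_comp (fine_measurable measurableT)) => //.
  exact: measurable_kernel.
apply: (measurableT_comp (fine_measurable measurableT)).
apply: measurable_fun_integral_kernel.
- by move=> U mU; exact: measurable_kernel.
- move=> x; rewrite lee_fin mulr_ge0// ?indicE//.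
  by have := hC x I; rewrite ler_norml => /andP[? _]; lra.
- apply/measurable_EFinP; apply: measurable_funM; first exact: mhc.1.
  exact: measurable_indic.
Qed.

Lemma mbounded_kernel_op (R : realType) (K : R.-pker R ~> R) (h : R -> R) :
  mbounded h -> mbounded (kernel_op K h).
Proof.
move=> mh; split; first exact: measurable_kernel_op.
by have [C hC] := mh.2; exists C => a _; apply: kernel_op_bound => // x; exact: hC.
Qed.

Lemma iter_kernel_op_bound (R : realType) (K : R.-pker R ~> R) (h : R -> R) (C : R) k :
  mbounded h -> (forall x, `|h x| <= C) ->
  mbounded (iter k (kernel_op K) h) /\ forall a, `|iter k (kernel_op K) h a| <= C.
Proof.
move=> mh hC; elim: k => // k [mi iC] /=; split; first exact: mbounded_kernel_op.
by move=> a; exact: kernel_op_bound.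
Qed.

Lemma mbounded_iter (R : realType) (K : R.-pker R ~> R) (h : R -> R) k :
  mbounded h -> mbounded (iter k (kernel_op K) h).
Proof. by move=> mh; elim: k => //= k; exact: mbounded_kernel_op. Qed.

Lemma positive_functional_iter (R : realType) (K : R.-pker R ~> R) k (a : R) :
  a \in angles -> positive_functional angles (fun h => iter k (kernel_op K) h a).
Proof.
move=> aA; split.
- move=> f h mf mh; move: a {aA}; elim: k => [//|k IH] a /=.
  have [KD _ _] := positive_functional_kernel_op K a.
  rewrite -KD//; [|exact: mbounded_iter..].
  by congr (kernel_op K _ _); apply/funext => x; exact: IH.
- move=> c f mf; move: a {aA}; elim: k => [//|k IH] a /=.
  have [_ KZ _] := positive_functional_kernel_op K a.
  rewrite -KZ//; last exact: mbounded_iter.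
  by congr (kernel_op K _ _); apply/funext => x; exact: IH.
- move=> f h mf mh fh; elim: k a aA => [a /set_mem aA|k IH a aA]; first exact: fh.
  have [_ _ Kle] := positive_functional_kernel_op K a.
  by apply: Kle; [exact: mbounded_iter..|move=> x /mem_set; exact: IH].
Qed.

Definition cesaro (R : realType) (K : R.-pker R ~> R) (n : nat) (h : R -> R) (a : R) : R :=
  n.+1%:R^-1 * \sum_(k < n.+1) iter k (kernel_op K) h a.

Lemma positive_functional_cesaro (R : realType) (K : R.-pker R ~> R) n (a : R) :
  a \in angles -> positive_functional angles (fun h => cesaro K n h a).
Proof.
move=> aA; have pf k := positive_functional_iter K k aA; split.
- move=> f h mf mh; rewrite /cesaro -mulrDr -big_split/=; congr (_ * _).
  by apply: eq_bigr => k _; have [+ _ _] := pf k; apply.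
- move=> c f mf; rewrite /cesaro mulrCA; congr (_ * _); rewrite mulr_sumr.
  by apply: eq_bigr => k _; have [_ + _] := pf k; apply.
- move=> f h mf mh fh; rewrite ler_wpM2l// ler_sum// => k _.
  by have [_ _ +] := pf k; apply.
Qed.

Lemma cesaro_bound (R : realType) (K : R.-pker R ~> R) n (h : R -> R) (C : R) a :
  mbounded h -> (forall x, `|h x| <= C) -> `|cesaro K n h a| <= C.
Proof.
move=> mh hC; rewrite normrM ger0_norm// mulrC ler_pdivrMr ?ltr0n//.
rewrite (le_trans (ler_norm_sum _ _ _))//.
rewrite (@le_trans _ _ (\sum_(k < n.+1) C))//; last by rewrite sumr_const card_ord mulr_natr.
by apply: ler_sum => k _; have [_ ->] := iter_kernel_op_bound K k mh hC.
Qed.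

(** Telescoping. For bounded h the right-hand side is O(1 / n) uniformly in a, which makes
    generalized limits of these averages invariant under K. *)
Lemma cesaro_shift (R : realType) (K : R.-pker R ~> R) n (h : R -> R) a :
  cesaro K n (kernel_op K h) a - cesaro K n h a =
  n.+1%:R^-1 * (iter n.+1 (kernel_op K) h a - h a).
Proof.
rewrite /cesaro -mulrBr; congr (_ * _).
under eq_bigr do rewrite -iterSr.
by rewrite big_ord_recr/= [X in _ - X]big_ord_recl/=; ring.
Qed.

Lemma cesaro_cst (R : realType) (K : R.-pker R ~> R) n (c a : R) :
  markov_on_angles K -> a \in angles -> cesaro K n (fun=> c) a = c.
Proof.
move=> hK aA; rewrite /cesaro (eq_bigr (fun=> c)).
  by rewrite sumr_const card_ord -(mulr_natl c) mulKf// pnatr_eq0.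
move=> k _; elim: {k}(val k) a aA => // k IH a aA /=.
rewrite -[RHS](kernel_op_cst c hK aA).
by apply: eq_Rintegral => x xA; exact: IH.
Qed.

(** One-sided and valid for all large n, so that the bounds for g and for -g can be combined at a
    common n. *)
Lemma cesaro_le (R : realType) (K : R.-pker R ~> R) (lam : {measure set (measurableTypeR R) ->
  \bar R})
    (M : R) (mu : probability R R) (g : R -> R) (e : R) :
  markov_on_angles K -> (lam angles < +oo)%E -> 0 <= M ->
  (forall a B, a \in angles -> measurable B -> B `<=` angles ->
    fine (K a B) <= M * fine (lam B)) ->
  unique_invariant_probability K mu -> mbounded g -> 0 < e ->
  exists N, forall n a, (N <= n)%N -> a \in angles ->
    cesaro K n g a <= \int[mu]_(x in angles) g x + e.
Proof.
move=> hK lamA M0 hM hmu mg e0; apply: contrapT => /forallNP noN.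
have mA := @measurable_angles R.
(* If the bound fails for every N, there are bad pairs (n, a) with n arbitrarily large; F below is a
   generalized limit of the averages along them. *)
have /choice[f hf] : forall k : nat, exists na : nat * R, [/\ (k <= na.1)%N, na.2 \in angles &
    \int[mu]_(x in angles) g x + e < cesaro K na.1 g na.2].
  move=> k; apply: contrapT => H; apply: (noN k) => n a kn aA.
  by rewrite leNgt; apply/negP => lt; apply: H; exists (n, a).
have aA k : (f k).2 \in angles by have [] := hf k.
have [L [LD LZ Lle Lcvg]] := generalized_limit R.
pose u (h : R -> R) k := cesaro K (f k).1 h (f k).2.
have bu h : mbounded h -> bounded_on (fun=> True) (u h).
  by move=> mh; have [C hC] := mh.2; exists C => k _; apply: cesaro_bound => // x; exact: hC.
pose F h := L (u h).
have pu k := positive_functional_cesaro K (f k).1 (aA k).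
have pF : positive_functional angles F.
  split.
  - move=> h1 h2 m1 m2; rewrite /F -LD; [|exact: bu..].
    by congr L; apply/funext => k; have [+ _ _] := pu k; apply.
  - move=> c h mh; rewrite /F -LZ; last exact: bu.
    by congr L; apply/funext => k; have [_ + _] := pu k; apply.
  - move=> h1 h2 m1 m2 h12; apply: Lle; [exact: bu..|].
    by move=> k; have [_ _ +] := pu k; apply.
have [FD FZ Fle] := pF.
have Fc c : F (fun=> c) = c.
  apply: Lcvg; rewrite (_ : u _ = fun=> c); first exact: cvg_cst.
  by apply/funext => k; exact: cesaro_cst.
have FK h : mbounded h -> F (kernel_op K h) = F h.
  move=> mh; have [C hC] := mh.2.
  have mKh := mbounded_kernel_op K mh.
  apply/eqP; rewrite -subr_eq0; apply/eqP.
  have -> : F (kernel_op K h) - F h = L (fun k => u (kernel_op K h) k + -1 * u h k).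
    rewrite LD; [|exact: bu|exact: (bounded_onM (bounded_on_cst _ (-1)) (bu _ mh))].
    by rewrite LZ ?mulN1r//; exact: bu.
  apply: Lcvg.
  have c2 : (2 * C) * harmonic k @[k --> \oo] --> (0 : R).
    by rewrite -[X in _ --> X](mulr0 (2 * C)); apply: cvgMr; exact: cvg_harmonic.
  have c1 : - ((2 * C) * harmonic k) @[k --> \oo] --> (0 : R).
    by rewrite -[X in _ --> X]oppr0; apply: cvgN.
  apply: (squeeze_cvgr _ c1 c2); near=> k.
  rewrite -ler_norml mulN1r cesaro_shift normrM ger0_norm// mulrC.
  apply: ler_pM => //.
    rewrite (le_trans (ler_normB _ _))// mulr_natl mulr2n lerD ?hC//.
    by have [_ ->] := iter_kernel_op_bound K (f k).1.+1 mh (hC^~ I).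
  by rewrite lef_pV2 ?posrE ?ltr0n// ler_nat ltnS; have [] := hf k.
have FA h1 h2 : mbounded h1 -> mbounded h2 -> (forall x, angles x -> h1 x = h2 x) -> F h1 = F h2.
  by move=> m1 m2 h12; apply/le_anti; rewrite !Fle// => x xA; rewrite h12.
have K1 B a : measurable B -> kernel_op K \1_B a = fine (K a (B `&` angles)).
  by move=> mB; rewrite /kernel_op Rintegral_indic.
(* The averages contain the Dirac mass at the bad angle and are not dominated by [lam]. F is, by
   invariance: its value at an indicator equals its value at the image under K, which is at most M
   lam(B) on [angles]. *)
have [p pE] : exists p : probability R R, forall B, measurable B -> p B = (F \1_B)%:E.
  apply: (@probability_of_functional _ lam angles F M) => // B mB.
  have mB1 := mbounded_indic R mB.
  rewrite -FK// -(Fc (M * _)); apply: Fle => [|//|].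
  - exact: mbounded_kernel_op.
  - exact: mbounded_cst.
  - move=> x xA; rewrite K1// hM//; [exact: mem_set|exact: measurableI].
have pI B : measurable B -> p (B `&` angles) = p B.
  move=> mB; rewrite !pE//; last exact: measurableI.
  congr EFin; apply: FA; [by apply: mbounded_indic; exact: measurableI|exact: mbounded_indic|].
  by move=> x xA; rewrite !indicE in_setI (mem_set xA) andbT.
have FE h : mbounded h -> F h = \int[p]_(x in angles) h x.
  apply: (@positive_functional_eq _ _ _ angles F (fun h => \int[p]_(x in angles) h x)) => //.
    by apply: positive_functional_Rintegral => //; exact: probability_lty.
  move=> B mB; transitivity (fine (p (B `&` angles))); last by rewrite /Rintegral integral_indic.
  by rewrite pI// pE.
have pinv : invariant_probability K p.
  split; first by rewrite -[angles]setTI pI// probability_setT.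
  move=> B mB BA; rewrite pE// -FK; last exact: mbounded_indic.
  have mK := mbounded_kernel_op K (mbounded_indic R mB).
  rewrite FE// /Rintegral fineK.
    by apply: eq_integral => x _; rewrite K1// setIidl// fineK// ge0_fin_numE// kernel_lty.
  apply: integrable_fin_num => //.
  by apply: mbounded_integrable => //; exact: probability_lty.
have pmu := hmu.2 p pinv.
(* At the bad pairs the averages exceed the mean by e, hence so does F g; but F is integration
   against p, which is [mu] by uniqueness. *)
have : \int[mu]_(x in angles) g x + e <= F g.
  rewrite -(Fc (_ + e)); apply: Lle; [exact/bu/mbounded_cst|exact: bu|].
  by move=> k; rewrite /u cesaro_cst//; have [_ _ /ltW] := hf k.
rewrite FE// (_ : \int[p]_(x in angles) g x = \int[mu]_(x in angles) g x); last first.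
  by congr fine; apply: eq_measure_integral => B mB _; exact: pmu.
by rewrite gerDl leNgt e0.
Unshelve. all: by end_near. Qed.

(* Otherwise a generalized limit of Cesaro averages taken at bad angles would
   define another invariant probability; it is countably additive because it is
   dominated by [lam]. *)
Lemma uniform_ergodic (R : realType) (K : R.-pker R ~> R) (lam :
  {measure set (measurableTypeR R) -> \bar R})
    (M : R) (mu : probability R R) (g : R -> R) (e : R) :
  markov_on_angles K -> (lam angles < +oo)%E -> 0 <= M ->
  (forall a B, a \in angles -> measurable B -> B `<=` angles ->
    fine (K a B) <= M * fine (lam B)) ->
  unique_invariant_probability K mu -> mbounded g -> 0 < e ->
  exists n, forall a, a \in angles ->
    `|cesaro K n g a - \int[mu]_(x in angles) g x| <= e.
Proof.
move=> hK lamA M0 hM hmu mg e0.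
have [N1 hN1] := cesaro_le hK lamA M0 hM hmu mg e0.
have mgN : mbounded (fun x => -1 * g x) by exact: mboundedZ.
have [N2 hN2] := cesaro_le hK lamA M0 hM hmu mgN e0.
exists (maxn N1 N2) => a aA.
have h1 := hN1 _ a (leq_maxl N1 N2) aA; have h2 := hN2 _ a (leq_maxr N1 N2) aA.
have [_ cZ _] := positive_functional_cesaro K (maxn N1 N2) aA.
have mA := @measurable_angles R.
have [_ iZ _] := positive_functional_Rintegral mA (probability_lty mu mA).
rewrite cZ// iZ// in h2.
by rewrite ler_norml; apply/andP; split; lra.
Qed.

(** [phi] is the average over j <= n of the partial sums q + K q + ... + K^j q. Telescoping gives
    phi - K phi = q - K (cesaro n q), without any convergence of K^n q. The statement concerns K phi
    because that function will be uniformly continuous. *)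
Lemma approx_poisson (R : realType) (K : R.-pker R ~> R) (lam :
  {measure set (measurableTypeR R) -> \bar R})
    (M : R) (mu : probability R R) (q : R -> R) (e : R) :
  markov_on_angles K -> (lam angles < +oo)%E -> 0 <= M ->
  (forall a B, a \in angles -> measurable B -> B `<=` angles ->
    fine (K a B) <= M * fine (lam B)) ->
  unique_invariant_probability K mu -> mbounded q -> 0 < e ->
  exists2 phi, mbounded phi & forall a, a \in angles ->
    `|kernel_op K phi a - kernel_op K (kernel_op K phi) a -
      (kernel_op K q a - \int[mu]_(x in angles) q x)| <= e.
Proof.
move=> hK lamA M0 hM hmu mq e0.
have [n hn] := uniform_ergodic hK lamA M0 hM hmu mq e0.
set rho := \int[mu]_(x in angles) q x in hn *.
have [w wE] : exists w : R, w * n.+1%:R = 1 by exists n.+1%:R^-1; rewrite mulVf.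
pose S j (a : R) : R := \sum_(k < j) iter k (kernel_op K) q a.
have mit k : mbounded (iter k (kernel_op K) q) by exact: mbounded_iter.
have mS j : mbounded (S j) by apply: (@mbounded_sum _ _ _ (fun k => iter k (kernel_op K) q)).
have mSS : mbounded (fun a => \sum_(j < n.+1) S j.+1 a).
  by apply: (@mbounded_sum _ _ _ (fun j => S j.+1)) => j; exact: mS.
pose phi a := w * \sum_(j < n.+1) S j.+1 a.
have mphi : mbounded phi by exact: mboundedZ.
have pf (a : R) := positive_functional_kernel_op K a.
have KS j a : kernel_op K (S j) a = \sum_(k < j) iter k.+1 (kernel_op K) q a.
  by rewrite (positive_functional_sum j (pf a) mit).
have phiK a : phi a - kernel_op K phi a = q a - kernel_op K (cesaro K n q) a.
  have -> : kernel_op K phi a = w * \sum_(j < n.+1) kernel_op K (S j.+1) a.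
    have [_ KZ _] := pf a; rewrite KZ//; congr (_ * _).
    exact: (positive_functional_sum n.+1 (pf a) (fun j => mS j.+1)).
  have -> : kernel_op K (cesaro K n q) a = w * \sum_(j < n.+1) iter j.+1 (kernel_op K) q a.
    have [_ KZ _] := pf a; rewrite KZ//; last by exact: (mS n.+1).
    have -> : w = n.+1%:R^-1 by rewrite -[LHS](mulfK (_ : n.+1%:R != 0)) ?wE ?mul1r.
    by congr (_ * _); exact: KS.
  rewrite /phi -mulrBr -sumrB -[in RHS](mul1r (q a)) -wE -mulrA -mulrBr; congr (_ * _).
  rewrite mulr_natl -[X in _ *+ X]card_ord -sumr_const -sumrB; apply: eq_bigr => j _.
  rewrite KS /S big_ord_recl/= [X in _ - X = _]big_ord_recr/=; ring.
exists phi => // a aA.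
have mKphi := mbounded_kernel_op K mphi.
have mc := mS n.+1; have mces : mbounded (cesaro K n q) by exact: mboundedZ.
have [KD KZ Kle] := pf a.
have -> : kernel_op K phi a - kernel_op K (kernel_op K phi) a - (kernel_op K q a - rho) =
    - (kernel_op K (kernel_op K (cesaro K n q)) a - rho).
  have : kernel_op K (fun x => phi x + -1 * kernel_op K phi x) a =
      kernel_op K (fun x => q x + -1 * kernel_op K (cesaro K n q) x) a.
    by congr (kernel_op K _ _); apply/funext => x; have := phiK x; lra.
  have mKc := mbounded_kernel_op K mces.
  rewrite (KD phi _ mphi (mboundedZ (-1) mKphi)) (KZ _ _ mKphi).
  by rewrite (KD q _ mq (mboundedZ (-1) mKc)) (KZ _ _ mKc); lra.
(* K preserves constants and is monotone on [angles], so two more applications do not enlarge the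
   error. *)
have H (h : R -> R) : mbounded h -> (forall x, x \in angles -> `|h x - rho| <= e) ->
    forall x, x \in angles -> `|kernel_op K h x - rho| <= e.
  move=> mh hr x xA; have [_ _ le] := pf x.
  have h1 : kernel_op K h x <= kernel_op K (fun=> rho + e) x.
    apply: le => //; first exact: mbounded_cst.
    by move=> y /mem_set/hr; rewrite ler_norml => /andP[_]; lra.
  have h2 : kernel_op K (fun=> rho - e) x <= kernel_op K h x.
    apply: le => //; first exact: mbounded_cst.
    by move=> y /mem_set/hr; rewrite ler_norml => /andP[+ _]; lra.
  rewrite !kernel_op_cst// in h1 h2.
  by rewrite ler_norml; apply/andP; split; lra.
by rewrite normrN; apply: (H) => //; [exact: mbounded_kernel_op|exact: H].
Qed.

(** * Consequences of the density of the kernel *)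

Lemma regular_density_section (R : realType) (K : R.-pker R ~> R) (kappa : R -> R -> R) (a : R) :
  regular_density K kappa -> a \in angles -> measurable_fun angles (kappa a).
Proof.
move=> [mk _ _ _ _] aA.
have mA := @measurable_angles R.
apply: (@measurable_comp _ _ _ _ _ _ (angles `*` angles) (fun p : R * R =>
  kappa p.1 p.2) angles (fun x => (a, x))) => //.
- exact: measurableX.
- by move=> _ [x xA <-]; split=> //; exact/set_mem.
- by apply: measurable_funTS; exact: measurable_pair1.
Qed.

Lemma lebesgue_angles_lty (R : realType) : (@lebesgue_measure R angles < +oo)%E.
Proof. by rewrite /angles lebesgue_measure_itv/=; case: ifP => _; rewrite -?EFinB ltry. Qed.

Lemma kernel_op_density (R : realType) (K : R.-pker R ~> R) (kappa : R -> R -> R)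
    (a : R) (h : R -> R) : regular_density K kappa -> a \in angles -> mbounded h ->
  (@lebesgue_measure R).-integrable angles (EFin \o kappa a) /\
  kernel_op K h a = \int[lebesgue_measure]_(x in angles) (kappa a x * h x).
Proof.
move=> hk aA mh; have [mk k0 _ kd _] := hk; have mA := @measurable_angles R.
apply: Rintegral_density => //.
- exact: kernel_lty.
- exact: regular_density_section hk aA.
- by move=> x /mem_set xA; exact: k0.
- by move=> B mB BA; exact: kd.
Qed.

(** Smoothing: equicontinuity of [kappa] in its first argument passes to K h for every bounded
    measurable h. This is what makes the corrector continuous. *)
Lemma kernel_op_uniform_continuous (R : realType) (K : R.-pker R ~> R)
    (kappa : R -> R -> R) (h : R -> R) (e : R) :
  regular_density K kappa -> mbounded h -> 0 < e -> exists2 delta : R, 0 < delta &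
  forall a a', a \in angles -> a' \in angles -> `|a - a'| <= delta ->
    `|kernel_op K h a - kernel_op K h a'| <= e.
Proof.
move=> hk mh e0; have [_ _ _ _ equi] := hk; have mA := @measurable_angles R.
have [C hC] := mh.2.
have C0 : 0 <= C by apply: le_trans (hC 0 I).
pose l := fine (@lebesgue_measure R angles).
have l0 : 0 <= l by rewrite fine_ge0.
have e1 : 0 < e / (C * l + 1) by rewrite divr_gt0//; have := mulr_ge0 C0 l0; lra.
have [delta d0 [_ hd]] := equi _ e1.
exists delta => // a a' aA a'A aa'.
have [ia ->] := kernel_op_density hk aA mh; have [ia' ->] := kernel_op_density hk a'A mh.
have [mh1 mh2] := mbounded_on angles mh.
have iah := @integrable_density _ _ (measurableTypeR R) lebesgue_measure angles _ h mA ia mh1 mh2.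
have ia'h := @integrable_density _ _ (measurableTypeR R) lebesgue_measure angles _ h mA ia' mh1 mh2.
rewrite -RintegralB//.
have idf : (@lebesgue_measure R).-integrable angles (EFin \o (fun x =>
  kappa a x * h x - kappa a' x * h x)).
  by have := @integrableB _ (measurableTypeR R) R lebesgue_measure angles mA _ _ iah ia'h.
rewrite (le_trans (@le_normr_Rintegral _ (measurableTypeR R) R lebesgue_measure angles _ mA idf))//.
apply: (@le_trans _ _ (\int[lebesgue_measure]_(x in angles) (e / (C * l + 1) * C))).
  apply: le_Rintegral => //; first exact: integrable_norm.
    apply: bounded_integrable => //; [exact: lebesgue_angles_lty|exact: bounded_on_cst].
  move=> x xA; rewrite -mulrBl normrM ler_pM//; last exact: hC.
  by apply: hd => //; exact: mem_set.
rewrite Rintegral_cst// -/l -mulrA mulrAC ler_pdivrMr; last by have := mulr_ge0 C0 l0; lra.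
by rewrite ler_pM2l//; lra.
Qed.

Lemma kernel_dominated (R : realType) (K : R.-pker R ~> R) (kappa : R -> R -> R) :
  regular_density K kappa -> exists2 M : R, 0 <= M &
  forall a B, a \in angles -> measurable B -> B `<=` angles ->
    fine (K a B) <= M * fine (@lebesgue_measure R B).
Proof.
move=> hk; have [_ k0 [M hM] kd _] := hk; have mA := @measurable_angles R.
exists `|M| => // a B aA mB BA.
have lB : (@lebesgue_measure R B < +oo)%E.
  by rewrite (le_lt_trans _ (@lebesgue_angles_lty R))// le_measure ?inE.
have [ia _] := kernel_op_density hk aA (mbounded_cst _ (0 : R)).
have -> : K a B = (\int[lebesgue_measure]_(x in B) (kappa a x)%:E)%E by exact: kd.
rewrite -[leLHS]/(Rintegral lebesgue_measure B (kappa a)).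
rewrite -Rintegral_cst//; apply: le_Rintegral => //.
- exact: integrableS ia.
- by apply: bounded_integrable => //; exact: bounded_on_cst.
- move=> x /BA/mem_set xA; rewrite (le_trans (hM _ _ aA xA))//; exact: ler_norm.
Qed.

(** The tangent is continuous on the open interval; the endpoints, where the cosine vanishes, are
    split off as singletons. *)
Lemma measurable_tan_angles (R : realType) : measurable_fun angles (@tan R).
Proof.
have hp : 0 < (pi : R) := @pi_gt0 R.
rewrite (_ : angles = `]- (pi / 2), pi / 2[%classic `|` ([set - (pi / 2)] `|` [set pi / 2])).
  apply/measurable_funU => //; first exact: measurableU.
  split; last first.
    by apply/measurable_funU => //; split; exact: measurable_fun_set1.
  apply: open_continuous_measurable_fun => //.
  move=> x /set_mem/=; rewrite in_itv/= => xI; apply: continuous_tan.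
  by rewrite gt_eqF// cos_gt0_pihalf.
apply/seteqP; split=> x /=; rewrite !in_itv/=.
  move=> /andP[x1' x2']; have x1 : - (pi / 2) <= x := x1'; have x2 : x <= pi / 2 := x2'.
  have [->|n1] := eqVneq x (- (pi / 2)); first by right; left.
  have [->|n2] := eqVneq x (pi / 2); first by right; right.
  by left; rewrite !lt_neqAle x1 x2 n2 eq_sym n1.
move=> xI; have : - (pi / 2) <= x <= pi / 2 by case: xI => [/andP[/ltW-> /ltW->]//|[->|->]];
  apply/andP; split; lra.
by [].
Qed.

(** [f] may be unbounded on D, as the tangent is, but p does not charge D outside S; the density
    vanishes almost everywhere there, so cutting f off at S changes nothing. *)
Lemma Rintegral_density_restrict (R : realType) (p : {measure set R -> \bar R})
    (D S : set R) (k f : R -> R) : measurable D -> measurable S -> (p D < +oo)%E ->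
  p (D `\` S) = 0%E -> measurable_fun D k -> (forall x, D x -> 0 <= k x) ->
  (forall B, measurable B -> B `<=` D ->
    p B = (\int[lebesgue_measure]_(x in B) (k x)%:E)%E) ->
  measurable_fun D f -> mbounded (f \_ S) ->
  \int[p]_(x in D) (f \_ S) x = \int[lebesgue_measure]_(x in D) (k x * f x).
Proof.
move=> mD mS pD pDS mk k0 pk mf mfS.
have [ik ->] := Rintegral_density mD pD mk k0 pk mfS.
have mDS : measurable (D `\` S) by exact: measurableD.
congr fine; apply: ae_eq_integral => //.
- by apply/measurable_EFinP; apply: measurable_funM => //; apply: measurable_funTS; exact: mfS.1.
- by apply/measurable_EFinP; exact: measurable_funM.
- have mkE : measurable_fun (D `\` S) (EFin \o k).
    by apply/measurable_EFinP; apply: measurable_funS mk => // x [].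
  have : ae_eq lebesgue_measure (D `\` S) (EFin \o k) (cst 0%E).
    apply/(ae_eq_integral_abs lebesgue_measure mDS mkE).
    rewrite -[RHS]pDS pk//.
    by apply: eq_integral => x /set_mem[Dx _] /=; rewrite ger0_norm// k0.
  apply: filterS => x h Dx; congr EFin; rewrite patchE; case: ifPn => // xS.
  have /= : (k x)%:E = 0%E by apply: h; split=> // /mem_set; exact/negP.
  by move=> [->]; rewrite !mul0r.
Qed.

Lemma norm_tan_le (R : realType) (theta0 x : R) : theta0 < pi / 2 ->
  `|x| <= theta0 -> `|tan x| <= tan theta0.
Proof.
move=> t2 xt; have hp : 0 < (pi : R) := @pi_gt0 R.
move: (xt); rewrite !ler_norml => /andP[x1 x2]; rewrite -tanN.
by have n0 := le_trans (normr_ge0 x) xt; rewrite !le_tan//; apply/andP; split; lra.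
Qed.

Lemma mbounded_tan (R : realType) (theta0 : R) (n : nat) : theta0 < pi / 2 ->
  mbounded ((fun x => tan x ^+ n) \_ `[- theta0, theta0]).
Proof.
move=> t2; split.
  apply/(measurable_restrictT _ _).1; first exact: measurable_itv.
  apply: measurable_funX; apply: measurable_funS (@measurable_tan_angles R) => //.
    exact: measurable_angles.
  move=> x /=; rewrite !in_itv/= => xI.
  have : - (pi / 2) <= (x : R) <= pi / 2 by move/andP: xI => [? ?]; apply/andP; split; lra.
  by [].
exists (`|tan theta0| ^+ n) => x _; rewrite patchE; case: ifPn; last first.
  by rewrite normr0 => _; rewrite exprn_ge0.
move=> /set_mem/=; rewrite in_itv/= -ler_norml => xI.
rewrite normrX lerXn2r ?nnegrE//.
by rewrite (le_trans (norm_tan_le t2 xI))// ler_norm.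
Qed.

(** * Expansion of the Lyapunov function *)

Lemma powR_le_neg (R : realType) (a x y : R) : a <= 0 -> 0 < x -> x <= y ->
  y `^ a <= x `^ a.
Proof.
move=> a0 x0 xy; have y0 := lt_le_trans x0 xy.
have e t : t `^ a = (t `^ (- a))^-1 by rewrite powRN invrK.
rewrite !e lef_pV2 ?posrE ?powR_gt0//.
by rewrite ge0_ler_powR ?nnegrE ?oppr_ge0// ltW.
Qed.

(* The correction by [psi] is of the order of the drift of [z ^ p]; it serves to
   average that drift over the chain of angles. *)
Definition lyapunov (R : realType) (g p : R) (psi : R -> R) (s : R * R * R) : R :=
  s.1.1 `^ p * (1 + (s.1.1 `^ (g - 1)) ^+ 2 * psi s.2).

(** [eta] absorbs two errors: the third-order remainders, which carry an extra factor y, and the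
    replacement of psi at the incoming angle by psi b, two angles that differ by theta z + theta z'
    = O(y). *)
Lemma lyapunov_expansion (R : realType) (g theta0 p : R) (psi : R -> R) (eta : R) :
  0 < g < 1 -> 0 < theta0 < pi / 2 -> 0 < eta ->
  bounded_on (fun=> True) psi ->
  (forall e : R, 0 < e -> exists2 delta : R, 0 < delta & forall a a' : R, a \in angles ->
    a' \in angles -> `|a - a'| <= delta -> `|psi a - psi a'| <= e) ->
  exists2 y0 : R, 0 < y0 & forall z j a b : R, good_state (z, j, a) -> 0 < z ->
    z `^ (g - 1) <= y0 -> `|b| <= theta0 ->
    let y := z `^ (g - 1) in let T := tan b in
    z / 2 <= (next_state g (z, j, a) b).1.1 /\
    `|lyapunov g p psi (next_state g (z, j, a) b) - z `^ p * (1 + 2 * p * y * T +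
      y ^+ 2 * (2 * p * g * (1 + 2 * T ^+ 2) + 2 * p * (p - 1) * T ^+ 2 + psi b))|
      <= eta * (z `^ p * y ^+ 2).
Proof.
move=> g01 t02 eta0 [Cpsi hCpsi] ucpsi; have /andP[g0 g1] := g01; have /andP[t0 t2] := t02.
have hp : 0 < (pi : R) := @pi_gt0 R.
have [y1 [T1 [y10 T10 far]]] := far_next_state g01 t02.
have tant0 : 0 <= tan theta0 by apply: le_trans (norm_tan_le t2 _); rewrite // ger0_norm// ltW.
(* [6 * T1] yields |d| <= 1 / 2, since |d| <= 3 y T1; the last bound yields |g y T| <= 1 / 2. *)
pose y2 : R := Num.min y1 (Num.min (1 / (6 * T1)) (1 / (2 * g * tan theta0 + 1))).
have gt0 : 0 < 2 * g * tan theta0 + 1 by have := mulr_ge0 (ltW g0) tant0; lra.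
have y20 : 0 < y2 by rewrite !lt_min y10 !divr_gt0// mulr_gt0.
(* An index packs a state with an outgoing angle, so that all error terms are uniform in both. *)
pose I : Type := (R * R * R * R)%type.
pose Z' (i : I) : R := (next_state g i.1 i.2).1.1.
pose A' (i : I) : R := (next_state g i.1 i.2).2.
pose P (i : I) : Prop := [/\ good_state i.1, 0 < i.1.1.1, i.1.1.1 `^ (g - 1) <= y2 & `|i.2|
  <= theta0].
pose y (i : I) : R := i.1.1.1 `^ (g - 1).
pose T (i : I) : R := tan i.2.
pose t (i : I) : R := tan (theta g i.1.1.1 + i.2).
pose d (i : I) : R := Z' i / i.1.1.1 - 1.
have facts i : P i -> [/\ i.1.1.1 / 2 <= Z' i <= 2 * i.1.1.1, `|t i| <= T1,
    0 < cos (theta g i.1.1.1 + i.2),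
    Z' i - i.1.1.1 = (i.1.1.1 `^ g + Z' i `^ g) * t i &
    A' i = i.2 + theta g i.1.1.1 + theta g (Z' i)].
  case: i => [[[z j] a] b] [[z0 j1 _] /= zp zy bt].
  have [|z' [h1 h2 h3 h4 h5]] := far z j a b zp _ j1 bt.
    by rewrite (le_trans zy)// ge_min lexx.
  by rewrite /Z' /A' /t [next_state g (_, b).1 _]h5.
have y0 i : P i -> 0 < y i by move=> [_ zp _ _]; rewrite powR_gt0.
have yle i : P i -> y i <= y2 by move=> [].
have by_ : bounded_on P y by exists y2 => i Pi; rewrite ger0_norm ?yle// ltW// y0.
have Tle i : P i -> `|T i| <= tan theta0 by move=> [_ _ _ bt]; exact: norm_tan_le.
have bT : bounded_on P T by exists (tan theta0).
have bt : bounded_on P t by exists T1 => i /facts[].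
have gyT i : P i -> `|g * y i * T i| <= 1 / 2.
  move=> Pi; rewrite (normrM (g * y i)) (normrM g) (gtr0_norm g0) (gtr0_norm (y0 i Pi)).
  have h1 : y i <= 1 / (2 * g * tan theta0 + 1).
    by rewrite (le_trans (yle i Pi))// !ge_min lexx !orbT.
  rewrite ler_pdivlMr// in h1.
  have h2 : g * y i * `|T i| <= g * y i * tan theta0.
    by rewrite ler_wpM2l ?Tle// mulr_ge0 ?ltW// y0.
  have h3 : y i * (2 * g * tan theta0 + 1) = 2 * (g * y i * tan theta0) + y i by ring.
  by rewrite h3 in h1; have := y0 i Pi; clear -h1 h2; lra.
have tE i : P i -> t i * (1 - g * y i * T i) = g * y i + T i.
  move=> Pi; have [gi zp _ bi] := Pi; have [_ _ cphi _ _] := facts i Pi.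
  have cth : cos (theta g i.1.1.1) != 0 by rewrite gt_eqF// cos_theta_gt0.
  have cb : cos i.2 != 0.
    rewrite gt_eqF// cos_gt0_pihalf// -ltr_norml.
    exact: le_lt_trans bi t2.
  rewrite /t tanD// tan_theta// -/(y i) -/(T i) divfK//.
  rewrite gt_eqF//; have := gyT i Pi; rewrite ler_norml => /andP[_]; lra.
have r0 i : P i -> 0 < 1 + d i /\ 1 + d i <= 2.
  move=> Pi; have [_ zp _ _] := Pi; have [/andP[h1 h2] _ _ _ _] := facts i Pi.
  rewrite /d addrC subrK divr_gt0//; last by lra.
  by rewrite ler_pdivrMr.
have Z'E i : P i -> Z' i = i.1.1.1 * (1 + d i).
  by move=> [_ zp _ _]; rewrite /d addrC subrK mulrC divfK// gt_eqF.
have dE i : P i -> d i = y i * (1 + (1 + d i) `^ g) * t i.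
  move=> Pi; have [_ zp _ _] := Pi; have [_ _ _ h _] := facts i Pi.
  have [rp _] := r0 i Pi.
  apply: (@mulfI _ i.1.1.1); first by rewrite gt_eqF.
  rewrite {1}/d mulrBr mulr1 mulrC divfK ?gt_eqF// h {1}Z'E// powRM ?ltW//.
  by rewrite -{1 2}(mulr_powRB1 (ltW zp) g0) -/(y i); ring.
have d12 i : P i -> `|d i| <= 1 / 2.
  move=> Pi; have [_ ht _ _ _] := facts i Pi; have [rp r2] := r0 i Pi.
  have rg : (1 + d i) `^ g <= 2.
    apply: (@le_trans _ _ (2 `^ g)); last by rewrite ler1_powR ?ler1n// ltW.
    by rewrite ge0_ler_powR ?nnegrE// ltW.
  have rg0 := powR_ge0 (1 + d i) g.
  rewrite dE// (normrM (y i * _)) (normrM (y i)) (gtr0_norm (y0 i Pi)) (ger0_norm (_ :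
    0 <= 1 + (1 + d i) `^ g)); last by lra.
  have h1 : y i <= 1 / (6 * T1) by rewrite (le_trans (yle i Pi))// !ge_min lexx !orbT.
  rewrite ler_pdivlMr ?mulr_gt0// in h1.
  have h2 : y i * (1 + (1 + d i) `^ g) * `|t i| <= y i * 3 * T1.
    rewrite ler_pM//; first by rewrite mulr_ge0 ?(ltW (y0 i Pi))//; lra.
    by rewrite ler_pM2l ?y0//; lra.
  by lra.
have [bdy bx] := jump_expansion y0 by_ bT bt gyT tE d12 dE.
have := jump_expansion_powR p y0 by_ bT d12 bdy bx.
set X := fun i => _ => bX.
(* The exponent of z in the correction term. As that term already has order y^2, the first-order
   bound (1 + d)^q = 1 + y W is enough. *)
pose q := p + 2 * (g - 1).
have [C1 hC1] := powR1D_taylor1 q.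
have bW0 : bounded_on P (fun i => ((1 + d i) `^ q - 1) / d i).
  by apply: (@bounded_on_ratio _ _ _ _ _ C1) => i Pi; exact/hC1/d12.
pose W i := ((1 + d i) `^ q - 1) / d i * (d i / y i).
have bW : bounded_on P W by exact: bounded_onM.
have WE i : P i -> (1 + d i) `^ q = 1 + y i * W i.
  move=> Pi; rewrite /W; have [->|d0] := eqVneq (d i) 0;
    first by rewrite addr0 powR1 !mul0r !mulr0 addr0.
  by field; rewrite d0 gt_eqF// y0.
have [CX hCX] := bX; have [CW hCW] := bW.
pose E : R := `|CX| + `|CW| * `|Cpsi| + 1.
have E0 : 0 < E by rewrite /E; have := normr_ge0 CX;
  have := mulr_ge0 (normr_ge0 CW) (normr_ge0 Cpsi); lra.
have [delta delta0 hdelta] := ucpsi (eta / 2) (divr_gt0 eta0 (ltr0Sn _ 1)).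
(* [E] bounds the third-order remainders divided by y, so they contribute at most y E <= eta / 2.
   The angles satisfy theta z <= g y and theta z' <= 2 g y, the factor 2 coming from z' >= z / 2;
   hence 3 g y <= delta. *)
exists (Num.min y2 (Num.min (eta / 2 / E) (delta / (3 * g)))).
  have f1 : 0 < eta / 2 / E by rewrite divr_gt0// divr_gt0.
  have f2 : 0 < delta / (3 * g) by rewrite divr_gt0// mulr_gt0.
  by rewrite lt_min y20 lt_min f1 f2.
move=> z j a b gs zp; rewrite le_min => /andP[zy]; rewrite le_min => /andP[zE zd] bt0 /=.
pose i : I := (z, j, a, b).
have Pi : P i by [].
have [/andP[hz1 hz2] _ _ _ hA] := facts i Pi.
have yi : y i = z `^ (g - 1) by [].
have yp := y0 i Pi.
split=> //.
have [rp r2] := r0 i Pi.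
have Z'p : 0 < Z' i by rewrite Z'E// mulr_gt0.
have VE : lyapunov g p psi (next_state g (z, j, a) b) =
    z `^ p * ((1 + d i) `^ p + y i ^+ 2 * ((1 + d i) `^ q * psi (A' i))).
  rewrite /lyapunov -/(Z' i) -/(A' i) (Z'E i Pi) /= !powRM ?(ltW zp) ?(ltW rp)//.
  have -> : (1 + d i) `^ q = (1 + d i) `^ p * ((1 + d i) `^ (g - 1)) ^+ 2.
    rewrite /q powRD ?(gt_eqF rp) ?implybT//; congr (_ * _).
    by rewrite mulrC powRrM powR_mulrn// powR_ge0.
  by rewrite -yi; ring.
have XE : (1 + d i) `^ p = 1 + 2 * p * y i * T i + y i ^+ 2 *
    (2 * p * g * (1 + 2 * T i ^+ 2) + 2 * p * (p - 1) * T i ^+ 2) + y i ^+ 3 * X i.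
  by rewrite /X; field; rewrite gt_eqF.
have -> : tan b = T i by [].
rewrite VE XE WE// -yi.
have -> : z `^ p * (1 + 2 * p * y i * T i + y i ^+ 2 *
    (2 * p * g * (1 + 2 * T i ^+ 2) + 2 * p * (p - 1) * T i ^+ 2) + y i ^+ 3 * X i +
    y i ^+ 2 * ((1 + y i * W i) * psi (A' i))) - z `^ p * (1 + 2 * p * y i * T i +
    y i ^+ 2 * (2 * p * g * (1 + 2 * T i ^+ 2) + 2 * p * (p - 1) * T i ^+ 2 + psi b)) =
    (z `^ p * y i ^+ 2) * (y i * (X i + W i * psi (A' i)) + (psi (A' i) - psi b)) by ring.
have zy2 : 0 <= z `^ p * y i ^+ 2 by rewrite mulr_ge0 ?powR_ge0// exprn_ge0// ltW.
rewrite normrM (ger0_norm zy2) mulrC ler_wpM2r//.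
have hb : b \in angles.
  move: (le_lt_trans bt0 t2); rewrite ltr_norml => /andP[b1 b2].
  apply/mem_set; have : - (pi / 2) <= b <= pi / 2 by rewrite !ltW.
  by [].
have hA' : A' i \in angles.
  by have /= [_ _ h] := next_state_good g01 t02 gs bt0; exact: h.
have thZ : theta g (Z' i) <= g * (2 * y i).
  rewrite (le_trans (theta_le g0 Z'p))// ler_pM2l//.
  have z2 : 0 < z / 2 by rewrite divr_gt0.
  rewrite (le_trans (powR_le_neg (_ : g - 1 <= 0) z2 hz1))//; first by lra.
  rewrite powRM ?(ltW zp) ?invr_ge0// -yi mulrC ler_wpM2r ?(ltW yp)//.
  rewrite -powR_inv1// -powRrM mulN1r opprB ler1_powR ?ler1n//; lra.
have thz : theta g z <= g * y i by exact: theta_le.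
have h1 : `|psi (A' i) - psi b| <= eta / 2.
  have dA : A' i - b = theta g z + theta g (Z' i) by rewrite hA /=; ring.
  apply: hdelta => //; rewrite dA ger0_norm; last first.
    by rewrite addr_ge0// ltW// theta_gt0// ltW.
  rewrite -yi ler_pdivlMr ?mulr_gt0// in zd.
  by clear -zd thZ thz; lra.
have h2 : `|y i * (X i + W i * psi (A' i))| <= eta / 2.
  rewrite normrM (gtr0_norm yp).
  have h3 : `|X i + W i * psi (A' i)| <= E.
    have k1 : `|X i| <= `|CX| by rewrite (le_trans (hCX i Pi))// ler_norm.
    have k2 : `|W i * psi (A' i)| <= `|CW| * `|Cpsi|.
      rewrite normrM ler_pM//; first by rewrite (le_trans (hCW i Pi))// ler_norm.
      by rewrite (le_trans (hCpsi _ Logic.I))// ler_norm.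
    by rewrite (le_trans (ler_normD _ _))// /E; clear -k1 k2; lra.
  rewrite -yi ler_pdivlMr// in zE.
  by rewrite (le_trans _ zE)// ler_pM2l.
by rewrite (le_trans (ler_normD _ _))//; clear -h1 h2; lra.
Qed.

(** * The law of a collision *)

Definition uniform_angle (R : realType) (a b : R) (ab : a < b) : set R -> \bar R :=
  uniform_prob ab.

(* [uniform_prob] is a measure for another (convertible) measurable structure
   on R. *)
HB.instance Definition _ (R : realType) (a b : R) (ab : a < b) :=
  isMeasure.Build _ R R (uniform_angle ab) (measure0 (uniform_prob ab))
    (measure_ge0 (uniform_prob ab))
    (@measure_semi_sigma_additive _ _ _ (uniform_prob ab)).

HB.instance Definition _ (R : realType) (a b : R) (ab : a < b) :=
  Measure_isProbability.Build _ R R (uniform_angle ab)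
    (probability_setT (uniform_prob ab)).

Definition outgoing_measure (R : realType) (theta0 : R) (htheta0 : 0 < theta0)
    (K : R.-pker R ~> R) (s : R * R * R) : {measure set R -> \bar R} :=
  if 0 < s.1.1 then K s.2 else uniform_angle (gtrN htheta0).

Lemma measurable_abscissa (R : realType) :
  measurable_fun setT (fun s : R * R * R => s.1.1).
Proof. by apply: measurableT_comp => //; exact: measurable_fst. Qed.

Lemma measurable_pos (R : realType) :
  measurable_fun setT (fun s : R * R * R => 0 < s.1.1).
Proof.
apply: measurable_fun_ltr => //.
exact: measurable_abscissa.
Qed.

Lemma measurable_outgoing_measure (R : realType) (theta0 : R) (htheta0 : 0 < theta0)
    (K : R.-pker R ~> R) (U : set R) : measurable U ->
  measurable_fun setT (outgoing_measure htheta0 K ^~ U).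
Proof.
move=> mU.
rewrite [X in measurable_fun _ X](_ : _ = fun s : R * R * R =>
  if 0 < s.1.1 then K s.2 U else uniform_angle (gtrN htheta0) U).
  apply: measurable_fun_ifT.
  - exact: measurable_pos.
  - exact: measurableT_comp (measurable_kernel K U mU) measurable_snd.
  - exact: measurable_cst.
by apply/funext => s; rewrite /outgoing_measure; case: ifP.
Qed.

HB.instance Definition _ (R : realType) (theta0 : R) (htheta0 : 0 < theta0)
    (K : R.-pker R ~> R) :=
  isKernel.Build _ _ _ _ R (outgoing_measure htheta0 K)
    (@measurable_outgoing_measure R theta0 htheta0 K).

Lemma outgoing_measure_setT (R : realType) (theta0 : R) (htheta0 : 0 < theta0)
    (K : R.-pker R ~> R) (s : R * R * R) : outgoing_measure htheta0 K s setT = 1%E.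
Proof.
rewrite /outgoing_measure; case: ifP => _; first exact: prob_kernel.
exact: probability_setT.
Qed.

HB.instance Definition _ (R : realType) (theta0 : R) (htheta0 : 0 < theta0)
    (K : R.-pker R ~> R) :=
  Kernel_isProbability.Build _ _ _ _ R (outgoing_measure htheta0 K)
    (@outgoing_measure_setT R theta0 htheta0 K).

Lemma outgoing_lawE (R : realType) (theta0 : R) (htheta0 : 0 < theta0)
    (K : R.-pker R ~> R) (s : R * R * R) (B : set R) :
  outgoing_law htheta0 K s B = outgoing_measure htheta0 K s B.
Proof. by case: s => [[z j] a]; rewrite /outgoing_law /outgoing_measure /=; case: ifP. Qed.

(** As functions of E both sides are finite measures on the product; they agree on rectangles, which
    generate the sigma-algebra and are stable under intersection. A will be an event of the past. *)
Lemma integral_joint_law (R : realType) (d d1 d2 : measure_display)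
    (Omega : measurableType d) (S : measurableType d1) (T : measurableType d2)
    (P : probability Omega R) (X : Omega -> S) (Y : Omega -> T) (k : R.-pker S ~> T)
    (A : set Omega) :
  measurable A -> measurable_fun setT X -> measurable_fun setT Y ->
  (forall (C : set S) (B : set T), measurable C -> measurable B ->
    P (A `&` X @^-1` C `&` Y @^-1` B) =
    (\int[P]_(w in A `&` X @^-1` C) k (X w) B)%E) ->
  forall E, measurable E -> P (A `&` (fun w => (X w, Y w)) @^-1` E) =
    (\int[P]_(w in A) k (X w) (xsection E (X w)))%E.
Proof.
move=> mA mX mY h.
have mXY : measurable_fun setT (fun w => (X w, Y w)) by exact: measurable_fun_pair.
have mk E : measurable E -> measurable_fun setT (fun s => k s (xsection E s)).
  by move=> mE; apply: (@measurable_fun_xsection_finite_kernel _ _ _ _ _ k); rewrite inE.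
have mkX E : measurable E -> measurable_fun A (fun w => k (X w) (xsection E (X w))).
  by move=> mE; apply: measurable_funTS; exact: measurableT_comp (mk E mE) mX.
pose m1 (E : set (S * T)) : \bar R := P (A `&` (fun w => (X w, Y w)) @^-1` E).
pose m2 (E : set (S * T)) : \bar R := (\int[P]_(w in A) k (X w) (xsection E (X w)))%E.
have mpre E : measurable E -> measurable (A `&` (fun w => (X w, Y w)) @^-1` E).
  by move=> mE; apply: measurableI => //; rewrite -[X in measurable X]setTI; exact: mXY.
have m10 : m1 set0 = 0%E by rewrite /m1 preimage_set0 setI0 measure0.
have m1_ge0 E : (0 <= m1 E)%E by exact: measure_ge0.
have m1_sigma : semi_sigma_additive m1.
  move=> F mF tF mUF; rewrite /m1 preimage_bigcup setI_bigcupr.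
  apply: measure_semi_sigma_additive.
  - by move=> i; exact: mpre.
  - apply: trivIset_setIl => i j Di Dj [w [Fi Fj]].
    by apply: tF => //; exists (X w, Y w).
  - by rewrite -setI_bigcupr -preimage_bigcup; exact: mpre.
have m20 : m2 set0 = 0%E.
  by rewrite /m2 integral0_eq// => w _; rewrite xsection0 measure0.
have m2_ge0 E : (0 <= m2 E)%E by apply: integral_ge0 => w _; exact: measure_ge0.
have m2_sigma : semi_sigma_additive m2.
  move=> F mF tF mUF.
  have -> : m2 (\bigcup_n F n) = (\sum_(0 <= n <oo) m2 (F n))%E.
    rewrite /m2 -integral_nneseries//; last by move=> n; exact: mkX.
    apply: eq_integral => w _; rewrite xsection_bigcup.
    apply/esym/cvg_lim => //; apply: measure_semi_sigma_additive.
    - by move=> n; exact: measurable_xsection.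
    - exact: trivIset_xsection.
    - by rewrite -xsection_bigcup; exact: measurable_xsection.
  by apply: is_cvg_nneseries => n _ _; exact: m2_ge0.
pose M1 : {measure set (S * T) -> \bar R} := HB.pack m1 (isMeasure.Build _ _ _ m1 m10 m1_ge0
  m1_sigma).
pose M2 : {measure set (S * T) -> \bar R} := HB.pack m2 (isMeasure.Build _ _ _ m2 m20 m2_ge0
  m2_sigma).
move=> E mE; rewrite -[LHS]/(M1 E) -[RHS]/(M2 E).
apply: (@measure_unique _ _ _ [set C `*` B | C in measurable & B in measurable] (fun=> setT)) => //.
- exact: measurable_prod_measurableType.
- move=> _ _ [X1 mX1 [X2 mX2 <-]] [Y1 mY1 [Y2 mY2 <-]].
  exists (X1 `&` Y1); first exact: measurableI.
  by exists (X2 `&` Y2); [exact: measurableI|rewrite setXI].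
- by move=> _; exists setT => //; exists setT => //; rewrite setXTT.
- by rewrite bigcup_const.
- move=> _ [C mC [B mB <-]]; rewrite /M1 /M2 /= /m1 /m2.
  transitivity (P (A `&` X @^-1` C `&` Y @^-1` B)).
    by congr (P _); apply/seteqP; split=> w /=; [move=> [? []]|move=> [[]]].
  rewrite h// integral_mkcondr; apply: eq_integral => w _; rewrite patchE.
  have [XC|XC] := boolP (X w \in C).
    by rewrite in_xsectionX// mem_set//; exact: set_mem XC.
  rewrite notin_xsectionX// measure0 memNset// => XC'.
  by move/negP: XC; apply; exact: mem_set.
- move=> n; rewrite /M1/= /m1 preimage_setT setIT.
  by rewrite (le_lt_trans (probability_le1 _ _))// ltry.
Qed.

Lemma mbounded_comp (R : realType) (d d1 : measure_display)
    (Omega : measurableType d) (S : measurableType d1) (X : Omega -> S) (h : S -> R) :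
  measurable_fun setT X -> mbounded h -> mbounded (fun w => h (X w)).
Proof.
move=> mX [mh [C hC]]; split; first exact: measurableT_comp.
by exists C => w _; exact: hC.
Qed.

Lemma pker_lty (R : realType) (d1 d2 : measure_display)
    (S : measurableType d1) (T : measurableType d2) (k : R.-pker S ~> T) (s : S) :
  (k s setT < +oo)%E.
Proof. by rewrite prob_kernel ltry. Qed.

Lemma Rintegral_pker_bound (R : realType) (d1 d2 : measure_display)
    (S : measurableType d1) (T : measurableType d2) (k : R.-pker S ~> T)
    (h : T -> R) (C : R) (s : S) :
  mbounded h -> (forall y, `|h y| <= C) -> `|\int[k s]_y h y| <= C.
Proof.
move=> mh hC; have kT := pker_lty k s.
have ih := mbounded_integrable measurableT kT mh.
rewrite (le_trans (le_normr_Rintegral measurableT ih))//.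
apply: (@le_trans _ _ (\int[k s]_(y in setT) C)).
  apply: le_Rintegral => //; first exact: integrable_norm.
  exact: mbounded_integrable measurableT kT (mbounded_cst T C).
by rewrite Rintegral_cst// prob_kernel mulr1.
Qed.

Lemma mbounded_pker_Rintegral (R : realType) (d1 d2 : measure_display)
    (S : measurableType d1) (T : measurableType d2) (k : R.-pker S ~> T)
    (G : S * T -> R) : mbounded G -> mbounded (fun s => \int[k s]_y G (s, y)).
Proof.
move=> mG; have [C hC] := mG.2.
have mGs s : mbounded (fun y => G (s, y)).
  by apply: mbounded_comp mG; exact: measurable_pair1.
split; last first.
  by exists C => s _; apply: Rintegral_pker_bound => // y; exact: hC.
have mc := mbounded_cst T C.
have -> : (fun s => \int[k s]_y G (s, y)) =
    fun s => fine (\int[k s]_y (G (s, y) + C)%:E)%E - C.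
  apply/funext => s; rewrite -[X in X - _]/(Rintegral (k s) setT (fun y => G (s, y) + C)).
  rewrite RintegralD//; [|exact: mbounded_integrable measurableT (pker_lty k s) _..].
  by rewrite Rintegral_cst// prob_kernel mulr1 addrK.
apply: measurable_funB; last exact: measurable_cst.
apply: (measurableT_comp (fine_measurable measurableT)).
apply: (@measurable_fun_integral_finite_kernel _ _ _ _ _ (fun p => (G p + C)%:E) k).
- by move=> p; rewrite lee_fin; have := hC p Logic.I; rewrite ler_norml => /andP[? _]; lra.
- by apply/measurable_EFinP; apply: measurable_funD => //; exact: mG.1.
Qed.

(** [integral_joint_law] says that two positive functionals of G agree on indicators. *)
Lemma Rintegral_joint_law (R : realType) (d d1 d2 : measure_display)
    (Omega : measurableType d) (S : measurableType d1) (T : measurableType d2)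
    (P : probability Omega R) (X : Omega -> S) (Y : Omega -> T) (k : R.-pker S ~> T)
    (A : set Omega) (G : S * T -> R) :
  measurable A -> measurable_fun setT X -> measurable_fun setT Y ->
  (forall (C : set S) (B : set T), measurable C -> measurable B ->
    P (A `&` X @^-1` C `&` Y @^-1` B) =
    (\int[P]_(w in A `&` X @^-1` C) k (X w) B)%E) ->
  mbounded G -> \int[P]_(w in A) G (X w, Y w) =
    \int[P]_(w in A) \int[k (X w)]_y G (X w, y).
Proof.
move=> mA mX mY h mG.
have mXY : measurable_fun setT (fun w => (X w, Y w)) by exact: measurable_fun_pair.
have PA := probability_lty P mA.
have mk (f : S * T -> R) : mbounded f -> mbounded (fun w => \int[k (X w)]_y f (X w, y)).
  by move=> /(mbounded_pker_Rintegral k); exact: mbounded_comp mX.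
have ms (f : S * T -> R) s : mbounded f -> mbounded (fun y => f (s, y)).
  by apply: mbounded_comp; exact: measurable_pair1.
have pk s := positive_functional_Rintegral measurableT (pker_lty k s).
have [PD PZ Ple] := positive_functional_Rintegral mA PA.
apply: (@positive_functional_eq _ _ _ setT (fun G => \int[P]_(w in A) G (X w, Y w))
  (fun G => \int[P]_(w in A) \int[k (X w)]_y G (X w, y))) => //.
- split.
  + by move=> f1 f2 m1 m2; rewrite PD//; exact: mbounded_comp mXY _.
  + by move=> c f mf; rewrite PZ//; exact: mbounded_comp mXY _.
  + by move=> f1 f2 m1 m2 f12; apply: Ple; [exact: mbounded_comp mXY _..|move=> w _; exact: f12].
- split.
  + move=> f1 f2 m1 m2; rewrite -PD; [|exact: mk..].
    congr Rintegral; apply/funext => w; have [kD _ _] := pk (X w).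
    by rewrite kD//; exact: ms.
  + move=> c f mf; rewrite -PZ; last exact: mk.
    congr Rintegral; apply/funext => w; have [_ kZ _] := pk (X w).
    by rewrite kZ//; exact: ms.
  + move=> f1 f2 m1 m2 f12; apply: Ple; [exact: mk..|move=> w _].
    by have [_ _ kle] := pk (X w); apply: kle; [exact: ms..|move=> y _; exact: f12].
- move=> E mE.
  have mpre : measurable ((fun w => (X w, Y w)) @^-1` E).
    by rewrite -[X in measurable X]setTI; exact: mXY.
  transitivity (fine (P (A `&` (fun w => (X w, Y w)) @^-1` E))).
    by rewrite setIC -Rintegral_indic.
  rewrite (integral_joint_law mA mX mY h mE); congr fine.
  apply: eq_integral => w _.
  have -> : (fun y => \1_E (X w, y) : R) = \1_(xsection E (X w)).
    by apply/funext => y; rewrite !indicE mem_xsection.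
  have mx : measurable (xsection E (X w)) by exact: measurable_xsection.
  rewrite Rintegral_indic// setIT fineK// ge0_fin_numE//.
  by rewrite (le_lt_trans _ (pker_lty k (X w)))// le_measure ?inE.
Qed.

Lemma history_measurable (R : realType) (d : measure_display)
    (Omega : measurableType d) (P : probability Omega R)
    (zeta : nat -> {RV P >-> (R * R * R)%type}) n (A : set Omega) :
  history zeta n A -> measurable A.
Proof.
apply: smallest_sub; first exact: sigma_algebra_measurable.
by move=> _ [k [B [_ mB ->]]]; rewrite -[X in measurable X]setTI; exact: measurable_funPT.
Qed.

Lemma history_preimage (R : realType) (d : measure_display)
    (Omega : measurableType d) (P : probability Omega R)
    (zeta : nat -> {RV P >-> (R * R * R)%type}) n k (B : set (R * R * R)) :
  (k <= n)%N -> measurable B -> history zeta n (zeta k @^-1` B).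
Proof. by move=> kn mB; apply: sub_sigma_algebra; exists k, B. Qed.

Lemma historyI (R : realType) (d : measure_display)
    (Omega : measurableType d) (P : probability Omega R)
    (zeta : nat -> {RV P >-> (R * R * R)%type}) n (A B : set Omega) :
  history zeta n A -> history zeta n B -> history zeta n (A `&` B).
Proof.
set G := [set A | exists k (B : set (R * R * R)),
        [/\ (k <= n)%N, measurable B & A = zeta k @^-1` B]].
exact: (@measurableI _ (g_sigma_algebraType G)).
Qed.

Lemma historyT (R : realType) (d : measure_display)
    (Omega : measurableType d) (P : probability Omega R)
    (zeta : nat -> {RV P >-> (R * R * R)%type}) n : history zeta n setT.
Proof.
set G := [set A | exists k (B : set (R * R * R)),
        [/\ (k <= n)%N, measurable B & A = zeta k @^-1` B]].
exact: (@measurableT _ (g_sigma_algebraType G)).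
Qed.

Lemma history_mono (R : realType) (d : measure_display)
    (Omega : measurableType d) (P : probability Omega R)
    (zeta : nat -> {RV P >-> (R * R * R)%type}) m n (A : set Omega) :
  (m <= n)%N -> history zeta m A -> history zeta n A.
Proof.
move=> mn; apply: sub_sigma_algebra2 => _ [k [B [kn mB ->]]].
by exists k, B; split=> //; exact: leq_trans mn.
Qed.

Lemma measurable_good_state (R : realType) :
  measurable [set s : R * R * R | good_state s].
Proof.
have m1 := @measurable_abscissa R.
have m2 : measurable_fun setT (fun s : R * R * R => s.1.2).
  by apply: measurableT_comp measurable_fst => //; exact: measurable_snd.
have pre (f : R * R * R -> R) (B : set R) : measurable_fun setT f -> measurable B ->
  measurable (f @^-1` B).
  by move=> mf mB; rewrite -[X in measurable X]setTI; exact: mf.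
rewrite (_ : [set s | _] = ((fun s : R * R * R => s.1.1) @^-1` `[0, +oo[ `&`
    ((fun s : R * R * R => s.1.2) @^-1` ([set 1] `|` [set -1]))) `&`
    (((fun s : R * R * R => s.1.1) @^-1` `]-oo, 0]) `|` (snd @^-1` angles))).
  apply: measurableI; first by apply: measurableI; apply: pre => //; exact: measurableU.
  by apply: measurableU; apply: pre => //; exact: measurable_angles.
apply/seteqP; split=> [[[z j] a]|[[z j] a]] /=; rewrite !in_itv/= andbT.
  move=> [z0 j1 za]; split=> //; have [|z0'] := leP z 0; first by left.
  by right; exact/set_mem/za.
by move=> [[z0 j1] za]; split=> // z0'; case: za => [|/mem_set//]; rewrite leNgt z0'.
Qed.

Lemma kernel_setC0 (R : realType) (K : R.-pker R ~> R) (a : R) (S : set R) :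
  measurable S -> K a S = 1%E -> K a (~` S) = 0%E.
Proof.
move=> mS e1.
have e2 := measureU (K a) mS (measurableC mS) (setICr _).
have e3 : (K a S + K a (~` S) = 1)%E.
  by rewrite -[RHS](@prob_kernel _ _ _ _ _ K a) -(setUv S); exact: (esym e2).
have : (1 + K a (~` S) = 1)%E := etrans (congr1 (fun x => x + _)%E (esym e1)) e3.
have aux (x : \bar R) : (1 + x = 1)%E -> x = 0%E.
  by case: x => //= r [/(canRL (addKr 1))]; rewrite addNr => ->.
by move/aux.
Qed.

Lemma outgoing_measure_setC (R : realType) (theta0 : R) (htheta0 : 0 < theta0)
    (K : R.-pker R ~> R) (s : R * R * R) : concentrated theta0 K -> good_state s ->
  outgoing_measure htheta0 K s (~` `[- theta0, theta0]%classic) = 0%E.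
Proof.
have mS : measurable (`[- theta0, theta0]%classic : set R) by exact: measurable_itv.
move=> hB1; case: s => [[z j] a] [_ _ za]; rewrite /outgoing_measure/=.
case: ifP => [/za/hB1 h|_]; first exact: kernel_setC0 mS h.
rewrite /= /uniform_angle /uniform_prob integral_uniform_pdf.
rewrite (_ : _ `&` _ = set0) ?integral_set0//.
by apply/seteqP; split=> // x [].
Qed.

(** The claims are proved together: the law of the angle is under control only at a good state, and
    the next state is known to be good only when the angle lies in the smaller interval. *)
Lemma good_state_ae (R : realType) (gamma theta0 : R) (htheta0 : 0 < theta0)
    (K : R.-pker R ~> R) (d : measure_display)
    (Omega : measurableType d) (P : probability Omega R)
    (zeta : nat -> {RV P >-> (R * R * R)%type}) (beta : nat -> {RV P >-> R}) (n : nat) :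
  0 < gamma < 1 -> theta0 < pi / 2 -> concentrated theta0 K ->
  collisions_process gamma htheta0 K zeta beta ->
  P (~` (zeta n @^-1` [set s | good_state s])) = 0%E /\
  P (~` (beta n @^-1` `[- theta0, theta0])) = 0%E.
Proof.
move=> g01 t2 hB1 hz.
have mg := @measurable_good_state R.
have mS : measurable (`[- theta0, theta0]%classic : set R) by exact: measurable_itv.
have mgz k : measurable (zeta k @^-1` [set s | good_state s]).
  exact: history_measurable (history_preimage (zeta:=zeta) (leqnn k) mg).
have mbS k : measurable (beta k @^-1` `[- theta0, theta0]).
  by rewrite -[X in measurable X]setTI; exact: measurable_funPT.
have step k : P (~` (zeta k @^-1` [set s | good_state s])) = 0%E ->
    P (~` (beta k @^-1` `[- theta0, theta0])) = 0%E.
  move=> zk; pose S : set R := `[- theta0, theta0]%classic.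
  have := collisions_law hz (history_preimage (zeta:=zeta) (leqnn k) mg) (measurableC mS).
  rewrite integral0_eq => [h|w gw]; last by rewrite outgoing_lawE outgoing_measure_setC.
  apply/eqP; rewrite -measure_le0.
  have : (P (~` (zeta k @^-1` [set s | good_state s]) `|`
      (zeta k @^-1` [set s | good_state s] `&` beta k @^-1` (~` S))) <= 0)%E.
    apply: (le_trans (measureU2 _ _ _)).
    - exact: measurableC.
    - by rewrite preimage_setC; apply: measurableI => //; exact: measurableC (mbS k).
    - by rewrite [X in (X + _)%E]zk [X in (_ + X)%E]h adde0.
  apply: le_trans; apply: le_measure; rewrite ?inE.
  - exact: measurableC.
  - by apply: measurableU; [exact: measurableC|rewrite preimage_setC; apply: measurableI => //;
    exact: measurableC (mbS k)].
  - move=> w /= bw; have [gw|gw] := pselect (good_state (zeta k w)); [by right|by left].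
suff zk : P (~` (zeta n @^-1` [set s | good_state s])) = 0%E by split=> //; exact: step.
elim: n => [|n IH].
  rewrite (_ : ~` _ = set0) ?measure0//; apply/seteqP; split=> // w; apply.
  have := collisions_init hz w; rewrite /preimage/=.
  by case: (zeta 0%N w) => [[z j] a] [z0 j1 aA _]; split.
pose S : set R := `[- theta0, theta0]%classic.
apply/eqP; rewrite -measure_le0.
have : (P (~` (zeta n @^-1` [set s | good_state s]) `|` ~` (beta n @^-1` S)) <= 0)%E.
  apply: (le_trans (measureU2 _ _ _)); [exact: measurableC|exact: measurableC|].
  by rewrite [X in (X + _)%E]IH [X in (_ + X)%E]step// adde0.
apply: le_trans; apply: le_measure; rewrite ?inE.
- exact: measurableC.
- by apply: measurableU; exact: measurableC.
- move=> w; apply: contra_notP => /not_orP[/contrapT gw /contrapT bw] /=.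
  rewrite (collisions_step hz); apply: (@next_state_good _ _ theta0) => //;
    first by rewrite htheta0.
  by move: bw; rewrite /S /= in_itv/= ler_norml.
Qed.

Lemma collisions_joint_law (R : realType) (gamma theta0 : R) (htheta0 : 0 < theta0)
    (K : R.-pker R ~> R) (d : measure_display)
    (Omega : measurableType d) (P : probability Omega R)
    (zeta : nat -> {RV P >-> (R * R * R)%type}) (beta : nat -> {RV P >-> R}) (n : nat)
    (A : set Omega) (C : set (R * R * R)) (B : set R) :
  collisions_process gamma htheta0 K zeta beta -> history zeta n A ->
  measurable C -> measurable B ->
  P (A `&` zeta n @^-1` C `&` beta n @^-1` B) =
    (\int[P]_(w in A `&` zeta n @^-1` C) outgoing_measure htheta0 K (zeta n w) B)%E.
Proof.
move=> hz hA mC mB; rewrite (collisions_law hz (historyI hA (history_preimage (zeta:=zeta)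
  (leqnn n) mC)) mB).
by apply: eq_integral => w _; rewrite outgoing_lawE.
Qed.

(** The majorant [G] is bounded and measurable on the product, so the joint law applies to it;
    [V (next_state gamma s b)] is only compared with it pointwise, and its measurability in (s, b)
    does not enter. *)
Lemma integral_step_le (R : realType) (gamma theta0 : R) (htheta0 : 0 < theta0)
    (K : R.-pker R ~> R) (d : measure_display)
    (Omega : measurableType d) (P : probability Omega R)
    (zeta : nat -> {RV P >-> (R * R * R)%type}) (beta : nat -> {RV P >-> R}) (n : nat)
    (A : set Omega) (D : set (R * R * R)) (V V' : R * R * R -> R)
    (G : R * R * R * R -> R) :
  0 < gamma < 1 -> theta0 < pi / 2 -> concentrated theta0 K ->
  collisions_process gamma htheta0 K zeta beta -> history zeta n A ->
  A `<=` zeta n @^-1` D -> measurable_fun setT V -> (forall s, 0 <= V s) ->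
  measurable_fun setT V' -> (forall s, 0 <= V' s) ->
  mbounded G -> (forall p, 0 <= G p) ->
  (forall s b, D s -> good_state s -> `|b| <= theta0 -> V (next_state gamma s b) <= G (s, b)) ->
  (forall s, D s -> good_state s -> \int[outgoing_measure htheta0 K s]_y G (s, y) <= V' s) ->
  (\int[P]_(w in A) (V (zeta n.+1 w))%:E <= \int[P]_(w in A) (V' (zeta n w))%:E)%E.
Proof.
move=> g01 t2 hB1 hz hA AD mV V0 mV' V'0 mG G0 h1 h2.
have mA := history_measurable hA.
have [gn bn] := good_state_ae n g01 t2 hB1 hz.
have mz k : measurable_fun setT (zeta k) by exact: measurable_funPT.
have mb : measurable_fun setT (beta n) by exact: measurable_funPT.
have mzb : measurable_fun setT (fun w => (zeta n w, beta n w)) by exact: measurable_fun_pair.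
have mgz : measurable (zeta n @^-1` [set s | good_state s]).
  exact: history_measurable (history_preimage (zeta:=zeta) (leqnn n) (@measurable_good_state R)).
have mbS : measurable (beta n @^-1` `[- theta0, theta0]).
  by rewrite -[X in measurable X]setTI; exact: mb.
have mGzb : mbounded (fun w => G (zeta n w, beta n w)) by exact: mbounded_comp mzb mG.
have PA := probability_lty P mA.
have mI := mbounded_comp (mz n) (mbounded_pker_Rintegral (outgoing_measure htheta0 K) mG).
have iG := mbounded_integrable mA PA mGzb.
have iI := mbounded_integrable mA PA mI.
apply: (@le_trans _ _ (\int[P]_(w in A) (G (zeta n w, beta n w))%:E)%E).
  apply: ae_ge0_le_integral => //.
  - by move=> w _; rewrite lee_fin.
  - by apply/measurable_EFinP/measurable_funTS; exact: measurableT_comp mV (mz n.+1).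
  - by move=> w _; rewrite lee_fin.
  - exact: measurable_int iG.
  exists (~` (zeta n @^-1` [set s | good_state s]) `|` ~` (beta n @^-1` `[- theta0, theta0]));
    split.
  - by apply: measurableU; exact: measurableC.
  - apply/eqP; rewrite -measure_le0 (le_trans (measureU2 _ _ _))//;
    [exact: measurableC|exact: measurableC|].
    by rewrite [X in (X + _)%E]gn [X in (_ + X)%E]bn adde0.
  - move=> w; apply: contra_notP => /not_orP[/contrapT gw /contrapT bw] /= Aw.
    rewrite lee_fin (collisions_step hz); apply: h1 => //; first exact: AD.
    by move: bw; rewrite /= in_itv/= ler_norml.
have -> : (\int[P]_(w in A) (G (zeta n w, beta n w))%:E)%E =
    (\int[P]_(w in A) (\int[outgoing_measure htheta0 K (zeta n w)]_y G (zeta n w, y))%:E)%E.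
  rewrite -[LHS]fineK; last exact: integrable_fin_num iG.
  rewrite -[RHS]fineK; last exact: integrable_fin_num iI.
  congr EFin; apply: (Rintegral_joint_law mA (mz n) mb _ mG) => C B mC mB.
  exact: collisions_joint_law hz hA mC mB.
apply: ae_ge0_le_integral => //.
- by move=> w _; rewrite lee_fin Rintegral_ge0.
- exact: measurable_int iI.
- by move=> w _; rewrite lee_fin.
- by apply/measurable_EFinP/measurable_funTS; exact: measurableT_comp mV' (mz n).
exists (~` (zeta n @^-1` [set s | good_state s])); split=> //; first exact: measurableC.
move=> w; apply: contra_notP => /contrapT gw /= Aw.
by rewrite lee_fin; apply: h2 => //; exact: AD.
Qed.

(** * The supermartingale *)

Lemma pker_Rintegral_angles (R : realType) (K : R.-pker R ~> R) (h : R -> R) (a : R) :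
  markov_on_angles K -> a \in angles -> mbounded h ->
  \int[K a]_y h y = kernel_op K h a.
Proof.
move=> hK aA mh; have mA := @measurable_angles R.
have KT : (K a setT < +oo)%E by rewrite prob_kernel ltry.
have ih := mbounded_integrable measurableT KT mh.
have z : K a (~` angles) = 0%E by exact: kernel_setC0 mA (hK a aA).
rewrite /Rintegral (negligible_integral (measurableC mA) measurableT ih z).
by rewrite setTD setCK.
Qed.

Lemma kernel_op_tan (R : realType) (theta0 : R) (K : R.-pker R ~> R) (kappa : R -> R -> R)
    (a : R) : theta0 < pi / 2 -> concentrated theta0 K -> regular_density K kappa ->
  a \in angles -> kernel_op K (tan \_ `[- theta0, theta0]) a = rho1 kappa a.
Proof.
move=> t2 hB1 hk aA; have [_ k0 _ kd _] := hk; have mA := @measurable_angles R.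
have mS : measurable (`[- theta0, theta0]%classic : set R) by exact: measurable_itv.
have mT := mbounded_tan 1 t2.
rewrite (_ : (fun x => tan x ^+ 1) = tan) in mT; last by apply/funext => x; rewrite expr1.
apply: Rintegral_density_restrict => //.
- exact: kernel_lty.
- apply/eqP; rewrite -measure_le0 -(kernel_setC0 mS (hB1 a aA)).
  apply: le_measure; rewrite ?inE; [|exact: measurableC mS|by move=> x []].
  exact: measurableD mA mS.
- exact: regular_density_section hk aA.
- by move=> x /mem_set xA; exact: k0.
- by move=> B mB BA; exact: kd.
- exact: measurable_tan_angles.
Qed.

(** Invariance transfers the concentration of K to [mu]: the mass outside the smaller interval is an
    average of zeros, so the truncation of tan^2 is invisible. *)
Lemma mean_tan_sqr (R : realType) (theta0 : R) (K : R.-pker R ~> R)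
    (mu : probability R R) (varpi : R -> R) : theta0 < pi / 2 -> concentrated theta0 K ->
  invariant_probability K mu -> density_on_angles mu varpi ->
  \int[mu]_(x in angles) ((fun x => tan x ^+ 2) \_ `[- theta0, theta0]) x =
  \int[lebesgue_measure]_(x in angles) (varpi x * tan x ^+ 2).
Proof.
move=> t2 hB1 [mu1 inv] [mv v0 vd]; have mA := @measurable_angles R.
have mS : measurable (`[- theta0, theta0]%classic : set R) by exact: measurable_itv.
have mAS : measurable (angles `\` `[- theta0, theta0]%classic : set R).
  exact: measurableD mA mS.
apply: Rintegral_density_restrict => //.
- exact: probability_lty.
- apply: etrans (inv _ mAS _) _; first by move=> x [].
  apply: integral0_eq => x /mem_set xA; apply/eqP; rewrite -measure_le0.
  rewrite -(kernel_setC0 mS (hB1 x xA)).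
  by apply: le_measure; rewrite ?inE; [|exact: measurableC mS|move=> y []].
- by move=> x /mem_set xA; exact: v0.
- apply: measurable_funX; exact: measurable_tan_angles.
- exact: mbounded_tan.
Qed.

(** [psi] is c times K phi, where c = 4 p g + 2 p (p - 1) is the coefficient of tan^2 in the drift.
    The averaged drift c rho + 2 p g is the quantity assumed to be negative. *)
Lemma corrector (R : realType) (g theta0 : R) (K : R.-pker R ~> R) (kappa : R -> R -> R)
    (mu : probability R R) (p rho : R) : theta0 < pi / 2 ->
  markov_on_angles K -> regular_density K kappa -> unique_invariant_probability K mu ->
  let T2 := (fun x : R => tan x ^+ 2) \_ `[- theta0, theta0] in
  rho = \int[mu]_(x in angles) T2 x ->
  p * (2 * (g * (1 + 2 * rho) - rho) + 2 * p * rho) < 0 ->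
  exists psi eta, [/\ 0 < eta, mbounded psi,
    forall e : R, 0 < e -> exists2 delta : R, 0 < delta & forall a a' : R, a \in angles ->
      a' \in angles -> `|a - a'| <= delta -> `|psi a - psi a'| <= e &
    forall a, a \in angles -> p * (4 * g + 2 * p - 2) * kernel_op K T2 a + 2 * p * g +
      kernel_op K psi a + eta <= psi a].
Proof.
move=> t2 hK hk hmu T2 rhoE neg.
set c := p * (4 * g + 2 * p - 2).
(* The averaged drift equals -2 m: one m pays for the error in the Poisson equation, the other is
   left over as [eta]. *)
pose m : R := - (p * (2 * (g * (1 + 2 * rho) - rho) + 2 * p * rho)) / 2.
have m0 : 0 < m by rewrite /m; lra.
have c1 : 0 < `|c| + 1 by have := normr_ge0 c; lra.
have [M M0 hM] := kernel_dominated hk.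
have mT2 := mbounded_tan 2 t2.
have [phi mphi hphi] := approx_poisson hK (@lebesgue_angles_lty R) M0 hM hmu mT2 (divr_gt0 m0 c1).
have mKphi := mbounded_kernel_op K mphi.
exists (fun a => c * kernel_op K phi a), m; split => //.
- exact: mboundedZ.
- move=> e e0.
  have [delta d0 hd] := kernel_op_uniform_continuous hk mphi (divr_gt0 e0 c1).
  exists delta => // a a' aA a'A aa'; rewrite -mulrBr normrM.
  have := hd a a' aA a'A aa'; rewrite ler_pdivlMr// mulrC => h.
  by have := normr_ge0 (kernel_op K phi a - kernel_op K phi a'); lra.
- move=> a aA; have [_ KZ _] := positive_functional_kernel_op K a.
  rewrite KZ//.
  have := hphi a aA; rewrite -rhoE -/T2.
  set k2 := kernel_op K T2 a; set k1 := kernel_op K phi a;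
    set kk := kernel_op K (kernel_op K phi) a.
  move=> h.
  have h2 : `|c * (k1 - kk - (k2 - rho))| <= m.
    rewrite normrM; apply: le_trans (_ : (`|c| + 1) * (m / (`|c| + 1)) <= m).
      by apply: ler_pM => //; lra.
    by rewrite mulrCA divff ?mulr1// gt_eqF.
  move: h2; rewrite ler_norml => /andP[h2 _].
  have e1 : c * rho + 2 * p * g = - (2 * m) by rewrite /m /c; field.
  have e2 : c * (k1 - kk - (k2 - rho)) = c * k1 - c * kk - c * k2 + c * rho by ring.
  by clear -h2 e1 e2; lra.
Qed.

(** Monotone exhaustion; the integrals may be infinite. It reduces the drift inequality to a bounded
    range of z, where V is bounded also for p > 0. *)
Lemma ge0_le_integral_exhaust (R : realType) (d : measure_display)
    (T : measurableType d) (m : {measure set T -> \bar R}) (A : set T) (Z : T -> R)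
    (f h : T -> R) : measurable A -> measurable_fun setT Z -> measurable_fun setT f ->
  measurable_fun setT h -> (forall w, 0 <= f w) -> (forall w, 0 <= h w) ->
  (forall M : nat, (\int[m]_(w in A `&` Z @^-1` `]-oo, M%:R]) (f w)%:E <=
    \int[m]_(w in A `&` Z @^-1` `]-oo, M%:R]) (h w)%:E)%E) ->
  (\int[m]_(w in A) (f w)%:E <= \int[m]_(w in A) (h w)%:E)%E.
Proof.
move=> mA mZ mf mh f0 h0 le.
pose F (M : nat) := A `&` Z @^-1` `]-oo, M%:R].
have AE : A = \bigcup_M F M.
  apply/seteqP; split=> [w Aw|w [M _ []]//].
  exists (Num.bound `|Z w|) => //; split=> //; rewrite /= in_itv/=.
  by rewrite (le_trans (ler_norm _))// ltW// archi_boundP.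
have mF M : measurable (F M).
  apply: measurableI => //; rewrite -[X in measurable X]setTI; apply: mZ => //;
    exact: measurable_itv.
have ndF : nondecreasing_seq F.
  move=> M N MN; rewrite subsetEset => w [Aw]; rewrite /= !in_itv/= => ZM; split=> //.
  by rewrite /= in_itv/= (le_trans ZM)// ler_nat.
have c (u : T -> R) : measurable_fun setT u -> (forall w, 0 <= u w) ->
    (\int[m]_(w in F M) (u w)%:E)%E @[M --> \oo] --> (\int[m]_(w in A) (u w)%:E)%E.
  move=> mu u0; rewrite [in X in _ --> X]AE; apply: ge0_nondecreasing_set_cvg_integral => //.
  - by move=> M; apply/measurable_EFinP; exact: measurable_funTS.
  - by move=> *; rewrite lee_fin.
by apply: (lee_cvg_to (c f mf f0) (c h mh h0)); apply: nearW => M; exact: le.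
Qed.

Lemma powR_le_max (R : realType) (p a b z : R) : 0 < a -> a <= z <= b ->
  z `^ p <= a `^ p + b `^ p.
Proof.
move=> a0 /andP[az zb]; have z0 := lt_le_trans a0 az.
have [p0|/ltW p0] := leP p 0.
  by rewrite (le_trans (powR_le_neg p0 a0 az))// lerDl powR_ge0.
by rewrite (@le_trans _ _ (b `^ p))// ?lerDr ?powR_ge0// ge0_ler_powR// nnegrE; lra.
Qed.

Lemma measurable_lyapunov (R : realType) (g p : R) (psi : R -> R) :
  measurable_fun setT psi -> measurable_fun setT (lyapunov g p psi).
Proof.
move=> mpsi.
have mZ := @measurable_abscissa R.
have mpow a : measurable_fun setT (fun s : R * R * R => s.1.1 `^ a).
  exact: measurableT_comp (measurable_powR a) mZ.
apply: measurable_funM => //; apply: measurable_funD => //; apply: measurable_funM.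
  exact: measurable_funX.
exact: measurableT_comp measurable_snd.
Qed.

(** Below x the function is frozen at x^p; the bounds by powers of max(z, x) and the drift
    inequality are all that later arguments know of V. From z >= 2 x a jump leads to z' >= z / 2 >=
    x, so the expansion applies before and after it. *)
Lemma drift_function (R : realType) (g theta0 : R) (htheta0 : 0 < theta0)
    (K : R.-pker R ~> R) (kappa : R -> R -> R) (mu : probability R R) (p rho : R)
    (d : measure_display) (Omega : measurableType d) (P : probability Omega R)
    (zeta : nat -> {RV P >-> (R * R * R)%type}) (beta : nat -> {RV P >-> R}) :
  0 < g < 1 -> theta0 < pi / 2 -> markov_on_angles K -> concentrated theta0 K ->
  regular_density K kappa -> unique_invariant_probability K mu ->
  (forall a, a \in angles -> rho1 kappa a = 0) ->
  rho = \int[mu]_(x in angles) ((fun x : R => tan x ^+ 2) \_ `[- theta0, theta0]) x ->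
  p * (2 * (g * (1 + 2 * rho) - rho) + 2 * p * rho) < 0 ->
  collisions_process g htheta0 K zeta beta ->
  exists x (V : R * R * R -> R), [/\ 0 < x, measurable_fun setT V,
    forall s, Num.max s.1.1 x `^ p / 2 <= V s <= 2 * Num.max s.1.1 x `^ p &
    forall n A, history zeta n A -> (forall w, A w -> 2 * x <= (zeta n w).1.1) ->
      (\int[P]_(w in A) (V (zeta n.+1 w))%:E <= \int[P]_(w in A) (V (zeta n w))%:E)%E].
Proof.
move=> g01 t2 hK hB1 hk hmu hrho rhoE neg hz; have /andP[g0 g1] := g01.
have [psi [eta [eta0 mpsi ucpsi hpsi]]] := corrector t2 hK hk hmu rhoE neg.
have t02 : 0 < theta0 < pi / 2 by rewrite htheta0.
have [y0 y0p hy0] := lyapunov_expansion p g01 t02 eta0 mpsi.2 ucpsi.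
pose T1 : R -> R := tan \_ `[- theta0, theta0].
pose T2 : R -> R := (fun x : R => tan x ^+ 2) \_ `[- theta0, theta0].
have mT1 : mbounded T1.
  have := mbounded_tan 1 t2.
  by rewrite (_ : (fun x => tan x ^+ 1) = tan)//; apply/funext => x; rewrite expr1.
have mT2 : mbounded T2 := mbounded_tan 2 t2.
set c := p * (4 * g + 2 * p - 2) in hpsi.
(* Coefficient of y^2 in the expansion, with the admissible error [eta] included. *)
pose B b : R := c * T2 b + 2 * p * g + psi b + eta.
have mB : mbounded B.
  by do !apply: mboundedD => //; [exact: mboundedZ|exact: mbounded_cst..].
have [CT hCT] := mT1.2; have [CB hCB] := mB.2; have [C hC] := mpsi.2.
have CT0 : 0 <= CT by apply: le_trans (hCT 0 I).
have CB0 : 0 <= CB by apply: le_trans (hCB 0 I).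
have C0 : 0 <= C by apply: le_trans (hC 0 I).
have p0 := normr_ge0 p.
(* Large enough for y1 L <= 1 to give y1 <= 1, |y^2 psi| <= 1 / 2 and a nonnegative [G]. *)
pose L : R := 2 * `|p| * CT + CB + 2 * C + 2.
have pCT : 0 <= 2 * `|p| * CT by rewrite !mulr_ge0.
have L0 : 0 < L by rewrite /L; lra.
pose y1 : R := Num.min y0 L^-1.
have y10 : 0 < y1 by rewrite lt_min y0p invr_gt0.
have y1L : y1 * L <= 1.
  by rewrite -ler_pdivlMr// div1r ge_min lexx orbT.
have y11 : y1 <= 1 by move: y1L; rewrite /L => h; have := mulr_ge0 (ltW y10) pCT;
  have := mulr_ge0 (ltW y10) CB0; have := mulr_ge0 (ltW y10) C0; clear -h; lra.
pose x : R := y1 `^ (g - 1)^-1.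
have x0 : 0 < x by rewrite powR_gt0.
have xy z : x <= z -> z `^ (g - 1) <= y1.
  move=> xz; rewrite (_ : y1 = x `^ (g - 1)); first by apply: powR_le_neg => //; lra.
  by rewrite -powRrM mulVf ?powRr1 ?ltW//; lra.
have y1C : y1 * C <= 1 / 2.
  move: y1L; rewrite /L => h; have := mulr_ge0 (ltW y10) pCT; have := mulr_ge0 (ltW y10) CB0.
  by clear -h y10; lra.
have ysmall y a : 0 <= y -> y <= y1 -> `|y ^+ 2 * psi a| <= 1 / 2.
  move=> yge0 yy; rewrite normrM ger0_norm ?exprn_ge0// expr2 -mulrA.
  have h1 : y * `|psi a| <= 1 / 2 by apply: le_trans y1C; apply: ler_pM => //; exact: hC.
  apply: le_trans h1; rewrite ler_piMl ?mulr_ge0//; exact: le_trans y11.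
pose V (s : R * R * R) : R := if x <= s.1.1 then lyapunov g p psi s else x `^ p.
pose D : set (R * R * R) := [set s | 2 * x <= s.1.1].
have mZ := @measurable_abscissa R.
have mV : measurable_fun setT V.
  apply: measurable_fun_ifT; last exact: measurable_cst.
    exact: measurable_fun_ler.
  by apply: measurable_lyapunov; exact: mpsi.1.
have Vbound s : Num.max s.1.1 x `^ p / 2 <= V s <= 2 * Num.max s.1.1 x `^ p.
  rewrite /V; have [sx|sx] := leP s.1.1 x.
    have := powR_ge0 x p; case: ifP => xs; last by lra.
    have <- : s.1.1 = x by apply/eqP; rewrite eq_le sx xs.
    have := powR_ge0 s.1.1 p; rewrite /lyapunov.
    have := ysmall (s.1.1 `^ (g - 1)) s.2 (powR_ge0 _ _) (xy _ xs).
    by rewrite ler_norml => /andP[]; nra.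
  rewrite (ltW sx); have := powR_ge0 s.1.1 p; rewrite /lyapunov.
  have := ysmall (s.1.1 `^ (g - 1)) s.2 (powR_ge0 _ _) (xy _ (ltW sx)).
  by rewrite ler_norml => /andP[]; nra.
have V0 s : 0 <= V s.
  by have /andP[h _] := Vbound s; rewrite (le_trans _ h)// divr_ge0// powR_ge0.
exists x, V; split => // n A hA AD.
have mA := history_measurable hA.
have mz k : measurable_fun setT (zeta k) by exact: measurable_funPT.
apply: (@ge0_le_integral_exhaust _ _ _ _ A (fun w => (zeta n w).1.1)
  (fun w => V (zeta n.+1 w)) (fun w => V (zeta n w))) => //.
- exact: measurableT_comp mZ (mz n).
- exact: measurableT_comp mV (mz n.+1).
- exact: measurableT_comp mV (mz n).
move=> M.
(* On this slice the powers of z are bounded whatever the sign of the exponent, as [G] has to be. *)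
pose DM : set (R * R * R) := [set s | 2 * x <= s.1.1 <= M%:R].
have mDM : measurable DM.
  rewrite (_ : DM = (fun s : R * R * R => s.1.1) @^-1` `[2 * x, M%:R]).
    by rewrite -[X in measurable X]setTI; apply: mZ => //; exact: measurable_itv.
  by apply/seteqP; split=> s /=; rewrite in_itv.
have mAM : history zeta n (A `&` (fun w => (zeta n w).1.1) @^-1` `]-oo, M%:R]).
  apply: historyI => //.
  have -> : (fun w => (zeta n w).1.1) @^-1` `]-oo, M%:R] = zeta n @^-1` ((fun s : R * R * R =>
    s.1.1) @^-1` `]-oo, M%:R]) by [].
  apply: history_preimage => //.
  by rewrite -[X in measurable X]setTI; apply: mZ => //; exact: measurable_itv.
have x20 : 0 < 2 * x by lra.
have mpow (a : R) : mbounded (fun s => \1_DM s * s.1.1 `^ a).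
  split.
    apply: measurable_funM; first exact: measurable_indic.
    exact: measurableT_comp (measurable_powR a) mZ.
  exists ((2 * x) `^ a + M%:R `^ a) => s _; rewrite ger0_norm ?mulr_ge0 ?powR_ge0//.
  rewrite indicE; have [sD|sD] := boolP (s \in DM).
    by rewrite mul1r powR_le_max//; exact/set_mem.
  by rewrite mul0r addr_ge0 ?powR_ge0.
pose F (s : R * R * R) : R := \1_DM s * s.1.1 `^ p.
pose Y (s : R * R * R) : R := \1_DM s * s.1.1 `^ (g - 1).
have F0 s : 0 <= F s by rewrite mulr_ge0 ?powR_ge0.
have Y0 s : 0 <= Y s by rewrite mulr_ge0 ?powR_ge0.
have Yy1 s : Y s <= y1.
  rewrite /Y indicE; have [/set_mem/andP[sD _]|sD] := boolP (s \in DM); last by rewrite mul0r ltW.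
  by rewrite mul1r xy//; lra.
pose G (q : R * R * R * R) : R :=
  F q.1 * (1 + 2 * p * Y q.1 * T1 q.2 + Y q.1 ^+ 2 * B q.2).
have mfst (h : R * R * R -> R) : mbounded h -> mbounded (fun q : R * R * R * R => h q.1).
  by apply: mbounded_comp; exact: measurable_fst.
have msnd (h : R -> R) : mbounded h -> mbounded (fun q : R * R * R * R => h q.2).
  by apply: mbounded_comp; exact: measurable_snd.
have mF := mfst _ (mpow p); have mY := mfst _ (mpow (g - 1)).
have mG : mbounded G.
  apply: mboundedM => //; apply: mboundedD; first apply: mboundedD.
  - exact: mbounded_cst.
  - by apply: mboundedM; [exact: mboundedZ|exact: msnd].
  - apply: mboundedM; last exact: msnd.
    by under eq_fun do rewrite expr2; exact: mboundedM.
have G0 q : 0 <= G q.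
  apply: mulr_ge0 => //.
  have hB := hCB q.2 Logic.I; have hT := hCT q.2 Logic.I.
  move: (Y q.1) (Y0 q.1) (Yy1 q.1) (T1 q.2) (B q.2) hB hT => y yge0 yy t b hB hT.
  have h1 : `|2 * p * y * t| <= y1 * (2 * `|p| * CT).
    rewrite !normrM (ger0_norm yge0) [`|2|]ger0_norm//.
    rewrite [leLHS](_ : _ = y * (2 * `|p| * `|t|)); last by ring.
    by apply: ler_pM; rewrite ?mulr_ge0// ler_wpM2l// mulr_ge0.
  have h2 : `|y ^+ 2 * b| <= y1 * CB.
    rewrite normrM ger0_norm ?exprn_ge0//; apply: ler_pM; rewrite ?exprn_ge0// expr2.
    by rewrite -[leRHS]mulr1; apply: ler_pM => //; exact: le_trans yy y11.
  have h3 : y1 * (2 * `|p| * CT) + y1 * CB <= 1.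
    apply: le_trans y1L; rewrite -mulrDr ler_wpM2l ?(ltW y10)// /L; lra.
  by move: h1 h2; rewrite !ler_norml => /andP[h1 _] /andP[h2 _]; clear -h1 h2 h3; lra.
apply: (integral_step_le (D := DM) (G := G) g01 t2 hB1 hz mAM) => //.
- move=> w [/AD wA]; rewrite /= in_itv/= => wM; exact/andP.
- move=> [[z j] a] b /= sD gs bt; have /andP[sx sM] := sD; rewrite /= in sx sM.
  have z0 : 0 < z by lra.
  have zy : z `^ (g - 1) <= y1 by apply: xy; lra.
  have zy0 : z `^ (g - 1) <= y0 by rewrite (le_trans zy)// ge_min lexx.
  have [h1 h2] := hy0 z j a b gs z0 zy0 bt.
  rewrite {1}/V ifT; last by move: h1; lra.
  have bS : b \in (`[- theta0, theta0]%classic : set R).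
    by apply: mem_set; rewrite /= in_itv/= -ler_norml.
  rewrite /G /F /Y /B /T1 /T2 /= !indicE mem_set// !mul1r !patchE bS.
  move: h2; rewrite ler_norml => /andP[_]; rewrite lerBlDr => h2.
  by rewrite (le_trans h2)// /c le_eqVlt; apply/orP; left; apply/eqP; ring.
- move=> [[z j] a] /= sD [z0 j1 za]; have /andP[sx sM] := sD; rewrite /= in sx sM.
  have zp : 0 < z by lra.
  have aA := za zp.
  rewrite /outgoing_measure/= zp.
  have mGs : mbounded (fun b => G (z, j, a, b)).
    by apply: mbounded_comp mG; exact: measurable_pair1.
  rewrite pker_Rintegral_angles//.
  have [KD KZ _] := positive_functional_kernel_op K a.
  rewrite [leLHS](_ : _ = F (z, j, a) * (1 + 2 * p * Y (z, j, a) * kernel_op K T1 a +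
      Y (z, j, a) ^+ 2 * (c * kernel_op K T2 a + 2 * p * g + kernel_op K psi a + eta))); last first.
    rewrite /G/= KZ; last first.
      apply: mboundedD; last exact: mboundedZ.
      by apply: mboundedD; [exact: mbounded_cst|exact: mboundedZ].
    rewrite KD; [|by apply: mboundedD; [exact: mbounded_cst|exact: mboundedZ]|exact: mboundedZ].
    rewrite KD; [|exact: mbounded_cst|exact: mboundedZ].
    rewrite kernel_op_cst// !KZ// /B.
    rewrite KD; [|by do !apply: mboundedD => //;
      [exact: mboundedZ|exact: mbounded_cst]|exact: mbounded_cst].
    rewrite KD//; last by apply: mboundedD; [exact: mboundedZ|exact: mbounded_cst].
    by rewrite KD; [rewrite KZ// !kernel_op_cst|exact: mboundedZ|exact: mbounded_cst].
  (* The term of first order in y disappears here: the mean of the tangent is [rho1], which is 0. *)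
  rewrite (kernel_op_tan t2 hB1 hk aA) hrho// mulr0 addr0 /V ifT; last by rewrite /=; lra.
  rewrite /F /Y indicE mem_set// !mul1r /lyapunov/=.
  rewrite ler_wpM2l ?powR_ge0// lerD2l ler_wpM2l ?exprn_ge0 ?powR_ge0//.
  exact: hpsi.
Qed.

(** * Recurrence *)

Lemma limn_einf_eqy (R : realType) (u : (\bar R)^nat) :
  limn_einf u = +oo%E <-> forall L : R, exists N, forall n, (N <= n)%N -> (L%:E <= u n)%E.
Proof.
rewrite limn_einf_lim; split=> [h L|h].
  have : (L%:E < ereal_sup (range (einfs u)))%E.
    by rewrite -(cvg_lim _ (@cvg_einfs_sup _ u))// h ltry.
  move=> /ereal_sup_gt[_ [N _ <-]] LN; exists N => n Nn.
  by apply/ltW/(lt_le_trans LN); apply: ereal_inf_lbound; exists n.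
apply/cvg_lim => //; apply: cvgy_einfs; apply/cvgeyPge => L.
by have [N hN] := h L; exists N => // n /= Nn; exact: hN.
Qed.

(** V need not be integrable at time 0, so the process is started at time N on the event Z_N <= m
    and followed while it stays above 2 x. The mean of V over these events stays bounded, so by
    Fatou the limit inferior of V times their indicators is almost surely finite, for all N and m at
    once. If Z_n -> oo, some N and m put the path in every [A N m j], and V would tend to infinity
    along it. *)
Lemma recurrent_of_supermartingale (R : realType) (d : measure_display)
    (Omega : measurableType d) (P : probability Omega R)
    (zeta : nat -> {RV P >-> (R * R * R)%type}) (p x : R) (V : R * R * R -> R) :
  0 < p -> 0 < x -> measurable_fun setT V ->
  (forall s, Num.max s.1.1 x `^ p / 2 <= V s <= 2 * Num.max s.1.1 x `^ p) ->
  (forall n A, history zeta n A -> (forall w, A w -> 2 * x <= (zeta n w).1.1) ->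
      (\int[P]_(w in A) (V (zeta n.+1 w))%:E <= \int[P]_(w in A) (V (zeta n w))%:E)%E) ->
  recurrent zeta.
Proof.
move=> p0 x0 mV VB step.
have mZ := @measurable_abscissa R.
have mz k : measurable_fun setT (zeta k) by exact: measurable_funPT.
have V0 s : 0 <= V s.
  by have /andP[h _] := VB s; rewrite (le_trans _ h)// divr_ge0// powR_ge0.
pose U : set (R * R * R) := [set s | 2 * x <= s.1.1].
pose W (m : nat) : set (R * R * R) := [set s | s.1.1 <= m%:R].
have mU : measurable U.
  rewrite (_ : U = (fun s : R * R * R => s.1.1) @^-1` `[2 * x, +oo[).
    by rewrite -[X in measurable X]setTI; apply: mZ => //; exact: measurable_itv.
  by apply/seteqP; split=> s /=; rewrite in_itv/= andbT.
have mW m : measurable (W m).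
  rewrite (_ : W m = (fun s : R * R * R => s.1.1) @^-1` `]-oo, m%:R]).
    by rewrite -[X in measurable X]setTI; apply: mZ => //; exact: measurable_itv.
  by apply/seteqP; split=> s /=; rewrite in_itv.
pose A N m := fix A j := if j is j'.+1 then A j' `&` zeta (N + j)%N @^-1` U
  else zeta N @^-1` W m `&` zeta N @^-1` U.
have hA N m j : history zeta (N + j) (A N m j).
  elim: j => [|j IH] /=.
    by rewrite addn0; apply: historyI; exact: history_preimage.
  apply: historyI; last exact: history_preimage.
  by rewrite addnS; exact: history_mono (leqnSn _) IH.
have AU N m j w : A N m j w -> 2 * x <= (zeta (N + j)%N w).1.1.
  by case: j => [|j] /= []; rewrite ?addn0.
have mA N m j := history_measurable (hA N m j).
pose f N m j w : \bar R := (\1_(A N m j) w * V (zeta (N + j)%N w))%:E.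
have f0 N m j w : (0 <= f N m j w)%E by rewrite lee_fin mulr_ge0.
have mf N m j : measurable_fun setT (f N m j).
  apply/measurable_EFinP; apply: measurable_funM; first exact: measurable_indic.
  exact: measurableT_comp mV (mz _).
have intf N m j : (\int[P]_w f N m j w = \int[P]_(w in A N m j) (V (zeta (N + j)%N w))%:E)%E.
  rewrite [RHS]integral_mkcond; apply: eq_integral => w _.
  by rewrite patchE /f indicE; case: ifP => _; rewrite ?mul1r ?mul0r.
have fC N m j : (\int[P]_w f N m j w <= (2 * Num.max m%:R x `^ p)%:E)%E.
  rewrite intf; elim: j => [|j IH].
    rewrite addn0; apply: (@le_trans _ _ (\int[P]_(w in A N m 0%N) (2 * Num.max m%:R x `^ p)%:E)%E).
      apply: ge0_le_integral => //.
      - by move=> w _; rewrite lee_fin.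
      - by apply/measurable_EFinP/measurable_funTS; exact: measurableT_comp mV (mz N).
      move=> w [wW _]; rewrite lee_fin.
      have /andP[_ h] := VB (zeta N w); apply: (le_trans h).
      have mx : 0 < Num.max (m%:R : R) x by rewrite lt_max x0 orbT.
      have zx : 0 < Num.max (zeta N w).1.1 x by rewrite lt_max x0 orbT.
      rewrite ler_pM2l//; apply: ge0_ler_powR; rewrite ?nnegrE ?(ltW mx) ?(ltW zx) ?(ltW p0)//.
      by rewrite ge_max !le_max lexx orbT andbT wW.
    rewrite (integral_cst P (mA N m 0%N)) -[leRHS]mule1; apply: lee_wpmul2l;
      first by rewrite lee_fin mulr_ge0// powR_ge0.
    exact: probability_le1 (mA _ _ _).
  apply: le_trans IH; apply: (@le_trans _ _ (\int[P]_(w in A N m j) (V (zeta (N + j.+1)%N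
    w))%:E)%E).
    apply: ge0_subset_integral.
    - exact: (mA N m j.+1).
    - exact: mA.
    - by apply/measurable_EFinP/measurable_funTS; exact: measurableT_comp mV (mz _).
    - by move=> w _; rewrite lee_fin.
    - by move=> w [].
  by rewrite addnS; apply: step; [exact: hA|exact: AU].
have fin N m : {ae P, forall w, setT w -> limn_einf (f N m ^~ w) \is a fin_num}.
  apply: integrable_ae => //; apply/integrableP; split.
    rewrite [X in measurable_fun _ X](_ : _ = fun w => (- limn_esup (fun j => - f N m j w))%E)//.
    by apply: measurableT_comp => //; apply: measurable_fun_limn_esup => n; exact: measurableT_comp.
  have limC (u : nat -> \bar R) (C : \bar R) : (forall n, u n <= C)%E -> (limn_einf u <= C)%E.
    move=> uC; rewrite limn_einf_lim; apply: lime_le; first exact: is_cvg_einfs.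
    by apply: nearW => n; apply: le_trans (uC n); apply: ereal_inf_lbound; exists n => /=.
  have lim0 w : (0 <= limn_einf (f N m ^~ w))%E.
    rewrite limn_einf_lim; apply: lime_ge; first exact: is_cvg_einfs.
    by apply: nearW => n; apply: le_ereal_inf_tmp => _ [k _ <-].
  under eq_integral do rewrite gee0_abs//.
  apply: (le_lt_trans (fatou P measurableT (mf N m) (fun j w _ => f0 N m j w))).
  apply: (le_lt_trans (limC _ (2 * Num.max m%:R x `^ p)%:E _)); last exact: ltry.
  by move=> j; exact: fC.
have ae_all : {ae P, forall w N m, limn_einf (f N m ^~ w) \is a fin_num}.
  apply/ae_foralln => N; apply/ae_foralln => m.
  by apply: filterS (fin N m) => w; exact.
apply: filterS ae_all => w hw.
rewrite ltNge leye_eq; apply/eqP => /limn_einf_eqy hZ.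
have [N hN] := hZ (2 * x).
pose m := Num.bound `|(zeta N w).1.1|.
have Aw j : A N m j w.
  elim: j => [|j IH] /=.
    split; last by have := hN N (leqnn N); rewrite lee_fin.
    by rewrite /preimage/W/= (le_trans (ler_norm _))// ltW// archi_boundP.
  split=> //; have := hN (N + j.+1)%N (leq_addr _ _); by rewrite lee_fin.
suff : limn_einf (f N m ^~ w) = +oo%E by move=> e; have := hw N m; rewrite e.
apply/limn_einf_eqy => L.
(* The level from which z^p / 2 is at least |L|. *)
have [N' hN'] := hZ ((2 * `|L|) `^ p^-1).
exists N' => n Nn; rewrite /f lee_fin indicE mem_set// mul1r.
have /andP[h _] := VB (zeta (N + n)%N w); apply: le_trans h.
rewrite ler_pdivlMr// (@le_trans _ _ (2 * `|L|))//.
  by rewrite mulrC ler_wpM2l// ler_norm.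
have LE : 2 * `|L| = ((2 * `|L|) `^ p^-1) `^ p.
  by rewrite -powRrM mulVf ?gt_eqF// powRr1// mulr_ge0.
rewrite {1}LE ge0_ler_powR ?nnegrE ?powR_ge0 ?(ltW p0)//.
  by rewrite le_max (ltW x0) orbT.
rewrite le_max -lee_fin hN'//; exact: leq_trans Nn (leq_addl _ _).
Qed.

(** * Transience *)

Lemma collisions_state (R : realType) (gamma theta0 : R) (htheta0 : 0 < theta0)
    (K : R.-pker R ~> R) (d : measure_display)
    (Omega : measurableType d) (P : probability Omega R)
    (zeta : nat -> {RV P >-> (R * R * R)%type}) (beta : nat -> {RV P >-> R}) (n : nat) (w : Omega) :
  0 < gamma < 1 -> collisions_process gamma htheta0 K zeta beta ->
  0 <= (zeta n w).1.1 /\ ((zeta n w).1.2 = 1 \/ (zeta n w).1.2 = -1).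
Proof.
move=> g01 hz; elim: n => [|n [IH1 IH2]].
  by have := collisions_init hz w; case: (zeta 0%N w) => [[z j] a] [].
rewrite (collisions_step hz); case: (zeta n w) IH1 IH2 => [[z j] a] /= z0 j1.
split; last by rewrite /sgn; case: ifP; [left|right].
have [->//|[t [_ bt ->]]] := hit_pointP (beta n w) g01 z0 j1.
by have /boundaryE[] := bt.
Qed.

Lemma uniform_angle_itv (R : realType) (a b e : R) (ab : a < b) : a <= e -> e <= b ->
  uniform_angle ab `[e, b]%classic = ((b - a)^-1 * (b - e))%:E.
Proof.
move=> ae eb; rewrite /uniform_angle /uniform_prob.
rewrite (eq_integral (fun=> ((b - a)^-1)%:E)); last first.
  move=> x /set_mem; rewrite /= in_itv/= => /andP[ex xb].
  by rewrite /uniform_pdf (le_trans ae ex) xb.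
rewrite integral_cst//= lebesgue_measure_itv/= lte_fin.
have [_|be] := ltP e b; first by rewrite -EFinB EFinM.
by rewrite (_ : e = b) ?subrr ?mulr0 ?mule0//; apply/eqP; rewrite eq_le eb be.
Qed.

Lemma uniform_angle_set1 (R : realType) (a b c : R) (ab : a < b) :
  uniform_angle ab [set c] = 0%E.
Proof. by rewrite /uniform_angle /uniform_prob integral_set1. Qed.

Lemma kernel_set1 (R : realType) (K : R.-pker R ~> R) (kappa : R -> R -> R) (a c : R) :
  regular_density K kappa -> a \in angles -> c \in angles -> K a [set c] = 0%E.
Proof.
move=> [_ _ _ kd _] aA cA; apply: etrans (kd a [set c] aA _ _) _ => //.
- by move=> x ->; exact: set_mem.
- by rewrite integral_set1.
Qed.

(** [c] will be the angle of the horizontal ray; removing one angle costs no mass. Lowering e to at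
    most theta0 / 2 lets the uniform law at the tip charge the interval with at least 1 / 4. *)
Lemma outgoing_upward (R : realType) (theta0 : R) (htheta0 : 0 < theta0)
    (K : R.-pker R ~> R) (kappa : R -> R -> R) : theta0 < pi / 2 ->
  concentrated theta0 K -> regular_density K kappa -> uniformly_positive K ->
  exists e delta : R, [/\ 0 < e, 0 < delta & forall s c, good_state s -> c \in angles ->
    (delta%:E <= outgoing_measure htheta0 K s (`[e, theta0]%classic `\ c))%E].
Proof.
move=> t2 hB1 hk [e e0 he].
pose e' : R := Num.min e (theta0 / 2).
have e'e : e' <= e by rewrite ge_min lexx.
have e't : e' <= theta0 / 2 by rewrite ge_min lexx orbT.
have e'0 : 0 < e' by rewrite lt_min e0; lra.
exists e', (Num.min e (1 / 4)); split => //.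
- by rewrite lt_min e0; lra.
move=> [[z j] a] c [z0 _ za] cA; rewrite /outgoing_measure/=.
pose B : set R := `[e', theta0]%classic.
have mB : measurable B by exact: measurable_itv.
have mc : measurable [set c] by exact: measurable_set1.
have mS : measurable (`[- theta0, theta0]%classic : set R) by exact: measurable_itv.
have mE : measurable (`[e, (pi / 2)%R]%classic : set R) by exact: measurable_itv.
have mBc : measurable (B `\ c) by exact: measurableD.
case: ifPn => zp.
- have aA := za zp.
  apply: (@le_trans _ _ e%:E); first by rewrite lee_fin ge_min lexx.
  apply: (le_trans (he a aA)).
  apply: (@le_trans _ _ (K a ((B `\ c `|` [set c]) `|` ~` `[- theta0, theta0]))).
    apply: le_measure; rewrite ?inE//.
      by apply: measurableU; [exact: measurableU|exact: measurableC].
    move=> x /=; rewrite !in_itv/= => /andP[ex xp].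
    have [xt|xt] := leP x theta0; last by right; rewrite andbF.
    left; have [->|/eqP xc] := eqVneq x c; first by right.
    by left; split=> //; rewrite /B/= in_itv/= xt andbT; lra.
  apply: (le_trans (measureU2 (K a) _ _)); [exact: measurableU|exact: measurableC|].
  rewrite [X in (_ + X)%E](kernel_setC0 mS (hB1 a aA)) adde0.
  apply: (le_trans (measureU2 (K a) _ _)) => //.
  by rewrite [X in (_ + X)%E](kernel_set1 hk aA cA) adde0.
- apply: (@le_trans _ _ (1 / 4)%:E); first by rewrite lee_fin ge_min lexx orbT.
  apply: (@le_trans _ _ (uniform_angle (gtrN htheta0) B)).
    rewrite uniform_angle_itv; [|lra|lra].
    by rewrite lee_fin opprK -ler_pdivrMl ?invr_gt0 ?invrK; lra.
  apply: (@le_trans _ _ (uniform_angle (gtrN htheta0) (B `\ c `|` [set c]))).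
    apply: le_measure; rewrite ?inE//; first exact: measurableU.
    by move=> x Bx; have [->|/eqP xc] := eqVneq x c; [right|left].
  apply: (le_trans (measureU2 (uniform_angle (gtrN htheta0)) _ _)) => //.
  by rewrite [X in (_ + X)%E]uniform_angle_set1 adde0.
Qed.

Lemma growth_probability (R : realType) (gamma theta0 : R) (htheta0 : 0 < theta0)
    (K : R.-pker R ~> R) (kappa : R -> R -> R) (d : measure_display)
    (Omega : measurableType d) (P : probability Omega R)
    (zeta : nat -> {RV P >-> (R * R * R)%type}) (beta : nat -> {RV P >-> R}) :
  0 < gamma < 1 -> theta0 < pi / 2 -> concentrated theta0 K ->
  regular_density K kappa -> uniformly_positive K ->
  collisions_process gamma htheta0 K zeta beta ->
  exists c delta : R, [/\ 0 < c, 0 < delta & forall n A, history zeta n A ->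
    (delta%:E * P A <=
      P (A `&` [set w | ((zeta n w).1.1 + c <= (zeta n.+1 w).1.1)%R]))%E].
Proof.
move=> g01 t2 hB1 hk hB3 hz; have /andP[g0 g1] := g01.
have [e [delta [e0 delta0 up]]] := outgoing_upward htheta0 t2 hB1 hk hB3.
have [c c0 grow] := hit_point_growth g01 e0 t2.
have hp : 0 < (pi : R) := @pi_gt0 R.
exists c, delta; split => // n A hA.
have mA := history_measurable hA.
have mZ := @measurable_abscissa R.
have mz k : measurable_fun setT (zeta k) by exact: measurable_funPT.
have mb : measurable_fun setT (beta n) by exact: measurable_funPT.
(* [q s] is pi / 2 - theta z, the outgoing angle that makes the ray horizontal, in a form that is
   measurable in s. *)
pose q (s : R * R * R) : R := atan (s.1.1 `^ (1 - gamma) / gamma).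
have mq : measurable_fun setT q.
  apply: measurableT_comp; first by apply: continuous_measurable_fun => x; exact: continuous_atan.
  apply: measurable_funM => //.
  exact: measurableT_comp (measurable_powR (1 - gamma)) mZ.
have qA s : q s \in angles.
  apply: mem_set; rewrite /angles/= in_itv/=.
  by rewrite !ltW ?atan_gtNpi2 ?atan_ltpi2.
pose E : set (R * R * R * R) := [set r | r.2 \in `[e, theta0]%R] `\` [set r | q r.1 == r.2].
have mE : measurable E.
  apply: measurableD.
    rewrite (_ : [set _ | _] = snd @^-1` `[e, theta0]%classic)//.
    by rewrite -[X in measurable X]setTI; apply: measurable_snd => //; exact: measurable_itv.
  rewrite (_ : [set _ | _] = (fun r : R * R * R * R => q r.1 - r.2) @^-1` [set 0]).
    have mf : measurable_fun setT (fun r : R * R * R * R => q r.1 - r.2).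
      by apply: measurable_funB; [exact: measurableT_comp mq measurable_fst|exact: measurable_snd].
    by rewrite -[X in measurable X]setTI; apply: mf => //; exact: measurable_set1.
  by apply/seteqP; split=> r /=; rewrite -subr_eq0 => /eqP.
have [gn _] := good_state_ae n g01 t2 hB1 hz.
have mgz : measurable (zeta n @^-1` [set s | good_state s]).
  exact: history_measurable (history_preimage (zeta:=zeta) (leqnn n) (@measurable_good_state R)).
have jl := integral_joint_law mA (mz n) mb (fun C B mC mB => collisions_joint_law hz hA mC mB) mE.
apply: (@le_trans _ _ (P (A `&` (fun w => (zeta n w, beta n w)) @^-1` E))).
  rewrite jl -integral_cst//; apply: ae_ge0_le_integral => //.
  - by move=> w _; rewrite lee_fin ltW.
  - apply: measurable_funTS.
    apply: (measurableT_comp (f := fun s => outgoing_measure htheta0 K s (xsection E s))) (mz n).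
    by apply: (@measurable_fun_xsection_finite_kernel _ _ _ _ _ (outgoing_measure htheta0 K));
      rewrite inE.
  exists (~` (zeta n @^-1` [set s | good_state s])); split=> //; first exact: measurableC.
  move=> w; apply: contra_notP => /contrapT gw /= Aw.
  apply: (le_trans (up (zeta n w) (q (zeta n w)) gw (qA _))).
  apply: le_measure; rewrite ?inE.
  - by apply: measurableD; [exact: measurable_itv|exact: measurable_set1].
  - exact: measurable_xsection.
  - move=> x [xe xq]; rewrite /xsection/=; apply: mem_set; split=> //=.
    by move=> /eqP qx; apply: xq.
apply: le_measure; rewrite ?inE.
- apply: measurableI => //; rewrite -[X in measurable X]setTI.
  by apply: measurable_fun_pair.
- apply: measurableI => //; rewrite -[X in measurable X]setTI.
  apply: measurable_fun_ler => //; last exact: measurableT_comp mZ (mz _).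
  by apply: measurable_funD => //; exact: measurableT_comp mZ (mz _).
- move=> w [Aw [/= be qb]]; split=> //=.
  have [z0 j1] := collisions_state n w g01 hz.
  rewrite (collisions_step hz); move: z0 j1 qb; rewrite /q.
  case: (zeta n w) => [[z j] a] /= z0 j1 qb.
  apply: (grow z j (beta n w) z0 j1); first by move: be; rewrite in_itv.
  by rewrite thetaE//; apply: contra_notN qb => /eqP h; apply/eqP; lra.
Qed.

Lemma history_le (R : realType) (d : measure_display)
    (Omega : measurableType d) (P : probability Omega R)
    (zeta : nat -> {RV P >-> (R * R * R)%type}) (a : R) n k l :
  (k <= n)%N -> (l <= n)%N ->
  history zeta n [set w | (zeta k w).1.1 + a <= (zeta l w).1.1].
Proof.
move=> kn ln; set G := [set A | exists k (B : set (R * R * R)),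
        [/\ (k <= n)%N, measurable B & A = zeta k @^-1` B]].
pose T := g_sigma_algebraType G.
have mZ := @measurable_abscissa R.
have mz i : (i <= n)%N -> @measurable_fun _ _ T _ setT (fun w => (zeta i w).1.1).
  move=> i_n; apply: (@measurableT_comp _ _ _ T _ _ (fun s : R * R * R => s.1.1)) => //.
  move=> _ B mB; rewrite setTI; exact: history_preimage.
suff : @measurable _ T (setT `&` [set w | (zeta k w).1.1 + a <= (zeta l w).1.1]) by rewrite setTI.
by apply: measurable_fun_ler => //; [apply: measurable_funD => //; exact: mz|exact: mz].
Qed.

(** Each jump is estimated on an event of the history that already contains the success of the jumps
    before it. *)
Lemma growth_iter (R : realType) (d : measure_display)
    (Omega : measurableType d) (P : probability Omega R)
    (zeta : nat -> {RV P >-> (R * R * R)%type}) (c delta : R) : 0 < delta ->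
  (forall n A, history zeta n A -> (delta%:E * P A <=
      P (A `&` [set w | ((zeta n w).1.1 + c <= (zeta n.+1 w).1.1)%R]))%E) ->
  forall m n A, history zeta n A -> ((delta ^+ m)%:E * P A <=
      P (A `&` [set w | ((zeta n w).1.1 + m%:R * c <= (zeta (n + m)%N w).1.1)%R]))%E.
Proof.
move=> delta0 hg; elim=> [|m IH] n A hA.
  rewrite expr0 mul1e addn0 (_ : _ `&` _ = A)//; apply/seteqP; split=> [w []//|w Aw].
  by split=> //=; rewrite mul0r addr0.
have hnm k : history zeta (n + k) A by apply: history_mono hA; exact: leq_addr.
have hB : history zeta (n + m) [set w | (zeta n w).1.1 + m%:R * c <= (zeta (n + m)%N w).1.1].
  by apply: history_le => //; exact: leq_addr.
have hAB := historyI (hnm m) hB.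
have := hg _ _ hAB; rewrite exprS EFinM -muleA.
move=> h; apply: (le_trans (lee_wpmul2l _ (IH n A hA))); first by rewrite lee_fin ltW.
apply: (le_trans h); apply: le_measure; rewrite ?inE.
- apply: (@history_measurable _ _ _ _ zeta (n + m).+1); apply: historyI.
    exact: history_mono (leqnSn _) hAB.
  by apply: history_le.
- apply: (@history_measurable _ _ _ _ zeta (n + m.+1)); apply: historyI => //.
  by apply: history_le => //; exact: leq_addr.
- move=> w [[Aw /= w1] w2]; split=> //=; rewrite addnS; move: w1 w2.
  by rewrite -[m.+1%:R]natr1 mulrDl mul1r; lra.
Qed.

(** Time is cut into blocks of m jumps with m c >= L. As Z >= 0, a block that advances by m c ends
    at or above L, which has conditional probability at least delta^m; staying below L through j
    blocks has probability at most (1 - delta^m)^j. *)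
Lemma unbounded_ae (R : realType) (d : measure_display)
    (Omega : measurableType d) (P : probability Omega R)
    (zeta : nat -> {RV P >-> (R * R * R)%type}) (c delta L : R) : 0 < c -> 0 < delta ->
  (forall n w, 0 <= (zeta n w).1.1) ->
  (forall n A, history zeta n A -> (delta%:E * P A <=
      P (A `&` [set w | ((zeta n w).1.1 + c <= (zeta n.+1 w).1.1)%R]))%E) ->
  P [set w | forall k, ((zeta k w).1.1 < L)%R] = 0%E.
Proof.
move=> c0 delta0 Z0 hg.
have mZ := @measurable_abscissa R.
pose U : set (R * R * R) := (fun s => s.1.1) @^-1` `]-oo, L[.
have mU : measurable U by rewrite -[U]setTI; apply: mZ => //; exact: measurable_itv.
pose m := Num.bound (`|L| / c).
have mc : L <= m%:R * c.
  rewrite -ler_pdivrMr// (@le_trans _ _ (`|L| / c))//; last first.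
    by rewrite ltW// archi_boundP// divr_ge0// ltW.
  by rewrite ler_pM2r ?invr_gt0// ler_norm.
(* [A j] tests only the ends of the first j blocks. *)
pose A := fix A j := if j is j'.+1 then A j' `&` zeta (j * m)%N @^-1` U else setT.
have hA j : history zeta (j * m) (A j).
  elim: j => [|j IH] /=; first exact: historyT.
  apply: historyI; last exact: history_preimage.
  by apply: history_mono IH; rewrite leq_mul2r leqnSn orbT.
have mA j := history_measurable (hA j).
pose r : R := 1 - delta ^+ m.
have r0 : 0 <= r.
  have := growth_iter delta0 hg m (@historyT _ _ _ P zeta 0%N); rewrite probability_setT mule1 => h.
  rewrite subr_ge0 -lee_fin (le_trans h)// probability_le1//.
  apply: (@history_measurable _ _ _ _ zeta (0 + m)); apply: historyI; first exact: historyT.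
  exact: history_le.
have r1 : r < 1 by rewrite /r ltrBlDr ltrDl exprn_gt0.
have PA j : fine (P (A j)) <= r ^+ j.
  elim: j => [|j IH]; first by rewrite expr0 probability_setT.
  have := growth_iter delta0 hg m (hA j).
  set B := _ `&` [set w | _] => h.
  have mB : measurable B.
    apply: (@history_measurable _ _ _ _ zeta (j * m + m)); apply: historyI.
      exact: history_mono (leq_addr _ _) (hA j).
    by apply: history_le => //; exact: leq_addr.
  have AB : A j.+1 `<=` A j `\` B.
    move=> w [Aw]; rewrite /U/preimage/= in_itv/= => ZL; split=> // -[_ /=].
    by rewrite addnC -mulSn => h1; have := Z0 (j * m)%N w; lra.
  have BAj : A j `&` B = B by rewrite setIC setIidl// => w [].
  have mAB : measurable (A j `\` B) by exact: measurableD.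
  have e1 : fine (P (A j)) = fine (P (A j `\` B)) + fine (P B).
    rewrite -fineD ?fin_num_measure//; congr fine.
    by apply: etrans (measureDI P (mA j) mB) _; rewrite BAj.
  have e2 : fine (P (A j.+1)) <= fine (P (A j `\` B)).
    by rewrite fine_le ?fin_num_measure// ?le_measure ?inE//; exact: (mA j.+1).
  have e3 : delta ^+ m * fine (P (A j)) <= fine (P B).
    by rewrite -lee_fin EFinM !fineK ?fin_num_measure//; exact: mA.
  rewrite exprS; apply: le_trans (ler_wpM2l r0 IH); rewrite /r mulrBl mul1r.
  by clear -e1 e2 e3; lra.
have mE : measurable [set w | forall k, (zeta k w).1.1 < L].
  rewrite (_ : [set _ | _] = \bigcap_k (zeta k @^-1` U)).
    apply: bigcapT_measurable => k; exact: history_measurable (history_preimage (leqnn k) mU).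
  apply/seteqP; split=> [w h k _|w h k].
    by rewrite /U/preimage/= in_itv/=; exact: h.
  by have := h k Logic.I; rewrite /U/preimage/= in_itv.
have PE j : (P [set w | forall k, ((zeta k w).1.1 < L)%R] <= P (A j))%E.
  apply: le_measure; rewrite ?inE//.
  move=> w /= hw; elim: j => [//|j IH] /=; split=> //.
  by rewrite /U/preimage/= in_itv/=; exact: hw.
apply/eqP; rewrite -measure_le0 -[leLHS]fineK ?fin_num_measure// lee_fin.
have cv : r ^+ j @[j --> \oo] --> (0 : R) by apply: cvg_expr; rewrite ger0_norm.
rewrite -(cvg_lim _ cv)//; apply: limr_ge; first by apply/cvg_ex; exists 0.
apply: nearW => j; apply: le_trans (PA j).
by rewrite fine_le ?fin_num_measure//; exact: mA.
Qed.

(** Maximal inequality for a nonnegative supermartingale. [B j] is the event of no return up to time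
    N + j. At a return V is at least e = z0^p / 2, while V <= 2 z2^p at time N; the constant 4 (z2 /
    z0)^p is the quotient of these bounds. *)
Lemma return_probability (R : realType) (d : measure_display)
    (Omega : measurableType d) (P : probability Omega R)
    (zeta : nat -> {RV P >-> (R * R * R)%type}) (p x : R) (V : R * R * R -> R)
    (N : nat) (A : set Omega) (z0 z2 : R) :
  p < 0 -> 0 < x -> measurable_fun setT V ->
  (forall s, Num.max s.1.1 x `^ p / 2 <= V s <= 2 * Num.max s.1.1 x `^ p) ->
  (forall n A, history zeta n A -> (forall w, A w -> 2 * x <= (zeta n w).1.1) ->
      (\int[P]_(w in A) (V (zeta n.+1 w))%:E <= \int[P]_(w in A) (V (zeta n w))%:E)%E) ->
  2 * x <= z0 -> z0 <= z2 -> history zeta N A -> (forall w, A w -> z2 <= (zeta N w).1.1) ->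
  (P (A `&` [set w | exists i, ((zeta (N + i)%N w).1.1 < z0)%R]) <=
    (4 * (z2 `^ p / z0 `^ p))%:E * P A)%E.
Proof.
move=> p0 x0 mV VB step xz0 z02 hA AN.
have z0p : 0 < z0 by lra.
have mZ := @measurable_abscissa R.
have mz k : measurable_fun setT (zeta k) by exact: measurable_funPT.
have V0 s : 0 <= V s.
  by have /andP[h _] := VB s; rewrite (le_trans _ h)// divr_ge0// powR_ge0.
have mVz k : measurable_fun setT (fun w => (V (zeta k w))%:E).
  by apply/measurable_EFinP; exact: measurableT_comp mV (mz k).
pose U : set (R * R * R) := (fun s => s.1.1) @^-1` `[z0, +oo[.
have mU : measurable U by rewrite -[U]setTI; apply: mZ => //; exact: measurable_itv.
pose B := fix B j := if j is j'.+1 then B j' `&` zeta (N + j)%N @^-1` U else A.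
have hB j : history zeta (N + j) (B j).
  elim: j => [|j IH] /=; first by rewrite addn0.
  apply: historyI; last exact: history_preimage.
  by apply: history_mono IH; rewrite leq_add2l.
have BU j w : B j w -> z0 <= (zeta (N + j)%N w).1.1.
  case: j => [/AN|j [_]]; first by rewrite addn0; exact: le_trans.
  by rewrite /U/preimage/= in_itv/= andbT.
have BA j : B j `<=` A by elim: j => [//|j IH] w [/IH].
have mA := history_measurable hA.
have mB j := history_measurable (hB j).
pose e : R := z0 `^ p / 2.
have e0 : 0 < e by rewrite divr_gt0// powR_gt0.
have intge k (C : set Omega) : measurable C -> (forall w, C w -> e <= V (zeta k w)) ->
    (e%:E * P C <= \int[P]_(w in C) (V (zeta k w))%:E)%E.
  move=> mC Ce; rewrite -(integral_cst P mC); apply: ge0_le_integral => //.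
  - by move=> w _; rewrite lee_fin ltW.
  - exact: measurable_funTS.
(* Paths that have returned are counted with the least value e, the others with their current V;
   this total does not increase with j. *)
have key j : (\int[P]_(w in B j) (V (zeta (N + j)%N w))%:E + e%:E * P (A `\` B j) <=
    \int[P]_(w in A) (V (zeta N w))%:E)%E.
  elim: j => [|j IH]; first by rewrite addn0 /= setDv measure0 mule0 adde0.
  apply: le_trans IH.
  have BE : B j = B j.+1 `|` (B j `\` B j.+1).
    by apply/esym/setDUK => w [].
  have mBD : measurable (B j `\` B j.+1) by exact: measurableD.
  have -> : P (A `\` B j.+1) = (P (A `\` B j) + P (B j `\` B j.+1))%E.
    rewrite -measureU//; last by apply/seteqP; split=> // w [[_ ?] []].
      congr (P _); apply/seteqP; split=> [w [Aw nB]|w [[Aw nB]|[Bw nB]]].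
      - by have [Bw|Bw] := pselect (B j w); [right|left].
      - by split=> // -[].
      - by split=> //; exact: (BA j).
    by apply: measurableD => //; exact: mB.
  have st := step _ _ (hB j) (fun w Bw => le_trans xz0 (BU j w Bw)).
  rewrite -addnS in st.
  apply: (@le_trans _ _ (\int[P]_(w in B j) (V (zeta (N + j.+1)%N w))%:E + e%:E * P (A `\` B
    j))%E); last first.
    exact: leeD2r.
  rewrite [in X in (_ <= X + _)%E]BE ge0_integral_setU//; last 3 first.
  - exact: measurable_funTS.
  - by move=> w _; rewrite lee_fin.
  - by apply/disj_setPRL => w [].
  rewrite muleDr//; last by rewrite ge0_adde_def// inE.
  rewrite addeA [leLHS]addeAC; apply: leeD2r; apply: leeD2l.
  apply: intge => // w [Bw nB]; rewrite /e.
  have /andP[h _] := VB (zeta (N + j.+1)%N w); apply: le_trans h.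
    rewrite ler_pM2r ?invr_gt0//; apply: powR_le_neg; first exact: ltW.
      by rewrite lt_max x0 orbT.
    rewrite ge_max; apply/andP; split; last by lra.
    rewrite leNgt; apply/negP => h; apply: nB; split=> //.
    by rewrite /U/preimage/= in_itv/= andbT ltW.
have start : (\int[P]_(w in A) (V (zeta N w))%:E <= (2 * z2 `^ p)%:E * P A)%E.
  rewrite -integral_cst//; apply: ge0_le_integral => //.
  - by move=> w _; rewrite lee_fin.
  - exact: measurable_funTS.
  - move=> w /AN Zw; rewrite lee_fin.
    have /andP[_ h] := VB (zeta N w); apply: (le_trans h).
    rewrite ler_pM2l//; apply: powR_le_neg; [exact: ltW|lra|].
    by rewrite le_max Zw.
have PB j : (P (A `\` B j) <= (4 * (z2 `^ p / z0 `^ p))%:E * P A)%E.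
  rewrite -(@lee_pmul2l _ e%:E) ?lte_fin// muleA -EFinM.
  have -> : e * (4 * (z2 `^ p / z0 `^ p)) = 2 * z2 `^ p.
    by rewrite /e; field; rewrite gt_eqF// powR_gt0.
  apply: le_trans start; apply: le_trans (key j).
  by apply: leeDr; apply: integral_ge0 => w _; rewrite lee_fin.
have -> : A `&` [set w | exists i, (zeta (N + i)%N w).1.1 < z0] = \bigcup_j (A `\` B j).
  apply/seteqP; split=> [w [Aw [i Zi]]|w [j _ [Aw nB]]].
    by exists i => //; split=> // /BU; rewrite leNgt Zi.
  split=> //; apply: contrapT => h; apply: nB; elim: j => [//|j IH]; split=> //.
  rewrite /U/preimage/= in_itv/= andbT leNgt; apply/negP => Z; apply: h.
  by exists j.+1.
have cv : P (A `\` B j) @[j --> \oo] --> P (\bigcup_j (A `\` B j)).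
  apply: nondecreasing_cvg_mu.
  - by move=> j; apply: measurableD.
  - by apply: bigcup_measurable => j _; exact: measurableD.
  - apply/nondecreasing_seqP => j; rewrite subsetEset => w [Aw nB]; split=> // -[].
    by move=> Bw _; exact: nB.
rewrite -(cvg_lim _ cv)//; apply: lime_le; first by apply/cvg_ex; eexists; exact: cv.
by apply: nearW => j; exact: PB.
Qed.

(** For M >= L >= 2 x, infinitely many visits below L have probability at most 4 (M / L)^p: the path
    almost surely reaches M, the possible first passage times give disjoint events, and the return
    estimate is summed over them. As p < 0, letting M grow gives 0. *)
Lemma transient_of_supermartingale (R : realType) (d : measure_display)
    (Omega : measurableType d) (P : probability Omega R)
    (zeta : nat -> {RV P >-> (R * R * R)%type}) (p x : R) (V : R * R * R -> R) :
  p < 0 -> 0 < x -> measurable_fun setT V ->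
  (forall s, Num.max s.1.1 x `^ p / 2 <= V s <= 2 * Num.max s.1.1 x `^ p) ->
  (forall n A, history zeta n A -> (forall w, A w -> 2 * x <= (zeta n w).1.1) ->
      (\int[P]_(w in A) (V (zeta n.+1 w))%:E <= \int[P]_(w in A) (V (zeta n w))%:E)%E) ->
  (forall L, P [set w | forall k, ((zeta k w).1.1 < L)%R] = 0%E) ->
  transient zeta.
Proof.
move=> p0 x0 mV VB step unb.
have mZ := @measurable_abscissa R.
have mz k : measurable_fun setT (fun w => (zeta k w).1.1).
  by apply: measurableT_comp mZ _; exact: measurable_funPT.
have mlt k (L : R) : measurable [set w | (zeta k w).1.1 < L].
  rewrite (_ : [set _ | _] = (fun w => (zeta k w).1.1) @^-1` `]-oo, L[); last first.
    by apply/seteqP; split=> w /=; rewrite in_itv.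
  by rewrite -[X in measurable X]setTI; apply: mz => //; exact: measurable_itv.
pose ret (L : R) : set Omega := \bigcap_n \bigcup_(k in [set k | (n <= k)%N]) [set w |
  (zeta k w).1.1 < L].
have mret L : measurable (ret L).
  by apply: bigcapT_measurable => n; apply: bigcup_measurable => k _; exact: mlt.
have bound (L M : R) : 2 * x <= L -> L <= M -> (P (ret L) <= (4 * (M `^ p / L `^ p))%:E)%E.
  move=> xL LM.
  pose B N : set Omega := [set w | M <= (zeta N w).1.1] `&` \bigcap_(i in [set i |
    (i < N)%N]) [set w | (zeta i w).1.1 < M].
  have hB N : history zeta N (B N).
    set G := [set A | exists k (B : set (R * R * R)),
        [/\ (k <= N)%N, measurable B & A = zeta k @^-1` B]].
    have hlt i : (i <= N)%N -> @measurable _ (g_sigma_algebraType G) [set w | (zeta i w).1.1 < M].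
      move=> iN; rewrite (_ : [set _ | _] = zeta i @^-1` [set s | s.1.1 < M])//.
      apply: history_preimage => //.
      rewrite (_ : [set _ | _] = (fun s : R * R * R => s.1.1) @^-1` `]-oo, M[); last first.
        by apply/seteqP; split=> w /=; rewrite in_itv.
      by rewrite -[X in measurable X]setTI; apply: mZ => //; exact: measurable_itv.
    apply: (@measurableI _ (g_sigma_algebraType G)).
      rewrite (_ : [set _ | _] = ~` [set w | (zeta N w).1.1 < M]).
        by apply: measurableC; exact: hlt.
      by apply/seteqP; split=> w /=; rewrite leNgt => /negP.
    by apply: (@bigcap_measurableType _ (g_sigma_algebraType G)) => i /= iN; apply: hlt;
      exact: ltnW.
  have mB N := history_measurable (hB N).
  pose F N : set Omega := B N `&` [set w | exists i, (zeta (N + i)%N w).1.1 < L].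
  have mF N : measurable (F N).
    apply: measurableI => //.
    rewrite (_ : [set _ | _] = \bigcup_i [set w | (zeta (N + i)%N w).1.1 < L]).
      by apply: bigcup_measurable => i _; exact: mlt.
    by apply/seteqP; split=> w [i]; [exists i|move=> _; exists i].
  have PF N : (P (F N) <= (4 * (M `^ p / L `^ p))%:E * P (B N))%E.
    by apply: (return_probability p0 x0 mV VB step xL LM (hB N)) => w [].
  have C0 : 0 <= 4 * (M `^ p / L `^ p) by rewrite mulr_ge0// divr_ge0 ?powR_ge0.
  have mlow : measurable [set w | forall k, (zeta k w).1.1 < M].
    rewrite (_ : [set _ | _] = \bigcap_k [set w | (zeta k w).1.1 < M]).
      by apply: bigcapT_measurable => k; exact: mlt.
    by apply/seteqP; split=> w h k; [move=> _; exact: h|exact: (h k Logic.I)].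
  have sub : ret L `<=` [set w | forall k, (zeta k w).1.1 < M] `|` \bigcup_N F N.
    move=> w rw; have [low|/existsNP[k /negP]] := pselect (forall k, (zeta k w).1.1 < M);
      first by left.
    rewrite -leNgt => Mk; right.
    have ex : exists k, M <= (zeta k w).1.1 by exists k.
    exists (ex_minn ex) => //; case: ex_minnP => N MN hN; split.
      split=> // i /= iN; rewrite ltNge; apply/negP => /hN; rewrite leqNgt.
      by move/negP; apply.
    have [i /= Ni Zi] := rw N Logic.I; exists (i - N)%N; by rewrite subnKC.
  have mUF : measurable (\bigcup_N F N) by apply: bigcup_measurable.
  apply: (@le_trans _ _ (P ([set w | forall k, ((zeta k w).1.1 < M)%R] `|` \bigcup_N F N))).
    by apply: le_measure; rewrite ?inE//; exact: measurableU.
  apply: (le_trans (measureU2 _ mlow mUF)); rewrite [X in (X + _)%E]unb add0e.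
  apply: (le_trans (generalized_Boole_inequality P mF mUF)).
  apply: (@le_trans _ _ (\sum_(0 <= N <oo) (4 * (M `^ p / L `^ p))%:E * P (B N))%E).
    by apply: lee_nneseries => N _ //; exact: PF.
  rewrite nneseriesZl// -measure_semi_bigcup//.
  - rewrite -[leRHS]mule1; apply: lee_wpmul2l; first by rewrite lee_fin.
    by apply: probability_le1; exact: bigcup_measurable.
  - apply/trivIsetP => i j _ _; rewrite neq_lt => /orP[] ij.
      by apply/seteqP; split=> // w [[/= wi hi] [/= wj hj]]; have := hj i ij; rewrite /= ltNge wi.
    by apply/seteqP; split=> // w [[/= wi hi] [/= wj hj]]; have := hi j ij; rewrite /= ltNge wj.
  - exact: bigcup_measurable.
have ret0 L : 2 * x <= L -> P (ret L) = 0%E.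
  move=> xL; have L0 : 0 < L by lra.
  apply/eqP; rewrite -measure_le0; apply/lee_addgt0Pr => e e0; rewrite add0e.
  (* [y] solves 4 y^p / L^p = e. *)
  pose y : R := (e / 4 * L `^ p) `^ p^-1.
  have y0 : 0 < y by rewrite powR_gt0// mulr_gt0 ?powR_gt0// divr_gt0.
  have yp : y `^ p = e / 4 * L `^ p.
    by rewrite -powRrM mulVf ?lt_eqF// powRr1// mulr_ge0 ?powR_ge0// divr_ge0// ltW.
  apply: (le_trans (bound L (Num.max L y) xL _)); first by rewrite le_max lexx.
  rewrite lee_fin (@le_trans _ _ (4 * (y `^ p / L `^ p)))//.
    rewrite ler_pM2l// ler_pM2r ?invr_gt0 ?powR_gt0//; apply: powR_le_neg => //; first exact: ltW.
    by rewrite le_max lexx orbT.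
  by rewrite yp mulfK ?gt_eqF ?powR_gt0// mulrC divfK.
(* Countably many levels suffice for divergence, so the exceptional sets unite to a null set. *)
have : {ae P, forall w, forall m : nat, ~ ret (2 * x + m%:R) w}.
  apply/ae_foralln => m; exists (ret (2 * x + m%:R)); split=> //.
  - by apply: ret0; rewrite lerDl.
  - by move=> w /= /contrapT.
apply: filterS => w hw; apply/cvgryPge => L.
pose m := Num.bound `|L|.
have Lm : L <= 2 * x + m%:R.
  rewrite (le_trans (ler_norm _))// (le_trans (ltW (archi_boundP _)))// lerDr; lra.
have [n hn] : exists n, forall k, (n <= k)%N -> 2 * x + m%:R <= (zeta k w).1.1.
  apply: contrapT => /forallNP h; apply: (hw m) => n _.
  have /existsNP[k /not_implyP[nk /negP]] := h n.
  by rewrite -ltNge => Zk; exists k.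
by exists n => // k /= nk; exact: le_trans (hn k nk).
Qed.

Theorem theorem3p2 (R : realType) (gamma theta0 : R)
    (hgamma0 : 0 < gamma) (hgamma1 : gamma < 1)
    (htheta0 : 0 < theta0) (htheta0_lt : theta0 < pi / 2)
    (K : R.-pker R ~> R) (hK : markov_on_angles K)
    (d : measure_display) (Omega : measurableType d) (P : probability Omega R)
    (zeta : nat -> {RV P >-> (R * R * R)%type}) (beta : nat -> {RV P >-> R})
    (hzeta : collisions_process gamma htheta0 K zeta beta)
    (hB1 : concentrated theta0 K)
    (kappa : R -> R -> R) (hB2 : regular_density K kappa)
    (hB3 : uniformly_positive K)
    (mu : probability R R) (hB4 : unique_invariant_probability K mu)
    (varpi : R -> R) (hvarpi : density_on_angles mu varpi)
    (hrho1 : forall alpha, alpha \in angles -> rho1 kappa alpha = 0) :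
  (gamma_c0 varpi < gamma -> transient zeta) /\
  (gamma < gamma_c0 varpi -> recurrent zeta).
Proof.
have g01 : 0 < gamma < 1 by rewrite hgamma0.
pose T2 := (fun x : R => tan x ^+ 2) \_ `[- theta0, theta0].
pose rho : R := \int[mu]_(x in angles) T2 x.
have rho0 : 0 <= rho.
  by apply: Rintegral_ge0 => x _; rewrite /T2 patchE; case: ifP => _ //; exact: sqr_ge0.
have gcE : gamma_c0 varpi = rho / (1 + 2 * rho).
  by rewrite /gamma_c0 -(mean_tan_sqr htheta0_lt hB1 hB4.1 hvarpi).
(* [k0] has the sign of gamma - gamma_c0. With the p below, |2 p rho| is at most |k0| / 2, so k0 + 2
   p rho keeps the sign of [k0] while p has the opposite one; [rho + 1] keeps the denominator
   positive. *)
pose k0 : R := 2 * (gamma * (1 + 2 * rho) - rho).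
pose p : R := - k0 / (4 * (rho + 1)).
have neg : k0 != 0 -> p * (k0 + 2 * p * rho) < 0.
  move=> k00; have q0 : 0 < k0 ^+ 2 by rewrite exprn_even_gt0.
  have r1 : 0 < 4 * (rho + 1) by lra.
  have -> : p * (k0 + 2 * p * rho) = - (k0 ^+ 2 * (rho + 2) / (8 * (rho + 1) ^+ 2)).
    by rewrite /p; field; lra.
  by rewrite oppr_lt0; apply: divr_gt0; apply: mulr_gt0 => //; [lra|apply: exprn_gt0; lra].
have drift n0 := drift_function g01 htheta0_lt hK hB1 hB2 hB4 hrho1 (erefl rho) (neg n0) hzeta.
rewrite gcE; split=> [|] hg.
- have k0p : 0 < k0.
    by move: hg; rewrite ltr_pdivrMr /k0; lra.
  have [x [V [x0 mV VB step]]] := drift (lt0r_neq0 k0p).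
  have p0 : p < 0 by rewrite /p mulNr oppr_lt0 divr_gt0//; lra.
  apply: (transient_of_supermartingale p0 x0 mV VB step) => L.
  have [c [delta [c0 delta0 grow]]] := growth_probability g01 htheta0_lt hB1 hB2 hB3 hzeta.
  by apply: (unbounded_ae L c0 delta0 _ grow) => n w; have [] := collisions_state n w g01 hzeta.
- have k0n : k0 < 0.
    by move: hg; rewrite ltr_pdivlMr /k0; lra.
  have [x [V [x0 mV VB step]]] := drift (ltr0_neq0 k0n).
  have p0 : 0 < p by rewrite /p divr_gt0//; lra.
  exact: (recurrent_of_supermartingale p0 x0 mV VB step).
Qed.
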